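(* Let $n\geq1$ and let $V$ be a simple object of the category $\mathcal{O}_{\mathrm{int}}$ of $sl_\infty$. Then $\phi_n(\chi(V))$ is the character of an actual representation of $\hat{sl}_{n+1}$; that is, in the decomposition $$\phi_n(\chi(V))=\sum_Wn_W\,\chi_n(W),\qquad n_W\in\mathbb{Z},$$ where the sum is over the isomorphism classes $W$ of simple integrable representations of $\hat{sl}_{n+1}$ in the category $\mathcal{O}$, one has $n_W\geq0$ for every $W$.
   Context: $sl_\infty$ is the complex Lie algebra defined by the Serre presentation with Chevalley generators $x_i^\pm,h_i$ ($i\in\mathbb{Z}$) associated with the Cartan matrix $C_{i,i}=2$, $C_{i,i+1}=C_{i+1,i}=-1$, $C_{i,j}=0$ if $i-j\notin\{-1,0,1\}$ ($i,j\in\mathbb{Z}$). $P=\bigoplus_{i\in\mathbb{Z}}\mathbb{Z}\Lambda_i$, $\alpha_i=2\Lambda_i-\Lambda_{i+1}-\Lambda_{i-1}$, $Q^+=\sum_{i\in\mathbb{Z}}\mathbb{N}\alpha_i$. For a representation $V$ and $\nu=\sum\nu_i\Lambda_i\in P$, $V_\nu=\{v\in V\mid h_iv=\nu_iv\ \forall i\in\mathbb{Z}\}$. $\mathcal{O}_{\mathrm{int}}$ is the category of representations $V=\bigoplus_{\nu\in P}V_\nu$ with all $V_\nu$ finite-dimensional, such that there are $\lambda_1,\dots,\lambda_N\in P$ with $\{\nu\mid V_\nu\neq0\}\subset\bigcup_j(\lambda_j-Q^+)$, and such that for all $\nu\in P$, $i\in\mathbb{Z}$ one has $V_{\nu\pm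 N\alpha_i}=0$ for $N$ large enough. $\chi(V)=\sum_{\nu\in P}\dim(V_\nu)e(\nu)$. Simple objects are the simple highest weight modules with highest weight in $\bigoplus_i\mathbb{N}\Lambda_i$. Let $I_n=\mathbb{Z}/(n+1)\mathbb{Z}$ and let $[i]$ be the image of $i\in\mathbb{Z}$ in $I_n$. $\hat{sl}_{n+1}$ is the affine Kac-Moody algebra of type $A_n^{(1)}$, with fundamental weights $\Lambda_i$ and simple roots $\alpha_i$ ($i\in I_n$); its weights are taken in $\bigoplus_{i\in I_n}\mathbb{Z}\Lambda_i\oplus\mathbb{Z}\delta$, $\delta=\sum_{i\in I_n}\alpha_i$, so that the simple roots are linearly independent. $\chi_n$ denotes the character map for representations of $\hat{sl}_{n+1}$, $\chi_n(W)=\sum_\mu\dim(W_\mu)e(\mu)$. The map $\phi_n$ is induced by $\Lambda_i\mapsto\Lambda_{[i]}$ and is applied termwise to characters: for $V$ simple with highest weight $\lambda=\sum_i\lambda_i\Lambda_i$, and $m_j\in\mathbb{N}$ almost all zero, $\phi_n\big(e(\lambda-\sum_jm_j\alpha_j)\big)=e\big(\sum_i\lambda_i\Lambda_{[i]}-\sum_jm_j\alpha_{[j]}\big)$. It is known (by Weyl group invariance) that $\phi_n(\chi(V))$ lies in the image of $\chi_n$, so a decomposition with $n_W\in\mathbb{Z}$ exists. *)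

(* Defs.v *)
From HB Require Import structures.
From mathcomp Require Import all_boot all_order all_algebra.
From mathcomp Require Import finmap.
From mathcomp Require Import boolp classical_sets cardinality fsbigop reals.
From mathcomp Require Import complex.
From mathcomp Require Import monalg.

Set Implicit Arguments.
Unset Strict Implicit.
Unset Printing Implicit Defensive.

Import GRing.Theory Num.Theory.
Local Open Scope ring_scope.
Local Open Scope classical_set_scope.
Local Open Scope quotient_scope.

Record lieAlgebra (K : fieldType) := LieAlgebra {
  lie_sort :> lmodType K;
  bracket : lie_sort -> lie_sort -> lie_sort;
  bracket_linearl : forall y, linear (bracket^~ y);
  bracket_linearr : forall x, linear (bracket x);
  bracketxx : forall x, bracket x x = 0;
  jacobi : forall x y z,
    bracket x (bracket y z) + bracket y (bracket z x) +
      bracket z (bracket x y) = 0 }.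

Section Presentation.
Variables (K : fieldType) (X : Type).

Inductive lie_term :=
  | LGen of X
  | LZero
  | LAdd of lie_term & lie_term
  | LScale of K & lie_term
  | LBr of lie_term & lie_term.

(* [E s t] means that the presentation contains the relation [s = t]. *)
Variable E : lie_term -> lie_term -> Prop.

Inductive lie_cong : lie_term -> lie_term -> Prop :=
  | lc_rel s t : E s t -> lie_cong s t
  | lc_refl t : lie_cong t t
  | lc_sym s t : lie_cong s t -> lie_cong t s
  | lc_trans s t u : lie_cong s t -> lie_cong t u -> lie_cong s u
  | lc_add s s' t t' : lie_cong s s' -> lie_cong t t' ->
      lie_cong (LAdd s t) (LAdd s' t')
  | lc_scale a t t' : lie_cong t t' -> lie_cong (LScale a t) (LScale a t')
  | lc_br s s' t t' : lie_cong s s' -> lie_cong t t' ->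
      lie_cong (LBr s t) (LBr s' t')
  | lc_addA s t u : lie_cong (LAdd s (LAdd t u)) (LAdd (LAdd s t) u)
  | lc_addC s t : lie_cong (LAdd s t) (LAdd t s)
  | lc_add0 t : lie_cong (LAdd LZero t) t
  | lc_addN t : lie_cong (LAdd (LScale (-1) t) t) LZero
  | lc_scaleA a b t : lie_cong (LScale a (LScale b t)) (LScale (a * b) t)
  | lc_scale1 t : lie_cong (LScale 1 t) t
  | lc_scaleDr a s t :
      lie_cong (LScale a (LAdd s t)) (LAdd (LScale a s) (LScale a t))
  | lc_scaleDl a b t :
      lie_cong (LScale (a + b) t) (LAdd (LScale a t) (LScale b t))
  | lc_br_linl a s t u :
      lie_cong (LBr (LAdd (LScale a s) t) u)
               (LAdd (LScale a (LBr s u)) (LBr t u))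
  | lc_br_linr a s t u :
      lie_cong (LBr u (LAdd (LScale a s) t))
               (LAdd (LScale a (LBr u s)) (LBr u t))
  | lc_brxx t : lie_cong (LBr t t) LZero
  | lc_jacobi s t u :
      lie_cong
        (LAdd (LAdd (LBr s (LBr t u)) (LBr t (LBr u s))) (LBr u (LBr s t)))
        LZero.

HB.instance Definition _ := gen_eqMixin lie_term.
HB.instance Definition _ := gen_choiceMixin lie_term.

Definition lie_congb (s t : lie_term) : bool := `[< lie_cong s t >].

Lemma lie_congb_refl : reflexive lie_congb.
Proof. by move=> t; apply/asboolP/lc_refl. Qed.

Lemma lie_congb_sym : symmetric lie_congb.
Proof. by move=> s t; apply/asboolP/asboolP => /lc_sym. Qed.

Lemma lie_congb_trans : transitive lie_congb.
Proof.
by move=> t s u /asboolP st /asboolP tu; apply/asboolP; apply: lc_trans tu.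
Qed.

Canonical lie_congb_equiv :=
  EquivRel lie_congb lie_congb_refl lie_congb_sym lie_congb_trans.

Definition presented_sort := {eq_quot lie_congb}.
HB.instance Definition _ := Choice.on presented_sort.

Definition lie_class (t : lie_term) : presented_sort := \pi_presented_sort t.

Lemma presentedP s t :
  lie_class s = lie_class t <-> lie_cong s t.
Proof.
split=> [/eqmodP/asboolP //|st]; by apply/eqmodP/asboolP.
Qed.

Let clsK (x : presented_sort) : lie_class (repr x) = x. Proof. exact: reprK. Qed.
Let reprc t : lie_cong (repr (lie_class t)) t. Proof. by apply/presentedP/reprK. Qed.

Definition presented_zero := lie_class LZero.
Definition presented_add (x y : presented_sort) := lie_class (LAdd (repr x) (repr y)).
Definition presented_opp (x : presented_sort) := lie_class (LScale (-1) (repr x)).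
Definition presented_scale a (x : presented_sort) := lie_class (LScale a (repr x)).
Definition presented_br (x y : presented_sort) := lie_class (LBr (repr x) (repr y)).

Let addE s t : presented_add (lie_class s) (lie_class t) = lie_class (LAdd s t).
Proof. by apply/presentedP/lc_add; apply: reprc. Qed.
Let oppE t : presented_opp (lie_class t) = lie_class (LScale (-1) t).
Proof. by apply/presentedP/lc_scale/reprc. Qed.
Let scaleE a t : presented_scale a (lie_class t) = lie_class (LScale a t).
Proof. by apply/presentedP/lc_scale/reprc. Qed.
Let brE s t : presented_br (lie_class s) (lie_class t) = lie_class (LBr s t).
Proof. by apply/presentedP/lc_br; apply: reprc. Qed.

Let addA : associative presented_add.
Proof.
move=> x y z; rewrite -(clsK x) -(clsK y) -(clsK z) !addE.
exact/presentedP/lc_addA.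
Qed.
Let addC : commutative presented_add.
Proof.
by move=> x y; rewrite -(clsK x) -(clsK y) !addE; apply/presentedP/lc_addC.
Qed.
Let add0 : left_id presented_zero presented_add.
Proof. by move=> x; rewrite -(clsK x) addE; apply/presentedP/lc_add0. Qed.
Let addN : left_inverse presented_zero presented_opp presented_add.
Proof. by move=> x; rewrite -(clsK x) oppE addE; apply/presentedP/lc_addN. Qed.

HB.instance Definition _ :=
  GRing.isZmodule.Build presented_sort addA addC add0 addN.

Lemma presented_addE s t :
  lie_class s + lie_class t = lie_class (LAdd s t).
Proof. exact: addE. Qed.

Let scaleA a b x :
  presented_scale a (presented_scale b x) = presented_scale (a * b) x.
Proof. by rewrite -(clsK x) !scaleE; apply/presentedP/lc_scaleA. Qed.
Let scale1 : left_id 1 presented_scale.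
Proof. by move=> x; rewrite -(clsK x) scaleE; apply/presentedP/lc_scale1. Qed.
Let scaleDr : right_distributive presented_scale +%R.
Proof.
move=> a x y; rewrite -(clsK x) -(clsK y) presented_addE !scaleE presented_addE.
exact/presentedP/lc_scaleDr.
Qed.
Let scaleDl x : {morph presented_scale^~ x : a b / a + b}.
Proof.
by move=> a b; rewrite -(clsK x) !scaleE presented_addE; apply/presentedP/lc_scaleDl.
Qed.

HB.instance Definition _ :=
  GRing.Zmodule_isLmodule.Build K presented_sort scaleA scale1 scaleDr scaleDl.

Lemma presented_scaleE a t :
  a *: lie_class t = lie_class (LScale a t).
Proof. exact: scaleE. Qed.

Lemma presented_brE s t :
  presented_br (lie_class s) (lie_class t) = lie_class (LBr s t).
Proof. exact: brE. Qed.

Lemma presented_br_linearl y : linear (presented_br^~ y).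
Proof.
move=> a x z; rewrite -(clsK x) -(clsK y) -(clsK z).
rewrite presented_scaleE presented_addE !presented_brE presented_scaleE
  presented_addE.
exact/presentedP/lc_br_linl.
Qed.

Lemma presented_br_linearr y : linear (presented_br y).
Proof.
move=> a x z; rewrite -(clsK x) -(clsK y) -(clsK z).
rewrite presented_scaleE presented_addE !presented_brE presented_scaleE
  presented_addE.
exact/presentedP/lc_br_linr.
Qed.

Lemma presented_brxx x : presented_br x x = 0.
Proof. by rewrite -(clsK x) presented_brE; apply/presentedP/lc_brxx. Qed.

Lemma presented_jacobi x y z :
  presented_br x (presented_br y z) + presented_br y (presented_br z x) +
    presented_br z (presented_br x y) = 0.
Proof.
rewrite -(clsK x) -(clsK y) -(clsK z).
rewrite !presented_brE !presented_addE.
exact/presentedP/lc_jacobi.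
Qed.

Definition presented_lie : lieAlgebra K :=
  LieAlgebra presented_br_linearl presented_br_linearr presented_brxx
    presented_jacobi.

Definition presented_gen (x : X) : presented_lie :=
  lie_class (LGen x).

End Presentation.

Arguments LZero {K X}.

Record lieRep (K : fieldType) (g : lieAlgebra K) := LieRep {
  rep_sort :> lmodType K;
  act : g -> rep_sort -> rep_sort;
  act_linearl : forall v, linear (act^~ v);
  act_linearr : forall x, linear (act x);
  act_bracket : forall x y v,
    act (bracket x y) v = act x (act y v) - act y (act x v) }.

Section Representations.
Variables (K : fieldType) (g : lieAlgebra K).

Definition subrep (V : lieRep g) (S : set V) : Prop :=
  [/\ S 0, forall (a : K) u v, S u -> S v -> S (a *: u + v)
    & forall x v, S v -> S (act x v)].

Definition simple_rep (V : lieRep g) : Prop :=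
  (exists v : V, v != 0) /\
  forall S : set V, subrep S -> S = [set 0] \/ S = setT.

Definition rep_iso (V W : lieRep g) : Prop :=
  exists2 f : {linear V -> W}, bijective f &
    forall x v, f (act x v) = act x (f v).

End Representations.

Section Dimension.
Variables (K : fieldType) (V : lmodType K).

(* To be used for linear subspaces [S] only. *)
Definition has_dim (S : set V) (d : nat) : Prop :=
  exists b : 'I_d -> V, (forall i, S (b i)) /\
    forall v, S v -> exists! c : 'rV[K]_d, v = \sum_(i < d) c 0 i *: b i.

(* The value is 0 when [S] is infinite-dimensional. *)
Definition dimension (S : set V) : nat := xget 0%N [set d | has_dim S d].

End Dimension.

(* The Cartan subalgebra is spanned by [torus], which contains the simple
   coroots and possibly further elements (such as the degree operator of an
   affine algebra); [pairing mu t] is the value of the weight [mu] at [t]. *)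
Record rootDatum := RootDatum {
  simple_index : eqType;
  torus : Type;
  weight : zmodType;
  pairing : weight -> torus -> int;
  coroot : simple_index -> torus;
  sroot : simple_index -> weight }.

Definition cartan (D : rootDatum) (i j : simple_index D) : int :=
  pairing (sroot j) (coroot i).

Inductive chevalley (D : rootDatum) :=
  | Xplus of simple_index D
  | Xminus of simple_index D
  | Tor of torus D.
Arguments Xplus {D}.
Arguments Xminus {D}.
Arguments Tor {D}.

Section KacMoody.
Variables (K : fieldType) (D : rootDatum).

Local Notation term := (lie_term K (chevalley D)).
Local Notation xp i := (LGen K (Xplus i)).
Local Notation xm i := (LGen K (Xminus i)).
Local Notation hh t := (LGen K (Tor t)).

(* In the Serre relations [cartan i j <= 0], so that the exponent
   [1 - cartan i j] is a positive integer. *)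
Inductive serre_rel : term -> term -> Prop :=
  | serre_tor s t : serre_rel (LBr (hh s) (hh t)) LZero
  | serre_tor_plus t j :
      serre_rel (LBr (hh t) (xp j))
                (LScale (pairing (sroot j) t)%:~R (xp j))
  | serre_tor_minus t j :
      serre_rel (LBr (hh t) (xm j))
                (LScale (- (pairing (sroot j) t)%:~R) (xm j))
  | serre_plus_minus i j :
      serre_rel (LBr (xp i) (xm j))
                (if i == j then hh (coroot i) else LZero)
  | serre_plus i j : i != j ->
      serre_rel (iter `|1 - cartan i j|%N (LBr (xp i)) (xp j)) LZero
  | serre_minus i j : i != j ->
      serre_rel (iter `|1 - cartan i j|%N (LBr (xm i)) (xm j)) LZero.

Definition kac_moody : lieAlgebra K := presented_lie serre_rel.

Definition raising (i : simple_index D) : kac_moody := presented_gen _ (Xplus i).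
Definition lowering (i : simple_index D) : kac_moody := presented_gen _ (Xminus i).
Definition toral (t : torus D) : kac_moody := presented_gen _ (Tor t).

Implicit Types V W : lieRep kac_moody.

Definition weight_space V (nu : weight D) : set V :=
  [set v | forall t, act (toral t) v = (pairing nu t)%:~R *: v].
Arguments weight_space V nu : clear implicits.

Definition is_weight V (nu : weight D) : Prop :=
  exists2 v : V, v != 0 & weight_space V nu v.

(* [character V nu] is the coefficient of [e(nu)] in the character of [V]. *)
Definition character V (nu : weight D) : nat := dimension (weight_space V nu).

Definition weight_direct_sum V : Prop :=
  (forall v : V, exists (s : seq (weight D)) (u : weight D -> V),
     (forall nu, weight_space V nu (u nu)) /\ v = \sum_(nu <- s) u nu) /\
  (forall (s : seq (weight D)) (u : weight D -> V), uniq s ->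
     (forall nu, weight_space V nu (u nu)) -> \sum_(nu <- s) u nu = 0 ->
     forall nu, nu \in s -> u nu = 0).

Definition Qplus : set (weight D) :=
  [set \sum_(i <- s) sroot i | s in [set: seq (simple_index D)]].

Definition category_O V : Prop :=
  [/\ weight_direct_sum V,
      forall nu, exists d, has_dim (weight_space V nu) d
    & exists lams : seq (weight D), forall nu, is_weight V nu ->
        exists2 lam, lam \in lams & Qplus (lam - nu)].

Definition category_Oint V : Prop :=
  category_O V /\
  forall nu i, exists N0, forall N, (N0 <= N)%N ->
    ~ is_weight V (nu + sroot i *+ N) /\ ~ is_weight V (nu - sroot i *+ N).

Definition integrable V : Prop :=
  forall i (v : V), exists N,
    iter N (act (raising i)) v = 0 /\ iter N (act (lowering i)) v = 0.

Definition simple_integrable V : Prop :=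
  [/\ simple_rep V, integrable V & category_O V].

Definition is_highest_weight V (lam : weight D) : Prop :=
  exists v : V, [/\ v != 0, weight_space V lam v,
    forall i, act (raising i) v = 0
    & forall S : set V, subrep S -> S v -> S = setT].

(* Arbitrary if [V] is not a highest weight module. *)
Definition highest_weight V : weight D :=
  xget 0 [set lam | is_highest_weight V lam].

(* The formal character [f] equals [\sum_W n_W chi(W)], [W] running over the
   isomorphism classes of simple integrable representations in the category O:
   [n] is a function on isomorphism classes and, for each weight [mu], the
   [W j] represent without repetition finitely many classes, among which all
   those that contribute to the coefficient of [e(mu)]. *)
Definition is_decomposition (f : weight D -> nat)
    (n : lieRep kac_moody -> int) : Prop :=
  (forall V W, rep_iso V W -> n V = n W) /\
  forall mu, exists (k : nat) (W : 'I_k -> lieRep kac_moody),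
    [/\ forall j, simple_integrable (W j),
        forall i j, rep_iso (W i) (W j) -> i = j,
        forall V, simple_integrable V -> n V != 0 -> is_weight V mu ->
          exists j, rep_iso V (W j)
      & (f mu)%:Z = \sum_(j < k) n (W j) * (character (W j) mu)%:Z].

End KacMoody.

Arguments weight_space {K D} V nu.

Local Notation P := {malg int[int]}.

Definition fund (i : int) : P := << i >>.
Definition alpha (i : int) : P := fund i *+ 2 - fund (i + 1) - fund (i - 1).

Definition slinf_datum : rootDatum :=
  @RootDatum int int P (fun nu i => nu@_i) id alpha.

Definition slinf (K : fieldType) : lieAlgebra K := kac_moody K slinf_datum.

Lemma cartan_slinfE (i j : int) :
  @cartan slinf_datum i j =
    if i == j then 2 else if (i == j + 1) || (j == i + 1) then -1 else 0.
Proof.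
rewrite /cartan /= /alpha /fund !mcoeffB mcoeffMn !mcoeffU.
have -> : (j - 1 == i) = (j == i + 1) by rewrite subr_eq.
rewrite (eq_sym j i) (eq_sym (j + 1) i).
case: eqP => [->|_].
  by rewrite -[X in X == _]addr0 (inj_eq (addrI j)).
case: eqP => [->|_] //=; case: eqP => // /eqP.
by rewrite -addrA -[X in X == _]addr0 (inj_eq (addrI j)).
Qed.

(* ['I_n.+1] is used as Z/(n+1)Z, via its canonical additive group structure. *)
Section Affine.
Variable n : nat.

Definition residue (i : int) : 'I_n.+1 := inZp `|(i %% n.+1)%Z|%N.

(* The pair [(c, d)] stands for [\sum_i c_i Lambda_i + d delta]. *)
Definition aff_weight : zmodType := ({ffun 'I_n.+1 -> int} * int)%type.

Definition aff_fund (i : 'I_n.+1) : aff_weight :=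
  ([ffun j => (j == i)%:R], 0).

Definition aff_delta : aff_weight := (0, 1).

(* For [n = 1], [i + 1 = i - 1] and the off-diagonal Cartan integers are -2.
   The term in [aff_delta] ensures that [\sum_i aff_alpha i = aff_delta]. *)
Definition aff_alpha (i : 'I_n.+1) : aff_weight :=
  aff_fund i *+ 2 - aff_fund (i + inZp 1) - aff_fund (i - inZp 1) +
    aff_delta *+ (i == 0).

Lemma sum_aff_alpha : \sum_i aff_alpha i = aff_delta.
Proof.
have sd : \sum_i aff_delta *+ (i == 0 :> 'I_n.+1) = aff_delta.
  rewrite (bigD1 (0 : 'I_n.+1)) //= big1 ?addr0 ?eqxx // => i /negPf ->.
  by rewrite mulr0n.
have sh a : \sum_i aff_fund (i + a) = \sum_i aff_fund i.
  by rewrite [RHS](reindex_inj (addIr a)).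
by rewrite /aff_alpha !big_split /= sd !sumrN !sh addrK subrr add0r.
Qed.

(* The torus element [None] is the degree operator [d], on which the
   fundamental weights vanish and [delta] takes the value 1. *)
Definition affine_datum : rootDatum :=
  @RootDatum 'I_n.+1 (option 'I_n.+1) aff_weight
    (fun mu t => if t is Some i then mu.1 i else mu.2) Some aff_alpha.

Definition affine (K : fieldType) : lieAlgebra K := kac_moody K affine_datum.

(* The exponents of [phi_n (e (lam - \sum_j m_j alpha_j))] and of its
   argument. *)
Definition fold_weight (lam : P) (m : {fsfun int -> nat with 0%N}) :
    aff_weight :=
  \sum_(i <- msupp lam) aff_fund (residue i) *~ lam@_i -
  \sum_(j <- finsupp m) aff_alpha (residue j) *+ m j.

Definition lower_weight (lam : P) (m : {fsfun int -> nat with 0%N}) : P :=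
  lam - \sum_(j <- finsupp m) alpha j *+ m j.

(* The coefficient of [e(mu)] in [phi_n (chi V)], for [V] simple in O_int. The
   weights of [V] are the [lower_weight lam m], for distinct [m]. A sum over a
   classical set is 0 when infinitely many terms are nonzero; here only finitely
   many are, since the support of [m] is linked to that of [lam] whenever
   [lower_weight lam m] is a weight of [V], and [mu] determines [\sum_j m_j]. *)
Definition folded_character (K : fieldType) (V : lieRep (slinf K))
    (mu : weight affine_datum) : nat :=
  let lam := highest_weight V in
  \big[addn/0%N]_(m \in [set m | fold_weight lam m = mu])
    character V (lower_weight lam m).

End Affine.

Arguments folded_character n {K} V mu.

(* Main.v *)
From HB Require Import structures.
Require Import Defs.
From mathcomp Require Import all_boot all_order all_algebra.
From mathcomp Require Import finmap.
From mathcomp Require Import boolp classical_sets fsbigop reals.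
From mathcomp Require Import complex.
From mathcomp Require Import monalg.
From mathcomp Require Import zify.

Set Implicit Arguments.
Unset Strict Implicit.
Unset Printing Implicit Defensive.

Import Order.TTheory GRing.Theory Num.Theory.
Local Open Scope ring_scope.
Local Open Scope classical_set_scope.

(** The folded character is the character of [V] itself, for another action.

    Let [V] be simple with highest weight [lam]. It is spanned by the words in
    the lowering operators applied to a highest weight vector, and a letter [j]
    which is far from the support of [lam] and from the other letters of a word
    commutes with them and kills the highest weight vector. So every vector of
    [V] is killed by all but finitely many Chevalley generators
    ([locally_finite]), and the infinite sums of the [x_j] with [j] of residue
    [r], as well as all infinite linear combinations of the [h_j], act on [V]
    ([lf_op]). These operators satisfy the relations of the affine algebra
    ([fold_op_rel]): on each vector they are elements of sl_infinity, where the
    relations follow from the fact that the [x_j] of one residue commute and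
    that a given [x_l] has at most two neighbours of that residue, each with
    [ad(x_j)^2 x_l = 0] ([fold_serre]). The degree operator is a combination of
    the [h_j] whose coefficients have the appropriate second difference, plus a
    constant ([kap], [kap_shift]). The resulting module [folded_rep] is integrable
    ([folded_integrable]), because commuting locally nilpotent operators have
    locally nilpotent sums ([nilpotent_sum]), and each of its weight spaces is a
    finite direct sum of weight spaces of [V], which gives the character
    ([character_folded]).

    A nonnegative decomposition of the character of an integrable module of the
    category O is obtained by peeling off simple modules ([good_step]): a vector
    of maximal weight generates a highest weight module, the simple quotient of
    which is split off, and the rest is replaced by the direct sum of its two
    layers, which changes no character. Every weight is exhausted after finitely
    many steps ([simple_sequence]), so that counting the simple modules of each
    class decomposes the character ([good_decomposition]).

    Any other decomposition has the same coefficients ([decomposition_uniq]), by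
    comparison at a maximal highest weight. This needs that, when the highest
    weight of a simple integrable module [U] is a weight of an integrable module
    [U'], all the weights of [U] are weights of [U'] ([weights_sub]); otherwise
    an infinite ascending chain of classes could cancel. *)

(** * Dimensions of subspaces *)

Section LinearAlgebra.
Variables (K : fieldType) (V : lmodType K).
Implicit Types (S T : set V) (u v : V).

Definition subspace S : Prop :=
  S 0 /\ forall (a : K) u v, S u -> S v -> S (a *: u + v).

Definition comb d (b : 'I_d -> V) (c : 'rV[K]_d) : V := \sum_i c 0 i *: b i.

Definition free_family d (b : 'I_d -> V) : Prop :=
  forall c, comb b c = 0 -> c = 0.

Lemma subspaceZ S a u : subspace S -> S u -> S (a *: u).
Proof. by case=> S0 SL Su; have := SL a u 0 Su S0; rewrite addr0. Qed.

Lemma subspaceD S u v : subspace S -> S u -> S v -> S (u + v).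
Proof. by case=> S0 SL Su Sv; have := SL 1 u v Su Sv; rewrite scale1r. Qed.

Lemma subspaceN S u : subspace S -> S u -> S (- u).
Proof. by move=> sS Su; rewrite -scaleN1r; apply: subspaceZ. Qed.

Lemma subspaceB S u v : subspace S -> S u -> S v -> S (u - v).
Proof. by move=> sS Su Sv; apply: subspaceD => //; apply: subspaceN. Qed.

Lemma subspace_sum S (I : Type) (r : seq I) (P : pred I) (F : I -> V) :
  subspace S -> (forall i, P i -> S (F i)) -> S (\sum_(i <- r | P i) F i).
Proof.
move=> sS SF; elim/big_rec: _ => [|i x Pi Sx]; first by case: sS.
by apply: subspaceD => //; apply: SF.
Qed.

Lemma subspace_sum_in S (I : eqType) (r : seq I) (F : I -> V) :
  subspace S -> (forall i, i \in r -> S (F i)) -> S (\sum_(i <- r) F i).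
Proof. by move=> sS SF; rewrite big_seq; apply: subspace_sum. Qed.

Lemma subspace0 : subspace [set 0 : V].
Proof. by split=> // a u v -> ->; rewrite scaler0 addr0. Qed.

Lemma combE d (b : 'I_d -> V) a (c c' : 'rV[K]_d) :
  comb b (a *: c + c') = a *: comb b c + comb b c'.
Proof.
rewrite /comb scaler_sumr -big_split; apply: eq_bigr => i _.
by rewrite !mxE scalerDl scalerA.
Qed.

Lemma combB d (b : 'I_d -> V) (c c' : 'rV[K]_d) :
  comb b (c - c') = comb b c - comb b c'.
Proof.
by have -> : c - c' = -1 *: c' + c; rewrite ?combE scaleN1r addrC.
Qed.

Lemma comb_mul d e (b : 'I_d -> V) (w : 'I_e -> V) (A : 'M[K]_(e, d)) c :
  (forall i, w i = comb b (row i A)) -> comb w c = comb b (c *m A).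
Proof.
move=> wE; rewrite /comb.
under eq_bigr => i _ do rewrite wE /comb scaler_sumr.
rewrite exchange_big; apply: eq_bigr => j _ /=.
rewrite mxE scaler_suml; apply: eq_bigr => i _.
by rewrite scalerA mxE.
Qed.

Lemma subspace_comb S d (b : 'I_d -> V) c :
  subspace S -> (forall i, S (b i)) -> S (comb b c).
Proof. by move=> sS Sb; apply: subspace_sum => // i _; apply: subspaceZ. Qed.

Lemma has_dimP S d : subspace S ->
  has_dim S d <-> exists b : 'I_d -> V,
    [/\ forall i, S (b i), free_family b & forall v, S v -> exists c, v = comb b c].
Proof.
move=> sS; split=> [[b [Sb bP]]|[b [Sb fb gb]]].
  exists b; split=> // [c c0|v /bP [c [-> _]]]; last by exists c.
  have [c' [_ c'U]] := bP 0 sS.1.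
  rewrite -(c'U c) ?c0 //; apply: c'U.
  by rewrite big1 // => i _; rewrite mxE scale0r.
exists b; split=> // v /gb [c ->]; exists c; split=> // c' /esym c'E.
apply/eqP; rewrite -subr_eq0 -[_ == _]/(_ == _); apply/eqP/fb.
by rewrite combB -/(comb b c') in c'E *; rewrite -/(comb b c') -c'E /comb subrr.
Qed.

(** A family that a family of [d] vectors generates has a coordinate matrix
    with [d] columns, and freeness makes the rows of that matrix free. *)
Lemma free_family_le d e (b : 'I_d -> V) (w : 'I_e -> V) :
  free_family w -> (forall i, exists c, w i = comb b c) -> (e <= d)%N.
Proof.
move=> fw /choice [c wE]; pose A := \matrix_i c i.
have wA i : w i = comb b (row i A) by rewrite rowK.
suff /eqP <- : row_free A by apply: rank_leq_col.
by apply: inj_row_free => u uA; apply: fw; rewrite (comb_mul _ wA) uA;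
  rewrite /comb big1 // => i _; rewrite mxE scale0r.
Qed.

Lemma has_dim_inj S d e : subspace S -> has_dim S d -> has_dim S e -> d = e.
Proof.
move=> sS /(has_dimP _ sS) [b [Sb fb gb]] /(has_dimP _ sS) [w [Sw fw gw]].
apply/eqP; rewrite eqn_leq (free_family_le (b := w) fb) ?(free_family_le (b := b) fw) // => i.
  exact: gb.
exact: gw.
Qed.

Lemma dimensionE S d : subspace S -> has_dim S d -> dimension S = d.
Proof.
by move=> sS dS; apply: (has_dim_inj sS _ dS); apply: (xgetPex 0%N); exists d.
Qed.

Definition dim_le S d := forall e (w : 'I_e -> V),
  (forall i, S (w i)) -> free_family w -> (e <= d)%N.

Lemma has_dim_le S d : subspace S -> has_dim S d -> dim_le S d.
Proof.
move=> sS /(has_dimP _ sS) [b [Sb fb gb]] e w Sw fw.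
by apply: (free_family_le fw) => i; apply: gb.
Qed.

(** A free family of maximal size is a basis. *)
Lemma dim_le_has_dim S d : subspace S -> dim_le S d ->
  exists2 e, (e <= d)%N & has_dim S e.
Proof.
move=> sS dS.
pose Q e := `[< exists w : 'I_e -> V, (forall i, S (w i)) /\ free_family w >].
have Q0 : exists e, Q e.
  exists 0%N; apply/asboolP; exists (fun=> 0); split=> [[]//|c _].
  by apply/rowP => -[].
have Qle e : Q e -> (e <= d)%N by move=> /asboolP [w [Sw fw]]; apply: dS Sw fw.
case: (ex_maxnP Q0 Qle) => e /asboolP [w [Sw fw]] emax.
exists e; first exact: dS Sw fw.
apply/has_dimP => //; exists w; split=> // v Sv; apply: contrapT => vN.
suff : Q e.+1 by move=> /emax; rewrite ltnn.
apply/asboolP; exists (fun i => oapp w v (unlift ord0 i)); split=> [i|c].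
  by case: unliftP => [j _|_] /=.
rewrite /comb big_ord_recl unlift_none /= => c0.
have c00 : c 0 ord0 = 0.
  apply: contrapT => /eqP cn0; apply: vN.
  exists (\row_i - ((c 0 ord0)^-1 * c 0 (lift ord0 i))).
  move/eqP: c0; rewrite addr_eq0 => /eqP /(congr1 ( *:%R (c 0 ord0)^-1)).
  rewrite scalerA mulVf // scale1r => ->; rewrite scalerN -scaleNr scaler_sumr.
  by apply: eq_bigr => i _; rewrite liftK /= mxE scalerA mulNr.
suff /rowP cl : (\row_i c 0 (lift ord0 i)) = 0.
  apply/rowP => i; rewrite mxE; case: (unliftP ord0 i) => [j|] -> //.
  by have := cl j; rewrite !mxE.
apply: fw; rewrite -{}[RHS]c0 c00 scale0r add0r.
by apply: eq_bigr => i _; rewrite mxE liftK.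
Qed.

Lemma subspace_has_dim S T d : subspace S -> subspace T -> S `<=` T ->
  has_dim T d -> exists2 e, (e <= d)%N & has_dim S e.
Proof.
move=> sS sT ST dT; apply: dim_le_has_dim => // e w Sw fw.
by apply: (has_dim_le sT dT) fw => i; apply: ST.
Qed.

(** A basis of a subspace is extended by a basis of a complement, or by lifts
    of a basis of the quotient: the family [w] stands for either. *)
Lemma has_dim_extend S T d e (w : 'I_e -> V) : subspace S -> subspace T ->
  T `<=` S -> has_dim T d -> (forall i, S (w i)) ->
  (forall c, T (comb w c) -> c = 0) ->
  (forall v, S v -> exists c, T (v - comb w c)) -> has_dim S (d + e).
Proof.
move=> sS sT TS /(has_dimP _ sT) [b [Tb fb gb]] Sw fw gw.
pose z (i : 'I_(d + e)) := match split i with inl j => b j | inr j => w j end.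
have zE c : comb z c = comb b (lsubmx c) + comb w (rsubmx c).
  rewrite /comb big_split_ord /=; congr (_ + _); apply: eq_bigr => i _.
    by rewrite mxE /z (unsplitK (inl _ i)).
  by rewrite mxE /z (unsplitK (inr _ i)).
apply/has_dimP => //; exists z; split=> [i|c|v Sv].
- by rewrite /z; case: split => j //; apply: TS.
- rewrite zE => c0.
  have r0 : rsubmx c = 0.
    apply: fw; move/eqP: c0; rewrite addrC addr_eq0 => /eqP ->.
    by apply: subspaceN => //; apply: subspace_comb.
  have l0 : lsubmx c = 0.
    apply: fb; rewrite -c0 r0 [X in _ + X]big1 ?addr0 // => i _.
    by rewrite mxE scale0r.
  by rewrite -(hsubmxK c) l0 r0 row_mx0.
- have [c /gb [c' E]] := gw v Sv; exists (row_mx c' c).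
  by rewrite zE row_mxKl row_mxKr -E subrK.
Qed.

Lemma has_dim0 : has_dim [set 0 : V] 0.
Proof.
apply/(has_dimP _ subspace0); exists (fun=> 0); split=> [[]//|c _|v ->].
  by apply/rowP => -[].
by exists 0; rewrite /comb big_ord0.
Qed.

Lemma has_dim_add (S A B : set V) a b : subspace S -> subspace A -> subspace B ->
  A `<=` S -> B `<=` S -> (forall v, A v -> B v -> v = 0) ->
  (forall v, S v -> exists x y, [/\ A x, B y & v = x + y]) ->
  has_dim A a -> has_dim B b -> has_dim S (a + b).
Proof.
move=> sS sA sB AS BS AB SAB dA /(has_dimP _ sB) [w [Bw fw gw]].
apply: (has_dim_extend (T := A) (w := w)) => // [i|c Ac|v /SAB [x [y [Ax By ->]]]].
- exact: BS.
- by apply: fw; apply: AB => //; apply: subspace_comb.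
- by have [c ->] := gw y By; exists c; rewrite addrK.
Qed.

Lemma has_dim_pos S d v : subspace S -> has_dim S d -> S v -> v != 0 -> (0 < d)%N.
Proof.
move=> sS /(has_dimP _ sS) [b [Sb fb gb]] Sv v0; case: d b Sb fb gb => // b _ _ gb.
by case/negP: v0; have [c ->] := gb v Sv; rewrite /comb big_ord0.
Qed.

Lemma has_dim_eq0 S v : subspace S -> has_dim S 0 -> S v -> v = 0.
Proof. by move=> sS dS Sv; apply/eqP/negPn/negP => /(has_dim_pos sS dS Sv). Qed.

End LinearAlgebra.

Section RankNullity.
Variables (K : fieldType) (V U : lmodType K) (f : {linear V -> U}).

Lemma comb_linear d (b : 'I_d -> V) c : f (comb b c) = comb (f \o b) c.
Proof. by rewrite /comb linear_sum; apply: eq_bigr => i _; rewrite linearZ. Qed.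

Lemma subspace_image (S : set V) : subspace S -> subspace (f @` S).
Proof.
move=> sS; split; first by exists 0; [case: sS|rewrite linear0].
move=> a _ _ [x Sx <-] [y Sy <-]; exists (a *: x + y); last by rewrite linearP.
by case: sS => _; apply.
Qed.

Lemma subspace_preimage (S : set U) : subspace S -> subspace (f @^-1` S).
Proof.
move=> [S0 SL]; split; first by rewrite /preimage /= linear0.
by move=> a x y; rewrite /preimage /= linearP; apply: SL.
Qed.

Lemma subspaceI (S T : set V) : subspace S -> subspace T -> subspace (S `&` T).
Proof.
move=> [S0 SL] [T0 TL]; split=> // a u v [Su Tu] [Sv Tv].
by split; [apply: SL|apply: TL].
Qed.

Lemma has_dim_ker_image (S : set V) k r : subspace S ->
  has_dim (S `&` f @^-1` [set 0]) k -> has_dim (f @` S) r -> has_dim S (k + r).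
Proof.
move=> sS dk /(has_dimP _ (subspace_image sS)) [b [Sb fb gb]].
have sK : subspace (S `&` f @^-1` [set 0]).
  by apply: subspaceI => //; apply/subspace_preimage/subspace0.
have /choice [w wP] : forall i, exists x, S x /\ f x = b i.
  by move=> i; have [x Sx <-] := Sb i; exists x.
have fw c : f (comb w c) = comb b c.
  by rewrite comb_linear; apply: eq_bigr => i _ /=; rewrite (wP i).2.
apply: (has_dim_extend sS sK _ dk) => [v []//|i||v Sv].
- exact: (wP i).1.
- by move=> c [_]; rewrite /= fw; apply: fb.
have [|c E] := gb (f v); first by exists v.
exists c; split; last by rewrite /= linearB fw -E subrr.
by apply: subspaceB => //; apply: subspace_comb => // i; apply: (wP i).1.
Qed.

Lemma has_dim_image_inj (S : set V) d : subspace S -> injective f ->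
  has_dim S d -> has_dim (f @` S) d.
Proof.
move=> sS fI /(has_dimP _ sS) [b [Sb fb gb]].
apply/(has_dimP _ (subspace_image sS)); exists (f \o b); split=> [i|c|_ [v Sv <-]].
- by exists (b i).
- by rewrite -comb_linear -(linear0 f) => /fI/fb.
- by have [c ->] := gb v Sv; exists c; rewrite comb_linear.
Qed.

Lemma has_dim_image_le (S : set V) d : subspace S -> has_dim S d ->
  exists r, has_dim (f @` S) r.
Proof.
move=> sS dS; suff: dim_le (f @` S) d.
  by move=> /(dim_le_has_dim (subspace_image sS)) [r _ ?]; exists r.
move=> e w Sw fw; have /choice [w' w'P] : forall i, exists x, S x /\ f x = w i.
  by move=> i; have [x Sx <-] := Sw i; exists x.
apply: (has_dim_le sS dS (w := w')) => [i|c c0]; first by case: (w'P i).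
by apply: fw; rewrite -(linear0 f) -c0 comb_linear; apply: eq_bigr => i _ /=;
  case: (w'P i) => _ ->.
Qed.

End RankNullity.

Local Open Scope quotient_scope.

(** * Brackets *)

Section LieBracket.
Variables (K : fieldType) (L : lieAlgebra K).

Lemma bracket0r (x : L) : bracket x 0 = 0.
Proof.
by have := bracket_linearr x 1 0 0; rewrite /= !scale1r addr0 -[X in X = _]addr0 => /addrI.
Qed.

Lemma bracketDl (x y z : L) : bracket (x + y) z = bracket x z + bracket y z.
Proof. by have := bracket_linearl z 1 x y; rewrite /= !scale1r. Qed.

Lemma bracketDr (x y z : L) : bracket z (x + y) = bracket z x + bracket z y.
Proof. by have := bracket_linearr z 1 x y; rewrite /= !scale1r. Qed.

Lemma bracket0l (x : L) : bracket 0 x = 0.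
Proof.
by have := bracket_linearl x 1 0 0; rewrite /= !scale1r addr0 -[X in X = _]addr0 => /addrI.
Qed.

Lemma bracket_suml (I : Type) (s : seq I) (F : I -> L) z :
  bracket (\sum_(i <- s) F i) z = \sum_(i <- s) bracket (F i) z.
Proof. exact: (big_morph (fun x => bracket x z) (fun x y => bracketDl x y z) (bracket0l z)). Qed.

Lemma bracket_sumr (I : Type) (s : seq I) (F : I -> L) z :
  bracket z (\sum_(i <- s) F i) = \sum_(i <- s) bracket z (F i).
Proof. exact: (big_morph (bracket z) (fun x y => bracketDr x y z) (bracket0r z)). Qed.

Lemma bracketC (x y : L) : bracket x y = - bracket y x.
Proof.
apply/eqP; rewrite -addr_eq0; apply/eqP; have := bracketxx (x + y).
by rewrite bracketDl !bracketDr !bracketxx add0r addr0.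
Qed.

Lemma bracket_comm_ad (x y z : L) : bracket x y = 0 ->
  bracket x (bracket y z) = bracket y (bracket x z).
Proof.
move=> xy; have := jacobi x y z; rewrite xy bracket0r addr0 [bracket z x]bracketC.
have -> : bracket y (- bracket x z) = - bracket y (bracket x z).
  by have := bracket_linearr y (-1) (bracket x z) 0; rewrite /= bracket0r !addr0 !scaleN1r.
by move=> /eqP; rewrite subr_eq0 => /eqP.
Qed.

End LieBracket.

(** * Representations: subobjects, quotients, products *)

Section RepTheory.
Variables (K : fieldType) (g : lieAlgebra K).
Implicit Types (V W : lieRep g).

HB.instance Definition _ V x :=
  GRing.isLinear.Build K V V _ (@act K g V x) (@act_linearr K g V x).

Lemma act0l V (v : V) : act 0 v = 0.
Proof.
by have := act_linearl v 1 0 0; rewrite /= !scale1r addr0 -[X in X = _]addr0 => /addrI.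
Qed.

Lemma actDl V x y (v : V) : act (x + y) v = act x v + act y v.
Proof. by have := act_linearl v 1 x y; rewrite /= !scale1r. Qed.

Lemma actZl V a x (v : V) : act (a *: x) v = a *: act x v.
Proof. by have := act_linearl v a x 0; rewrite /= act0l !addr0. Qed.

Lemma act_suml V (I : Type) (r : seq I) (P : pred I) (F : I -> g) (v : V) :
  act (\sum_(i <- r | P i) F i) v = \sum_(i <- r | P i) act (F i) v.
Proof. exact: (big_morph (fun x => act x v) (fun x y => actDl x y v) (act0l v)). Qed.

Lemma subrep_subspace V (S : set V) : subrep S -> subspace S.
Proof. by case. Qed.

Lemma subrep_act V (S : set V) x v : subrep S -> S v -> S (act x v).
Proof. by case=> _ _; apply. Qed.

Lemma subrep_setT V : subrep [set: V].
Proof. by split. Qed.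

Lemma subrep_set0 V : subrep [set 0 : V].
Proof. by split=> [|a u v -> ->|x v ->]; rewrite ?scaler0 ?addr0 ?linear0. Qed.

Lemma linear_pack (V W : lmodType K) (f : V -> W) :
  linear f -> exists h : {linear V -> W}, h =1 f.
Proof.
move=> lf; pose fm := GRing.isLinear.Build K V W _ f lf.
pose h : {linear V -> W} := HB.pack f fm.
by exists h.
Qed.

Definition rep_hom V W (f : {linear V -> W}) :=
  forall x v, f (act x v) = act x (f v).

Lemma subrep_preimage V W (f : {linear V -> W}) (S : set W) :
  rep_hom f -> subrep S -> subrep (f @^-1` S).
Proof.
move=> fh sS; have [S0 SL] := subspace_preimage f (subrep_subspace sS).
by split=> // x v; rewrite /preimage /= fh; apply: subrep_act.
Qed.

Lemma subrep_image V W (f : {linear V -> W}) (S : set V) :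
  rep_hom f -> subrep S -> subrep (f @` S).
Proof.
move=> fh sS; have [S0 SL] := subspace_image f (subrep_subspace sS).
split=> // x _ [v Sv <-]; exists (act x v); last exact: fh.
exact: subrep_act.
Qed.

Lemma rep_iso_refl V : rep_iso V V.
Proof. by exists idfun => //; exists idfun. Qed.

Lemma rep_iso_sym V W : rep_iso V W -> rep_iso W V.
Proof.
move=> [f [f' fK f'K] fh].
have lf : linear f' by apply: can2_linear fK f'K.
have [h hE] := linear_pack lf; exists h.
  by exists f => x; rewrite hE ?fK ?f'K.
by move=> x v; rewrite !hE; apply: (can_inj fK); rewrite fh !f'K.
Qed.

Lemma rep_iso_trans V W U : rep_iso V W -> rep_iso W U -> rep_iso V U.
Proof.
move=> [f fb fh] [h hb hh]; exists (h \o f); first exact: bij_comp.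
by move=> x v /=; rewrite fh hh.
Qed.

Section SubRep.
Variables (V : lieRep g) (S : set V).
Hypothesis sS : subrep S.

(** The proof is an argument of the type, so that the module structure, which
    depends on it, can be inferred from the type. *)
Definition sub_sort (_ : subrep S) := {v : V | `[< S v >]}.
Local Notation sub := (sub_sort sS).
HB.instance Definition _ := Choice.on sub.

Let subP (u : sub) : S (val u). Proof. exact/asboolP/(valP u). Qed.
Let mk v (Sv : S v) : sub := exist _ v (introT (asboolP _) Sv).

Let add (u v : sub) := mk (subspaceD (subrep_subspace sS) (subP u) (subP v)).
Let opp (u : sub) := mk (subspaceN (subrep_subspace sS) (subP u)).
Let zero : sub := mk (subrep_subspace sS).1.
Let scale a (u : sub) := mk (subspaceZ a (subrep_subspace sS) (subP u)).
Let sact x (u : sub) := mk (subrep_act x sS (subP u)).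

Let addA : associative add.
Proof. by move=> x y z; apply: val_inj; rewrite /= addrA. Qed.
Let addC : commutative add.
Proof. by move=> x y; apply: val_inj; rewrite /= addrC. Qed.
Let add0 : left_id zero add.
Proof. by move=> x; apply: val_inj; rewrite /= add0r. Qed.
Let addN : left_inverse zero opp add.
Proof. by move=> x; apply: val_inj; rewrite /= addNr. Qed.
HB.instance Definition _ := GRing.isZmodule.Build sub addA addC add0 addN.

Let scaleA a b x : scale a (scale b x) = scale (a * b) x.
Proof. by apply: val_inj; rewrite /= scalerA. Qed.
Let scale1 : left_id 1 scale.
Proof. by move=> x; apply: val_inj; rewrite /= scale1r. Qed.
Let scaleDr : right_distributive scale +%R.
Proof. by move=> a x y; apply: val_inj; rewrite /= scalerDr. Qed.
Let scaleDl x : {morph scale^~ x : a b / a + b}.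
Proof. by move=> a b; apply: val_inj; rewrite /= scalerDl. Qed.
HB.instance Definition _ :=
  GRing.Zmodule_isLmodule.Build K sub scaleA scale1 scaleDr scaleDl.

Let sact_linearl u : linear (sact^~ u).
Proof. by move=> a x y; apply: val_inj; rewrite /= actDl actZl. Qed.
Let sact_linearr x : linear (sact x).
Proof. by move=> a u v; apply: val_inj; rewrite /= linearP. Qed.
Let sact_bracket x y u :
  sact (bracket x y) u = sact x (sact y u) - sact y (sact x u).
Proof. by apply: val_inj; rewrite /= act_bracket. Qed.

Definition sub_rep : lieRep g := LieRep sact_linearl sact_linearr sact_bracket.

Lemma sub_rep_spec : exists f : {linear sub_rep -> V},
  [/\ rep_hom f, injective f & forall v, S v <-> exists u, f u = v].
Proof.
have lf : linear (fun u : sub_rep => val (u : sub)) by [].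
have [f fE] := linear_pack lf; exists f; split.
- by move=> x v; rewrite !fE.
- by move=> u v; rewrite !fE => /val_inj.
- move=> v; split=> [Sv|[u <-]]; first by exists (mk Sv); rewrite fE.
  by rewrite fE; apply: subP.
Qed.

End SubRep.

Section QuotRep.
Variables (V : lieRep g) (S : set V).
Hypothesis sS : subrep S.
Let sV := subrep_subspace sS.

(** The proof is an argument for the same reason as in [sub_sort]. *)
Definition quot_rel (_ : subrep S) (u v : V) : bool := `[< S (u - v) >].
Local Notation rel := (quot_rel sS).
Let rel_refl : reflexive rel.
Proof. by move=> u; apply/asboolP; rewrite subrr; case: sS. Qed.
Let rel_sym : symmetric rel.
Proof.
by move=> u v; apply/asboolP/asboolP => /(subspaceN sV); rewrite opprB.
Qed.
Let rel_trans : transitive rel.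
Proof.
move=> v u w /asboolP uv /asboolP vw; apply/asboolP.
by have := subspaceD sV uv vw; rewrite addrA subrK.
Qed.
Canonical quot_equiv := EquivRel rel rel_refl rel_sym rel_trans.

Definition quot_sort := {eq_quot rel}.
HB.instance Definition _ := Choice.on quot_sort.

Let cls (v : V) : quot_sort := \pi_quot_sort v.
Let clsP u v : cls u = cls v <-> S (u - v).
Proof. by split=> [/eqmodP/asboolP //|st]; apply/eqmodP/asboolP. Qed.
Let clsK (x : quot_sort) : cls (repr x) = x. Proof. exact: reprK. Qed.
Let reprc v : S (repr (cls v) - v). Proof. by apply/clsP/reprK. Qed.

Let add (x y : quot_sort) := cls (repr x + repr y).
Let opp (x : quot_sort) := cls (- repr x).
Let zero := cls 0.
Let scale a (x : quot_sort) := cls (a *: repr x).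
Let qact z (x : quot_sort) := cls (act z (repr x)).

Let addE u v : add (cls u) (cls v) = cls (u + v).
Proof.
apply/clsP; have := subspaceD sV (reprc u) (reprc v).
by rewrite addrACA -opprD.
Qed.
Let oppE u : opp (cls u) = cls (- u).
Proof. by apply/clsP; rewrite -opprD; apply/(subspaceN sV)/reprc. Qed.
Let scaleE a u : scale a (cls u) = cls (a *: u).
Proof. by apply/clsP; rewrite -scalerBr; apply/(subspaceZ _ sV)/reprc. Qed.
Let qactE z u : qact z (cls u) = cls (act z u).
Proof. by apply/clsP; rewrite -linearB; apply/(subrep_act _ sS)/reprc. Qed.

Let addA : associative add.
Proof.
by move=> x y z; rewrite -(clsK x) -(clsK y) -(clsK z) !addE addrA.
Qed.
Let addC : commutative add.
Proof. by move=> x y; rewrite -(clsK x) -(clsK y) !addE addrC. Qed.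
Let add0 : left_id zero add.
Proof. by move=> x; rewrite -(clsK x) addE add0r. Qed.
Let addN : left_inverse zero opp add.
Proof. by move=> x; rewrite -(clsK x) oppE addE addNr. Qed.
HB.instance Definition _ := GRing.isZmodule.Build quot_sort addA addC add0 addN.

Let addE' u v : cls u + cls v = cls (u + v). Proof. exact: addE. Qed.
Let oppE' u : - cls u = cls (- u). Proof. exact: oppE. Qed.

Let scaleA a b x : scale a (scale b x) = scale (a * b) x.
Proof. by rewrite -(clsK x) !scaleE scalerA. Qed.
Let scale1 : left_id 1 scale.
Proof. by move=> x; rewrite -(clsK x) !scaleE scale1r. Qed.
Let scaleDr : right_distributive scale +%R.
Proof.
by move=> a x y; rewrite -(clsK x) -(clsK y) !(addE', scaleE) scalerDr.
Qed.
Let scaleDl x : {morph scale^~ x : a b / a + b}.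
Proof. by move=> a b; rewrite -(clsK x) !(addE', scaleE) scalerDl. Qed.
HB.instance Definition _ :=
  GRing.Zmodule_isLmodule.Build K quot_sort scaleA scale1 scaleDr scaleDl.

Let scaleE' a u : a *: cls u = cls (a *: u). Proof. exact: scaleE. Qed.

Let qact_linearl u : linear (qact^~ u).
Proof.
by move=> a x y; rewrite -(clsK u) !(scaleE', qactE, addE') actDl actZl.
Qed.
Let qact_linearr x : linear (qact x).
Proof.
move=> a u v; rewrite -(clsK u) -(clsK v).
by rewrite scaleE' addE' !qactE scaleE' addE' linearP.
Qed.
Let qact_bracket x y u :
  qact (bracket x y) u = qact x (qact y u) - qact y (qact x u).
Proof. by rewrite -(clsK u) !(qactE, addE', oppE') act_bracket. Qed.

Definition quot_rep : lieRep g := LieRep qact_linearl qact_linearr qact_bracket.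

Lemma quot_rep_spec : exists f : {linear V -> quot_rep},
  [/\ rep_hom f, forall y, exists u, f u = y & forall v, S v <-> f v = 0].
Proof.
have lf : linear (cls : V -> quot_rep).
  by move=> a u v; rewrite -addE' -scaleE'.
have [f fE] := linear_pack lf; exists f; split.
- by move=> x v; rewrite !fE; apply/esym/qactE.
- by move=> y; exists (repr (y : quot_sort)); rewrite fE clsK.
- move=> v; rewrite fE -[0 : quot_rep]/(cls 0).
  by split=> [Sv|/clsP]; [apply/clsP|]; rewrite subr0.
Qed.

End QuotRep.

Section ProdRep.
Variables (V W : lieRep g).

Definition prod_act x (p : V * W) : V * W := (act x p.1, act x p.2).
Let prod_linearl p : linear (prod_act^~ p).
Proof. by move=> a x y; rewrite /prod_act !actDl !actZl. Qed.
Let prod_linearr x : linear (prod_act x).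
Proof. by move=> a p q; rewrite /prod_act /= !linearP. Qed.
Let prod_bracket x y p :
  prod_act (bracket x y) p =
  prod_act x (prod_act y p) - prod_act y (prod_act x p).
Proof. by rewrite /prod_act /= !act_bracket. Qed.
Definition prod_rep : lieRep g := LieRep prod_linearl prod_linearr prod_bracket.

Lemma prod_rep_fst : exists f : {linear prod_rep -> V},
  rep_hom f /\ forall p : V * W, f p = p.1.
Proof.
have lin : linear (fst : prod_rep -> V) by [].
by have [f fE] := linear_pack lin; exists f; split=> // x p; rewrite !fE.
Qed.

Lemma prod_rep_snd : exists f : {linear prod_rep -> W},
  rep_hom f /\ forall p : V * W, f p = p.2.
Proof.
have lin : linear (snd : prod_rep -> W) by [].
by have [f fE] := linear_pack lin; exists f; split=> // x p; rewrite !fE.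
Qed.

Lemma prod_rep_inl : exists f : {linear V -> prod_rep},
  rep_hom f /\ forall x, f x = (x, 0) :> V * W.
Proof.
have lin : linear ((fun x => (x, 0)) : V -> prod_rep).
  by move=> a x y; apply/pair_equal_spec; rewrite /= scaler0 addr0.
have [f fE] := linear_pack lin; exists f; split=> // x y.
by rewrite !fE /= /prod_act /= linear0.
Qed.

Lemma prod_rep_inr : exists f : {linear W -> prod_rep},
  rep_hom f /\ forall y, f y = (0, y) :> V * W.
Proof.
have lin : linear ((fun y => (0, y)) : W -> prod_rep).
  by move=> a x y; apply/pair_equal_spec; rewrite /= scaler0 addr0.
have [f fE] := linear_pack lin; exists f; split=> // x y.
by rewrite !fE /= /prod_act /= linear0.
Qed.

End ProdRep.

End RepTheory.

(** * Representations of a presented Lie algebra *)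

Section PresentedReps.
Variables (K : fieldType) (X : Type) (E : lie_term K X -> lie_term K X -> Prop).
Local Notation g := (presented_lie E).

Lemma presented_ind (Q : g -> Prop) :
  (forall x, Q (presented_gen E x)) -> Q 0 -> (forall x y, Q x -> Q y -> Q (x + y)) ->
  (forall a x, Q x -> Q (a *: x)) -> (forall x y, Q x -> Q y -> Q (bracket x y)) ->
  forall x, Q x.
Proof.
move=> Qg Q0 QD QZ QB x; rewrite -[x]reprK; elim: (repr x) => //.
- by move=> s Qs t Qt; rewrite -[\pi_(_) _]/(lie_class E _) -presented_addE; apply: QD.
- by move=> a t Qt; rewrite -[\pi_(_) _]/(lie_class E _) -presented_scaleE; apply: QZ.
- move=> s Qs t Qt; rewrite -[\pi_(_) _]/(lie_class E _) -presented_brE.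
  exact: QB.
Qed.

Lemma subrep_gen (V : lieRep g) (S : set V) : subspace S ->
  (forall x v, S v -> S (act (presented_gen E x) v)) -> subrep S.
Proof.
move=> sS Sg; split; [exact: sS.1|exact: sS.2|].
elim/presented_ind => [||x y IHx IHy|a x IH|x y IHx IHy] v Sv.
- exact: Sg.
- by rewrite act0l; case: sS.
- by rewrite actDl; apply: subspaceD => //; [apply: IHx|apply: IHy].
- by rewrite actZl; apply: subspaceZ => //; apply: IH.
- by rewrite act_bracket; apply: subspaceB => //; [apply/IHx/IHy|apply/IHy/IHx].
Qed.

Variables (V : lmodType K) (op : X -> V -> V).
Hypothesis op_lin : forall x, linear (op x).

Fixpoint term_op (t : lie_term K X) (v : V) : V :=
  match t with
  | LGen x => op x v
  | LZero => 0
  | LAdd s t => term_op s v + term_op t v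
  | LScale a t => a *: term_op t v
  | LBr s t => term_op s (term_op t v) - term_op t (term_op s v)
  end.

Lemma term_op_linear t : linear (term_op t).
Proof.
elim: t => [x|| s IHs t IHt|a t IH|s IHs t IHt] b u v /=.
- exact: op_lin.
- by rewrite scaler0 addr0.
- by rewrite IHs IHt scalerDr addrACA.
- by rewrite IH scalerDr !scalerA mulrC.
- by rewrite !(IHs, IHt) opprD scalerBr addrACA.
Qed.

Hypothesis op_rel : forall s t, E s t -> term_op s =1 term_op t.

Lemma term_op_cong s t : lie_cong E s t -> term_op s =1 term_op t.
Proof.
have lin0 r : term_op r 0 = 0.
  have := term_op_linear r 1 0 0.
  by rewrite /= !scale1r addr0 -[X in X = _]addr0 => /addrI.
have linD r u v : term_op r (u + v) = term_op r u + term_op r v.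
  by have := term_op_linear r 1 u v; rewrite !scale1r.
have linZ r a u : term_op r (a *: u) = a *: term_op r u.
  by have := term_op_linear r a u 0; rewrite lin0 !addr0.
have linN r u : term_op r (- u) = - term_op r u by rewrite -!scaleN1r linZ.
elim => {s t} //=.
- by move=> s t _ IH v; rewrite IH.
- by move=> s t u _ IH _ IH' v; rewrite IH IH'.
- by move=> s s' t t' _ IH _ IH' v; rewrite IH IH'.
- by move=> a t t' _ IH v; rewrite IH.
- by move=> s s' t t' _ IH _ IH' v; rewrite !(IH, IH').
- by move=> s t u v; rewrite addrA.
- by move=> s t v; rewrite addrC.
- by move=> t v; rewrite add0r.
- by move=> t v; rewrite scaleN1r addNr.
- by move=> a b t v; rewrite scalerA.
- by move=> t v; rewrite scale1r.
- by move=> a s t v; rewrite scalerDr.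
- by move=> a b t v; rewrite scalerDl.
- by move=> a s t u v; rewrite linD linZ opprD scalerBr addrACA.
- by move=> a s t u v; rewrite linD linZ opprD scalerBr addrACA.
- by move=> t v; rewrite subrr.
- have tele (x y z : V) : x - y + (y - z) = x - z by rewrite addrA subrK.
  move=> s t u v; rewrite !(linD, linN) !opprB.
  rewrite [X in _ + X + _]addrC [X in X + _]addrACA !tele.
  by rewrite addrACA !tele subrr.
Qed.

Let op_act (x : g) v := term_op (repr x) v.

Let op_actE t v : op_act (lie_class E t) v = term_op t v.
Proof. by apply: term_op_cong; apply/presentedP; apply: reprK. Qed.

Let op_linearl v : linear (op_act^~ v).
Proof.
move=> a x y; rewrite -[x]reprK -[y]reprK.
rewrite -[\pi_(_) (repr x)]/(lie_class E _) -[\pi_(_) (repr y)]/(lie_class E _).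
by rewrite presented_scaleE presented_addE !op_actE.
Qed.

Let op_linearr x : linear (op_act x).
Proof. exact: term_op_linear. Qed.

Let op_bracket (x y : g) v :
  op_act (bracket x y) v = op_act x (op_act y v) - op_act y (op_act x v).
Proof.
rewrite -[x]reprK -[y]reprK.
rewrite -[\pi_(_) (repr x)]/(lie_class E _) -[\pi_(_) (repr y)]/(lie_class E _).
by rewrite [bracket _ _]presented_brE !op_actE.
Qed.

Definition rep_of_ops : lieRep g := LieRep op_linearl op_linearr op_bracket.

Lemma rep_of_opsE x (v : V) : act (presented_gen E x) (v : rep_of_ops) = op x v.
Proof. exact: op_actE. Qed.

End PresentedReps.

(** * Weights and highest weight modules *)

(** The properties of a root datum on which the theory of weights rests; [ht]
    is a positive linear functional, which makes [Qplus] a strict order. *)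
Record graded_datum (D : rootDatum) (ht : weight D -> int) : Prop := GradedDatum {
  pairingD : forall mu nu (t : torus D),
    pairing (mu + nu) t = pairing mu t + pairing nu t;
  pairing_inj : forall mu nu : weight D,
    (forall t, pairing mu t = pairing nu t) -> mu = nu;
  cartan_diag : forall i : simple_index D, cartan i i = 2 :> int;
  htD : {morph ht : mu nu / mu + nu};
  ht_sroot_gt0 : forall i : simple_index D, 0 < ht (sroot i) }.

Section Weights.
Variables (K : numFieldType) (D : rootDatum) (ht : weight D -> int).
Hypothesis Dht : graded_datum ht.
Local Notation g := (kac_moody K D).
Implicit Types (V W : lieRep g) (mu nu lam : weight D) (w : seq (simple_index D)).

Lemma bracket_rel (s t x : lie_term K (chevalley D)) :
  serre_rel (LBr s t) x ->
  bracket (lie_class _ s : g) (lie_class _ t) = lie_class _ x.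
Proof. by move=> st; rewrite [LHS]presented_brE; apply/presentedP/lc_rel. Qed.

Lemma act_tor_raise V t i (v : V) :
  act (toral K t) (act (raising K i) v) =
  act (raising K i) (act (toral K t) v) +
  (pairing (sroot i) t)%:~R *: act (raising K i) v.
Proof.
have /(congr1 (fun x => act x v)) := bracket_rel (serre_tor_plus K t i).
rewrite act_bracket -presented_scaleE actZl => /eqP.
by rewrite subr_eq addrC => /eqP.
Qed.

Lemma act_tor_lower V t i (v : V) :
  act (toral K t) (act (lowering K i) v) =
  act (lowering K i) (act (toral K t) v) -
  (pairing (sroot i) t)%:~R *: act (lowering K i) v.
Proof.
have /(congr1 (fun x => act x v)) := bracket_rel (serre_tor_minus K t i).
rewrite act_bracket -presented_scaleE actZl => /eqP.
by rewrite subr_eq addrC scaleNr => /eqP.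
Qed.

Lemma act_raise_lower V i j (v : V) :
  act (raising K i) (act (lowering K j) v) =
  act (lowering K j) (act (raising K i) v) +
  (if i == j then act (toral K (coroot i)) v else 0).
Proof.
have /(congr1 (fun x => act x v)) := bracket_rel (serre_plus_minus K i j).
rewrite act_bracket => /eqP; rewrite subr_eq addrC => /eqP ->; congr (_ + _).
by case: ifP => // _; rewrite -[lie_class _ _]/(0 : g) act0l.
Qed.

Lemma pairing0 t : pairing (0 : weight D) t = 0.
Proof. by apply: (addrI (pairing (0 : weight D) t)); rewrite -(pairingD Dht) !addr0. Qed.

Lemma pairingN mu t : pairing (- mu) t = - pairing mu t.
Proof.
by apply: (addrI (pairing mu t)); rewrite -(pairingD Dht) !subrr pairing0.
Qed.

Lemma pairingB mu nu t : pairing (mu - nu) t = pairing mu t - pairing nu t.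
Proof. by rewrite (pairingD Dht) pairingN. Qed.

Lemma pairingMn mu t m : pairing (mu *+ m) t = pairing mu t *+ m.
Proof.
elim: m => [|m IH]; first by rewrite !mulr0n pairing0.
by rewrite !mulrS (pairingD Dht) IH.
Qed.

Lemma ht0 : ht 0 = 0.
Proof. by apply: (addrI (ht 0)); rewrite -(htD Dht) !addr0. Qed.

Lemma htN mu : ht (- mu) = - ht mu.
Proof. by apply: (addrI (ht mu)); rewrite -(htD Dht) !subrr ht0. Qed.

Lemma htB mu nu : ht (mu - nu) = ht mu - ht nu.
Proof. by rewrite (htD Dht) htN. Qed.

Definition root_sum w : weight D := \sum_(i <- w) sroot i.

Lemma ht_root_sum w : (size w)%:Z <= ht (root_sum w).
Proof.
elim: w => [|i w IH]; first by rewrite /root_sum big_nil ht0.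
rewrite /root_sum big_cons (htD Dht) -/(root_sum w) /=.
by have := ht_sroot_gt0 Dht i; lia.
Qed.

Lemma QplusP mu : Qplus mu <-> exists w, mu = root_sum w.
Proof. by split=> [[w _ <-]|[w ->]]; exists w. Qed.

Lemma weight_space_subspace V nu : subspace (weight_space V nu).
Proof.
split=> [t|a u v uP vP t]; first by rewrite linear0 scaler0.
by rewrite linearP /= uP vP scalerDr !scalerA mulrC.
Qed.

Lemma weight_space_raise V nu i v : weight_space V nu v ->
  weight_space V (nu + sroot i) (act (raising K i) v).
Proof.
move=> vP t; rewrite act_tor_raise vP linearZ /= -scalerDl (pairingD Dht).
by rewrite intrD.
Qed.

Lemma weight_space_lower V nu i v : weight_space V nu v ->
  weight_space V (nu - sroot i) (act (lowering K i) v).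
Proof.
move=> vP t; rewrite act_tor_lower vP linearZ /= -scalerBl pairingB.
by rewrite intrB.
Qed.

Definition toral_closed V (S : set V) :=
  subspace S /\ forall t v, S v -> S (act (toral K t) v).

Lemma subrep_toral_closed V (S : set V) : subrep S -> toral_closed S.
Proof. by move=> sS; split; [apply: subrep_subspace|move=> t v; apply: subrep_act]. Qed.

(** Induction on the number of weights: for [t] that separates [nu] from the
    first weight [nu0], the operator [t - pairing nu0 t] removes the component
    of weight [nu0] and rescales the others. *)
Lemma weight_components V (S : set V) (s : seq (weight D)) (u : weight D -> V) :
  toral_closed S -> uniq s -> (forall nu, nu \in s -> weight_space V nu (u nu)) ->
  S (\sum_(nu <- s) u nu) -> forall nu, nu \in s -> S (u nu).
Proof.
move=> [sS tS]; elim: s u => // nu0 s IH u /= /andP [nu0s us] uP.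
rewrite big_cons => Su.
have Ss nu : nu \in s -> S (u nu).
  move=> nus; have [t tP] : exists t, pairing nu t != pairing nu0 t.
    apply: contrapT => /forallNP nt; case/negP: nu0s.
    rewrite -(pairing_inj Dht (mu := nu) (nu := nu0)) // => t.
    by apply/eqP/negPn/negP/nt.
  pose u' nu := (pairing nu t - pairing nu0 t)%:~R *: u nu.
  have : S (u' nu).
    apply: IH nus => // [nu' nu's|].
      apply: (subspaceZ _ (weight_space_subspace _ nu')).
      by apply: uP; rewrite inE nu's orbT.
    have -> : \sum_(nu <- s) u' nu = act (toral K t) (u nu0 + \sum_(j <- s) u j)
        - (pairing nu0 t)%:~R *: (u nu0 + \sum_(j <- s) u j).
      rewrite linearD /= (uP nu0) ?mem_head // scalerDr opprD addrACA subrr add0r.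
      rewrite linear_sum scaler_sumr -sumrB big_seq [RHS]big_seq /=.
      apply: eq_bigr => nu' nu's; rewrite (uP nu') ?inE ?nu's ?orbT //.
      by rewrite -scalerBl -intrB.
    by apply: subspaceB => //; [apply: tS|apply: subspaceZ].
  move=> /(subspaceZ ((pairing nu t - pairing nu0 t)%:~R)^-1 sS).
  by rewrite scalerA mulVf ?scale1r // intr_eq0 subr_eq0.
move=> nu; rewrite inE => /orP [/eqP ->|]; last exact: Ss.
by rewrite -[u nu0](addrK (\sum_(j <- s) u j)); apply: subspaceB => //;
  apply: subspace_sum_in.
Qed.

Definition weight_span V (Q : weight D -> Prop) : set V :=
  [set v | exists2 l : seq (weight D * V),
     forall p, p \in l -> weight_space V p.1 p.2 /\ Q p.1 & v = \sum_(p <- l) p.2].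
Arguments weight_span V Q : clear implicits.

Definition graded V := forall v, weight_span V (fun=> True) v.

Lemma weight_span_subspace V Q : subspace (weight_span V Q).
Proof.
split=> [|a _ _ [l lP ->] [m mP ->]]; first by exists [::]; rewrite ?big_nil.
exists ([seq (p.1, a *: p.2) | p <- l] ++ m) => [p|].
  rewrite mem_cat => /orP [/mapP [q /lP [qP qQ] ->]|/mP //]; split=> //=.
  exact: (subspaceZ _ (weight_space_subspace _ q.1)).
by rewrite big_cat big_map scaler_sumr.
Qed.

Lemma weight_span_mono V (Q Q' : weight D -> Prop) v :
  (forall nu, Q nu -> Q' nu) -> weight_span V Q v -> weight_span V Q' v.
Proof.
by move=> QQ' [l lP ->]; exists l => // p /lP [pP pQ]; split=> //; apply: QQ'.
Qed.

Lemma weight_span1 V (Q : weight D -> Prop) nu v :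
  weight_space V nu v -> Q nu -> weight_span V Q v.
Proof.
move=> vP Qnu; exists [:: (nu, v)]; last by rewrite big_seq1.
by move=> p; rewrite inE => /eqP ->.
Qed.

Lemma weight_span_ind V Q (S : set V) : subspace S ->
  (forall nu v, Q nu -> weight_space V nu v -> S v) ->
  forall v, weight_span V Q v -> S v.
Proof.
move=> sS QS v [l lP ->]; apply: subspace_sum_in => // p /lP [pP pQ].
exact: QS pP.
Qed.

Lemma weight_span_uniq V Q v : weight_span V Q v ->
  exists (s : seq (weight D)) (u : weight D -> V),
    [/\ uniq s, forall nu, nu \in s -> Q nu, forall nu, weight_space V nu (u nu)
      & v = \sum_(nu <- s) u nu].
Proof.
case=> l lP ->; exists (undup (map fst l)), (fun nu => \sum_(p <- l | p.1 == nu) p.2).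
split; first exact: undup_uniq.
- by move=> nu; rewrite mem_undup => /mapP [p /lP [_ Qp] ->].
- move=> nu; rewrite big_seq_cond; apply: subspace_sum => [|p].
    exact: weight_space_subspace.
  by move=> /andP [/lP [pP _] /eqP <-].
- rewrite (exchange_big_dep predT) //= big_seq [RHS]big_seq.
  apply: eq_bigr => p pl; rewrite -big_filter.
  rewrite (_ : [seq i <- _ | p.1 == i] = [:: p.1]) ?big_seq1 //.
  under eq_filter do rewrite eq_sym.
  by rewrite filter_pred1_uniq ?undup_uniq // mem_undup map_f.
Qed.

Lemma weight_span_split V (S : set V) Q nu y z : toral_closed S ->
  ~ Q nu -> weight_space V nu y -> weight_span V Q z -> S (y + z) -> S y.
Proof.
move=> sS Qnu yP /weight_span_uniq [s [u [us sQ uP ->]]] Syz.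
have nus : nu \notin s by apply/negP => /sQ.
have := @weight_components V S (nu :: s) (fun k => if k == nu then y else u k) sS.
rewrite /= nus us big_cons eqxx => /(_ isT) H.
have := H _ _ nu (mem_head _ _); rewrite eqxx; apply.
  by move=> k _; case: eqP => [->|].
rewrite big_seq; under eq_bigr => k ks.
  rewrite (negPf (_ : k != nu)); last by apply: contraNneq nus => <-.
  over.
by rewrite -big_seq.
Qed.

Lemma toral_closed0 V : toral_closed [set 0 : V].
Proof. exact/subrep_toral_closed/subrep_set0. Qed.

Lemma weight_span_eq0 V Q nu v : ~ Q nu ->
  weight_space V nu v -> weight_span V Q v -> v = 0.
Proof.
move=> Qnu vP vQ; apply: (weight_span_split (toral_closed0 V) Qnu vP) => /=.
  by apply: (subspaceN (weight_span_subspace V Q)); exact: vQ.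
by rewrite subrr.
Qed.

Lemma weight_direct_sumP V : weight_direct_sum V <-> graded V.
Proof.
split=> [[gV _] v|gV]; last split.
- have [s [u [uP ->]]] := gV v.
  exists [seq (nu, u nu) | nu <- s]; last by rewrite big_map.
  by move=> p /mapP [nu _ ->].
- move=> v; have [s [u [_ _ uP ->]]] := weight_span_uniq (gV v).
  by exists s, u.
- move=> s u us uP s0.
  by apply: (weight_components (toral_closed0 V) us) => // nu _; apply: uP.
Qed.

(** ** Words in the lowering operators *)

Definition lower_word V w (v : V) := foldr (fun i x => act (lowering K i) x) v w.

(** The span of the lowering words, as the intersection of the subspaces that
    contain them: membership is eliminated into any given subspace. *)
Definition hw_span V (v : V) : set V :=
  [set x | forall S : set V, subspace S -> (forall w, S (lower_word w v)) -> S x].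

Lemma hw_span_word V (v : V) w : hw_span v (lower_word w v).
Proof. by move=> S _; apply. Qed.
Arguments hw_span_word {V} v w.

Lemma hw_span_subspace V (v : V) : subspace (hw_span v).
Proof.
split=> [S [S0 _] _ //|a x y xP yP S sS Sw].
by apply: sS.2; [apply: xP|apply: yP].
Qed.

Lemma weight_space_word V lam w v : weight_space V lam v ->
  weight_space V (lam - root_sum w) (lower_word w v).
Proof.
move=> vP; elim: w => [|i w IH]; first by rewrite /root_sum big_nil subr0.
rewrite /root_sum big_cons opprD addrCA addrC; exact: weight_space_lower.
Qed.

(** A raising operator moves to the right through a word at the cost of toral
    commutators, which act on words by scalars, and kills [v] in the end. *)
Lemma hw_span_subrep V lam v : weight_space V lam v ->
  (forall i, act (raising K i) v = 0) -> subrep (hw_span v).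
Proof.
move=> vP v0; apply: subrep_gen; first exact: hw_span_subspace.
have lin x : (forall w, hw_span v (act x (lower_word w v))) ->
    forall y, hw_span v y -> hw_span v (act x y).
  move=> xP y yP; apply: (yP ((act x) @^-1` hw_span v)) => //.
  by apply: subspace_preimage; apply: hw_span_subspace.
have low i : forall y, hw_span v y -> hw_span v (act (lowering K i) y).
  by apply: lin => w; apply: (hw_span_word v (i :: w)).
have tor t : forall y, hw_span v y -> hw_span v (act (toral K t) y).
  apply: lin => w; rewrite (weight_space_word w vP).
  exact: (subspaceZ _ (hw_span_subspace v)) (hw_span_word v w).
case=> [i|i|t]; [|exact: low|exact: tor].
apply: lin => w; rewrite -/(raising K i); elim: w => [|j w IH] /=.
  by rewrite v0; apply: (hw_span_subspace v).1.
rewrite act_raise_lower; apply: (subspaceD (hw_span_subspace v)).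
  exact: low.
case: ifP => _; last exact: (hw_span_subspace v).1.
by apply: tor; apply: hw_span_word.
Qed.

Lemma hw_span_min V (S : set V) v : subrep S -> S v -> hw_span v `<=` S.
Proof.
move=> sS Sv x; apply; first exact: subrep_subspace.
by elim=> [|i w IH] //=; apply: subrep_act.
Qed.

Definition strictly_below lam nu :=
  exists2 w, w != [::] & nu = lam - root_sum w.

Lemma strictly_below_ht lam nu : strictly_below lam nu -> ht nu < ht lam.
Proof.
move=> [w w0 ->]; rewrite htB; have := ht_root_sum w.
by case: w w0 => //= i w _; lia.
Qed.

Lemma hw_span_split V lam v x : weight_space V lam v -> hw_span v x ->
  exists (a : K) y, weight_span V (strictly_below lam) y /\ x = a *: v + y.
Proof.
move=> vP xP.
pose S := [set x | exists (a : K) y, weight_span V (strictly_below lam) y /\ x = a *: v + y].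
have sW := weight_span_subspace V (strictly_below lam).
apply: (xP S) => [|[|i w]].
- split=> [|a _ _ [b [y [yP ->]]] [c [z [zP ->]]]].
    by exists 0, 0; rewrite scale0r addr0; split=> //; apply: sW.1.
  exists (a * b + c), (a *: y + z); split; first exact: sW.2.
  by rewrite scalerDr scalerDl scalerA addrACA.
- by exists 1, 0; rewrite scale1r addr0; split=> //; apply: sW.1.
- exists 0, (lower_word (i :: w) v); rewrite scale0r add0r; split=> //.
  by apply: weight_span1; [apply: weight_space_word|exists (i :: w)].
Qed.

Lemma hw_span_weights V lam v x : weight_space V lam v -> hw_span v x ->
  weight_span V (fun nu => Qplus (lam - nu)) x.
Proof.
move=> vP; apply; first exact: weight_span_subspace.
move=> w; apply: weight_span1 (weight_space_word w vP) _.
by apply/QplusP; exists w; rewrite opprB addrC subrK.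
Qed.

Lemma hw_span_top V lam v x : weight_space V lam v -> hw_span v x ->
  weight_space V lam x -> exists a : K, x = a *: v.
Proof.
move=> vP /(hw_span_split vP) [a [y [yP ->]]] xP; exists a.
suff -> : y = 0 by rewrite addr0.
apply: (@weight_span_eq0 V (strictly_below lam) lam) => //.
  by move=> /strictly_below_ht; rewrite ltxx.
have -> : y = a *: v + y - a *: v by rewrite addrC addKr.
have sV := weight_space_subspace V lam.
exact: (subspaceB sV xP (subspaceZ _ sV vP)).
Qed.

(** The component of a vector of [S] along [v] is again in [S], hence vanishes. *)
Lemma hw_span_proper V lam v (S : set V) x : weight_space V lam v ->
  subrep S -> ~ S v -> S x -> hw_span v x ->
  weight_span V (strictly_below lam) x.
Proof.
move=> vP sS Sv Sx /(hw_span_split vP) [a [y [yP xE]]].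
have Sav : S (a *: v).
  apply: (@weight_span_split V S (strictly_below lam) lam (a *: v) y) => //.
  - exact: subrep_toral_closed.
  - by move=> /strictly_below_ht; rewrite ltxx.
  - exact: (subspaceZ _ (weight_space_subspace _ lam)).
  - by rewrite -xE.
have [a0|a0] := eqVneq a 0; first by rewrite xE a0 scale0r add0r.
case: Sv; rewrite -[v]scale1r -(mulVf a0) -scalerA.
by apply: subspaceZ => //; apply: subrep_subspace.
Qed.


Lemma hw_span_weight V lam v nu x : weight_space V lam v -> hw_span v x ->
  weight_space V nu x -> x != 0 -> Qplus (lam - nu).
Proof.
move=> vP xv xP x0; apply: contrapT => nQ; case/eqP: x0.
apply: (@weight_span_eq0 V (fun mu => Qplus (lam - mu)) nu) => //.
exact: hw_span_weights xv.
Qed.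

(** ** Highest weights *)

Definition bounded_by V lam := forall nu, is_weight V nu -> Qplus (lam - nu).

Lemma Qplus_ht lam nu : Qplus (lam - nu) -> ht nu <= ht lam.
Proof.
by move=> /QplusP [w E]; have := ht_root_sum w; rewrite -E htB; lia.
Qed.

Lemma max_weight (Q : weight D -> Prop) (B : int) :
  (exists nu, Q nu) -> (forall nu, Q nu -> ht nu <= B) ->
  exists2 nu, Q nu & forall mu, Q mu -> ht mu <= ht nu.
Proof.
move=> [nu0 Q0] QB.
pose P m := `[< exists2 nu, Q nu & `|B - ht nu|%N = m >].
have exP : exists m, P m by exists `|B - ht nu0|%N; apply/asboolP; exists nu0.
case: (ex_minnP exP) => m /asboolP [nu Qnu nuE] mmin.
exists nu => // mu Qmu.
have /mmin : P `|B - ht mu|%N by apply/asboolP; exists mu.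
by have := QB mu Qmu; have := QB nu Qnu; lia.
Qed.

Lemma top_weight_raise V nu v : weight_space V nu v ->
  (forall mu, is_weight V mu -> ht mu <= ht nu) ->
  forall i, act (raising K i) v = 0.
Proof.
move=> vP nutop i; apply: contrapT => /eqP v0.
have /nutop : is_weight V (nu + sroot i).
  by exists (act (raising K i) v) => //; apply: weight_space_raise.
by rewrite (htD Dht); have := ht_sroot_gt0 Dht i; lia.
Qed.

Lemma simple_highest_weight V : simple_rep V -> category_O V ->
  exists lam, is_highest_weight V lam.
Proof.
move=> [[x x0] sV] [/weight_direct_sumP gV _ [lams lamsP]].
have exw : exists nu, is_weight V nu.
  apply: contrapT => noW; case/eqP: x0.
  case: (gV x) => l lP ->; rewrite big_seq big1 // => p /lP [pP _].
  by apply: contrapT => /eqP p0; apply: noW; exists p.1, p.2.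
have [B Bmax] : exists B, forall lam, lam \in lams -> ht lam <= B.
  elim: (lams) => [|lam s [B BP]]; first by exists 0.
  exists (Num.max (ht lam) B) => mu; rewrite inE le_max => /orP [/eqP ->|/BP ->].
    by rewrite lexx.
  by rewrite orbT.
have [nu [v v0 vP] nutop] : exists2 nu, is_weight V nu &
    forall mu, is_weight V mu -> ht mu <= ht nu.
  apply: (max_weight exw (B := B)) => nu /lamsP [lam /Bmax lamB].
  by move=> /Qplus_ht /le_trans; apply.
exists nu, v; split=> //; first exact: top_weight_raise nutop.
move=> S sS Sv; have [S0|//] := sV S sS.
by move: Sv; rewrite S0 => /eqP; rewrite (negPf v0).
Qed.

Lemma highest_weightP V : (exists lam, is_highest_weight V lam) ->
  is_highest_weight V (highest_weight V).
Proof. by move=> [lam lamP]; apply: (xgetPex 0); exists lam. Qed.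

(** A highest weight vector generates by the lowering operators alone, because
    their span is already a submodule. *)
Lemma is_highest_weightE V lam : is_highest_weight V lam ->
  exists v, [/\ v != 0, weight_space V lam v, forall i, act (raising K i) v = 0
    & forall x, hw_span v x].
Proof.
move=> [v [v0 vP vr vgen]]; exists v; split=> // x.
have -> // : hw_span v = setT; apply: vgen (hw_span_subrep vP vr) _.
exact: (hw_span_word v [::]).
Qed.

Lemma highest_weight_bounded V lam : is_highest_weight V lam -> bounded_by V lam.
Proof.
move=> /is_highest_weightE [v [v0 vP vr vgen]] nu [x x0 xP].
exact: hw_span_weight vP (vgen x) xP x0.
Qed.

Lemma highest_weight_weight V lam : is_highest_weight V lam -> is_weight V lam.
Proof. by move=> [v [v0 vP _ _]]; exists v. Qed.

Lemma highest_weight_uniq V lam mu :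
  is_highest_weight V lam -> is_highest_weight V mu -> lam = mu.
Proof.
move=> Vlam Vmu.
have /QplusP [w wE] := highest_weight_bounded Vlam (highest_weight_weight Vmu).
have := Qplus_ht (highest_weight_bounded Vmu (highest_weight_weight Vlam)).
have := ht_root_sum w; case: w wE => [|i w] wE; rewrite -wE htB /=.
  by move/eqP: wE; rewrite /root_sum big_nil subr_eq0 => /eqP.
by lia.
Qed.

Lemma rep_iso_weight V W nu : rep_iso V W -> is_weight V nu -> is_weight W nu.
Proof.
move=> [f fb fh] [v v0 vP]; exists (f v); last by move=> t; rewrite -fh vP linearZ.
by apply: contraNneq v0 => fv; apply/eqP/(bij_inj fb); rewrite fv linear0.
Qed.

Lemma rep_iso_highest_weight V W lam :
  rep_iso V W -> is_highest_weight V lam -> is_highest_weight W lam.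
Proof.
move=> [f fb fh] [v [v0 vP vr vgen]]; exists (f v); split.
- by apply: contraNneq v0 => fv; apply/eqP/(bij_inj fb); rewrite fv linear0.
- by move=> t; rewrite -fh vP linearZ.
- by move=> i; rewrite -fh vr linear0.
- move=> S sS Sfv; apply/seteqP; split=> // y _.
  have [f' fK f'K] := fb; rewrite -(f'K y).
  suff H : (f @^-1` S) (f' y) by [].
  by rewrite (vgen (f @^-1` S)) //; apply: subrep_preimage.
Qed.

(** Goursat's argument: inside [V * W], the submodule generated by the pair of
    highest weight vectors is the graph of an isomorphism, since its fibres over
    0 are proper submodules. *)
Lemma simple_hw_iso V W lam : simple_rep V -> simple_rep W ->
  is_highest_weight V lam -> is_highest_weight W lam -> rep_iso V W.
Proof.
move=> [_ sV] [_ sW] [v [v0 vP vr vgen]] [w [w0 wP wr wgen]].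
pose P := prod_rep V W; pose p : P := (v, w).
have pP : weight_space P lam p by move=> t; rewrite /= /prod_act /= vP wP.
have pr i : act (raising K i) p = 0 by rewrite /= /prod_act /= vr wr.
have sG := hw_span_subrep pP pr; have pG := hw_span_word p [::].
have gV := subrep_subspace sG.
have [f [fh fE]] := prod_rep_fst V W; have [h [hh hE]] := prod_rep_snd V W.
have [il [ilh ilE]] := prod_rep_inl V W; have [ir [irh irE]] := prod_rep_inr V W.
have totV x : exists y, hw_span p ((x, y) : P).
  have : (f @` hw_span p) x.
    rewrite (vgen _ (subrep_image fh sG)) //; exists p => //; exact: fE.
  by case=> [[x' y] xyP <-]; exists y; rewrite fE.
have totW y : exists x, hw_span p ((x, y) : P).
  have : (h @` hw_span p) y.
    rewrite (wgen _ (subrep_image hh sG)) //; exists p => //; exact: hE.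
  by case=> [[x y'] xyP <-]; exists x; rewrite hE.
have kerW y : hw_span p ((0, y) : P) -> y = 0.
  move=> yP; have [S0|ST] := sW _ (subrep_preimage irh sG).
    have : (ir @^-1` hw_span p) y by rewrite /preimage /= irE.
    by rewrite S0.
  have : (ir @^-1` hw_span p) w by rewrite ST.
  rewrite /preimage /= irE => wG; case/eqP: w0.
  have [|a /pair_equal_spec /= [av ->]] := hw_span_top pP wG.
    by move=> t; rewrite /= /prod_act /= linear0 wP; apply/pair_equal_spec; rewrite /= scaler0.
  by move/esym/eqP: av; rewrite scaler_eq0 (negPf v0) orbF => /eqP ->; rewrite scale0r.
have kerV x : hw_span p ((x, 0) : P) -> x = 0.
  move=> xP; have [S0|ST] := sV _ (subrep_preimage ilh sG).
    have : (il @^-1` hw_span p) x by rewrite /preimage /= ilE.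
    by rewrite S0.
  have : (il @^-1` hw_span p) v by rewrite ST.
  rewrite /preimage /= ilE => vG; case/eqP: v0.
  have [|a /pair_equal_spec /= [-> aw]] := hw_span_top pP vG.
    by move=> t; rewrite /= /prod_act /= linear0 vP; apply/pair_equal_spec; rewrite /= scaler0.
  by move/esym/eqP: aw; rewrite scaler_eq0 (negPf w0) orbF => /eqP ->; rewrite scale0r.
have [F FP] := choice totV; have [G GP] := choice totW.
have FU x y : hw_span p ((x, y) : P) -> y = F x.
  move=> xyP; apply/eqP; rewrite -subr_eq0; apply/eqP/kerW.
  by have := subspaceB gV xyP (FP x); rewrite -[_ - _]/(x - x, y - F x) subrr.
have GU x y : hw_span p ((x, y) : P) -> x = G y.
  move=> xyP; apply/eqP; rewrite -subr_eq0; apply/eqP/kerV.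
  by have := subspaceB gV xyP (GP y); rewrite -[_ - _]/(x - G y, y - y) subrr.
have Flin : linear F.
  by move=> a x y; apply/esym/FU; apply: (gV.2 a (x, F x) (y, F y)).
have [F' F'E] := linear_pack Flin; exists F'.
  exists G => [x|y]; first by rewrite F'E; apply/esym/GU.
  by rewrite F'E; apply/esym/FU.
move=> x y; rewrite !F'E; apply/esym/FU.
exact: (subrep_act x sG (FP y)).
Qed.

(** ** Strings of weights *)

(** [E] and [F] are the raising and the lowering operator in either order; the
    relation between them says that [F ^ k v] has weight [q - 2 k]. *)
Lemma sl2_string (V : lmodType K) (E F : V -> V) (q : int) (v : V) N :
  (forall (a : K) x, F (a *: x) = a *: F x) ->
  E v = 0 -> v != 0 -> iter N F v = 0 ->
  (forall k, E (F (iter k F v)) =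
     F (E (iter k F v)) + (q - (2 * k)%:Z)%:~R *: iter k F v) ->
  E 0 = 0 ->
  exists2 b : nat, q = b%:Z & forall k, (k <= b)%N -> iter k F v != 0.
Proof.
move=> FZ Ev v0 FN EF E0.
have EFk k : E (iter k.+1 F v) =
    ((k.+1)%:Z * (q - k%:Z))%:~R *: iter k F v.
  elim: k => [|k IH].
    by rewrite [LHS](EF 0%N) /= Ev -[X in F X](scale0r v) FZ scale0r add0r mul1r.
  rewrite -[iter k.+2 F v]/(F (iter k.+1 F v)) EF IH FZ.
  rewrite -/(iter k.+1 F v) -scalerDl -intrD; congr (_%:~R *: _); lia.
have exb : exists b, iter b F v == 0 by exists N; apply/eqP.
case: (ex_minnP exb) => -[|b] /eqP Fb bmin; first by case/eqP: v0.
have nz k : (k <= b)%N -> iter k F v != 0.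
  by move=> kb; apply: contraTN kb => /bmin; rewrite -ltnNge.
exists b => //.
have := EFk b; rewrite Fb E0 => /esym/eqP.
rewrite scaler_eq0 (negPf (nz b _)) // orbF intr_eq0 mulf_eq0 /= subr_eq0.
by move=> /eqP.
Qed.

Lemma weight_space_iter_raise V nu i v k : weight_space V nu v ->
  weight_space V (nu + sroot i *+ k) (iter k (act (raising K i)) v).
Proof.
move=> vP; elim: k => [|k IH]; first by rewrite mulr0n addr0.
by rewrite mulrSr addrA; apply: weight_space_raise.
Qed.

Lemma weight_space_iter_lower V nu i v k : weight_space V nu v ->
  weight_space V (nu - sroot i *+ k) (iter k (act (lowering K i)) v).
Proof.
move=> vP; elim: k => [|k IH]; first by rewrite mulr0n subr0.
by rewrite mulrSr opprD addrA; apply: weight_space_lower.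
Qed.

Lemma pairing_sroot (i : simple_index D) : pairing (sroot i) (coroot i) = 2 :> int.
Proof. exact: (cartan_diag Dht i). Qed.

Lemma last_iter (V : lmodType K) (F : V -> V) (v : V) N : v != 0 -> iter N F v = 0 ->
  exists k, iter k F v != 0 /\ F (iter k F v) = 0.
Proof.
move=> v0 FN; have exb : exists b, iter b F v == 0 by exists N; apply/eqP.
case: (ex_minnP exb) => -[|b] /eqP Fb bmin; first by case/eqP: v0.
by exists b; split=> //; apply/negP => /bmin; rewrite ltnn.
Qed.

Lemma weight_string_down V nu i (k : nat) : integrable V -> is_weight V nu ->
  k%:Z <= pairing nu (coroot i) -> is_weight V (nu - sroot i *+ k).
Proof.
move=> iV [v v0 vP] kle; have [N [eN _]] := iV i v.
have [a [w0 ew]] := last_iter v0 eN; set w := iter a _ v in w0 ew.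
have wP : weight_space V (nu + sroot i *+ a) w by apply: weight_space_iter_raise.
have [M [_ fM]] := iV i w.
set q := pairing (nu + sroot i *+ a) (coroot i).
have qE : q = pairing nu (coroot i) + a%:Z *+ 2.
  by rewrite /q (pairingD Dht) pairingMn pairing_sroot; lia.
have [||b bE bP] := @sl2_string V (act (raising K i)) (act (lowering K i)) q w M
    _ ew w0 fM _ (linear0 _); first by move=> c x; rewrite linearZ.
  move=> m; rewrite act_raise_lower eqxx (weight_space_iter_lower i m wP).
  by rewrite pairingB [pairing (_ *+ m) _]pairingMn pairing_sroot -/q;
    congr (_ + _%:~R *: _); lia.
exists (iter (a + k) (act (lowering K i)) w); first by apply: bP; lia.
have := weight_space_iter_lower i (a + k) wP.
by rewrite mulrnDr opprD addrA addrK.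
Qed.

Lemma weight_string_up V nu i (k : nat) : integrable V -> is_weight V nu ->
  pairing nu (coroot i) <= - k%:Z -> is_weight V (nu + sroot i *+ k).
Proof.
move=> iV [v v0 vP] kle; have [N [_ fN]] := iV i v.
have [a [w0 fw]] := last_iter v0 fN; set w := iter a _ v in w0 fw.
have wP : weight_space V (nu - sroot i *+ a) w by apply: weight_space_iter_lower.
have [M [eM _]] := iV i w.
set q := - pairing (nu - sroot i *+ a) (coroot i).
have qE : q = - pairing nu (coroot i) + a%:Z *+ 2.
  by rewrite /q pairingB pairingMn pairing_sroot; lia.
have [||b bE bP] := @sl2_string V (act (lowering K i)) (act (raising K i)) q w M
    _ fw w0 eM _ (linear0 _); first by move=> c x; rewrite linearZ.
  move=> m; rewrite [in RHS]act_raise_lower eqxx (weight_space_iter_raise i m wP).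
  rewrite -addrA -scalerDl -intrD (_ : _ + _ = 0 :> int) ?scale0r ?addr0 //.
  rewrite (pairingD Dht) [pairing (_ *+ m) _]pairingMn pairing_sroot.
  by rewrite /q; lia.
exists (iter (a + k) (act (raising K i)) w); first by apply: bP; lia.
have := weight_space_iter_raise i (a + k) wP.
by rewrite mulrnDr addrA subrK.
Qed.

Lemma simple_hw_raise V lam nu : simple_rep V -> is_highest_weight V lam ->
  is_weight V nu -> nu <> lam -> exists i, is_weight V (nu + sroot i).
Proof.
move=> [_ sV] /is_highest_weightE [v [v0 vP vr vgen]] [x x0 xP] nulam.
apply: contrapT => noi; have xr i : act (raising K i) x = 0.
  apply: contrapT => /eqP ex0; apply: noi; exists i.
  by exists (act (raising K i) x) => //; apply: weight_space_raise.
have [S0|ST] := sV _ (hw_span_subrep xP xr).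
  have : hw_span x x := hw_span_word x [::].
  by rewrite S0 => /eqP; rewrite (negPf x0).
have vx : hw_span x v by rewrite ST.
have Qnl : Qplus (nu - lam) by apply: hw_span_weight xP vx vP v0.
have Qln : Qplus (lam - nu) by apply: hw_span_weight vP (vgen x) xP x0.
case: nulam; case/QplusP: (Qln) => -[|i w] wE.
  by move/eqP: wE; rewrite /root_sum big_nil subr_eq0 => /eqP.
by have := ht_root_sum (i :: w); rewrite -wE htB /=; have := Qplus_ht Qnl; lia.
Qed.

(** By induction on the depth below [lam]: a weight [nu] is reached either along
    a string from [nu + sroot i], or by reflection from a higher weight. *)
Lemma weights_sub V W lam : simple_rep V -> integrable V -> is_highest_weight V lam ->
  integrable W -> is_weight W lam -> forall nu, is_weight V nu -> is_weight W nu.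
Proof.
move=> sV iV Vlam iW Wlam nu.
have [m] := ubnP `|ht lam - ht nu|%N; elim: m nu => // m IH nu.
rewrite ltnS => num nuV.
have [-> //|/eqP nulam] := eqVneq nu lam.
have [i iV'] := simple_hw_raise sV Vlam nuV nulam.
have hi := ht_sroot_gt0 Dht i.
have le1 := Qplus_ht (highest_weight_bounded Vlam nuV).
have le2 := Qplus_ht (highest_weight_bounded Vlam iV').
have H1 : is_weight W (nu + sroot i).
  by apply: IH => //; move: le1 le2; rewrite (htD Dht); lia.
have [p1|p1] := leP 1 (pairing (nu + sroot i) (coroot i)).
  by have := weight_string_down (k := 1%N) iW H1 p1; rewrite mulr1n addrK.
have [k pk] : exists k : nat, pairing nu (coroot i) = - k.+1%:Z.
  exists `|(pairing nu (coroot i) + 1)%R|%N.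
  by move: p1; rewrite (pairingD Dht) pairing_sroot; lia.
have V2 : is_weight V (nu + sroot i *+ k.+1).
  by apply: weight_string_up => //; rewrite pk.
have ht2 : ht (nu + sroot i *+ k.+1) > ht nu.
  rewrite (htD Dht) ltrDl; elim: (k) => [|j IHj]; first by rewrite mulr1n.
  by rewrite mulrS (htD Dht) addr_gt0.
have le3 := Qplus_ht (highest_weight_bounded Vlam V2).
have W2 : is_weight W (nu + sroot i *+ k.+1) 
  by apply: IH => //; move: le3 ht2 num; set h := ht (_ + _); lia.
rewrite -[nu](addrK (sroot i *+ k.+1)); apply: weight_string_down => //.
by rewrite (pairingD Dht) pk pairingMn pairing_sroot; lia.
Qed.

End Weights.

(** * Decomposition of characters *)

Arguments hw_span_word {K D V} v w.

Section Characters.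
Variables (K : numFieldType) (D : rootDatum) (ht : weight D -> int).
Hypothesis Dht : graded_datum ht.
Local Notation g := (kac_moody K D).
Implicit Types (V W U M L : lieRep g) (mu nu lam : weight D).

Definition finite_weights V := forall nu, exists d, has_dim (weight_space V nu) d.

(** The integrable modules of the category O whose weights have a common bound.
    Subquotients and finite sums keep the same bound [lam]. *)
Definition good_rep lam V :=
  [/\ graded V, finite_weights V, bounded_by V lam & integrable V].

Lemma good_category_O lam V : good_rep lam V -> category_O V.
Proof.
case=> gV fV bV _; split=> //; first exact/(weight_direct_sumP Dht).
by exists [:: lam] => nu /bV; exists lam; rewrite ?mem_head.
Qed.

Lemma characterE V nu d : has_dim (weight_space V nu) d -> character V nu = d.
Proof. exact/dimensionE/weight_space_subspace. Qed.

Lemma finite_weightsP V nu : finite_weights V ->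
  has_dim (weight_space V nu) (character V nu).
Proof. by move=> fV; have [d dP] := fV nu; rewrite (characterE dP). Qed.

Lemma character_gt0 V nu : finite_weights V ->
  (0 < character V nu)%N <-> is_weight V nu.
Proof.
move=> /finite_weightsP - /(_ nu) dP; split=> [c0|[v v0 vP]].
  apply: contrapT => noW; move: c0.
  rewrite (@characterE V nu 0) //.
  have -> : weight_space V nu = [set 0].
    apply/seteqP; split=> [v vP|v ->]; last exact: (weight_space_subspace V nu).1.
    by apply: contrapT => /eqP v0; apply: noW; exists v.
  exact: has_dim0.
exact: (has_dim_pos (weight_space_subspace V nu) dP vP v0).
Qed.

Lemma has_dim_weight_span V (s : seq (weight D)) : finite_weights V -> uniq s ->
  has_dim (weight_span (V := V) (fun nu => nu \in s)) (\sum_(nu <- s) character V nu)%N.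
Proof.
move=> fV; elim: s => [_|nu s IH /= /andP [nus us]].
  rewrite big_nil (_ : weight_span (V := V) _ = [set 0]); first exact: has_dim0.
  apply/seteqP; split=> [_ [[|p l] lP ->]|_ ->].
  - by rewrite big_nil.
  - by have [] := lP p (mem_head _ _).
  - exact: (weight_span_subspace V _).1.
rewrite big_cons; have sA := weight_space_subspace V nu.
apply: (has_dim_add _ sA (weight_span_subspace V (fun mu => mu \in s))) (IH us).
- exact: weight_span_subspace.
- by move=> v vP; apply: weight_span1 vP _; rewrite mem_head.
- by move=> v; apply: weight_span_mono => mu mus; rewrite inE mus orbT.
- move=> v vP vs; apply: (@weight_span_eq0 _ _ _ Dht V _ nu v _ vP vs).
  exact/negP.
- apply: (weight_span_ind (S := [set v | exists x y, [/\ weight_space V nu x,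
    weight_span (fun mu => mu \in s) y & v = x + y]])).
    have sB := weight_span_subspace V (fun mu => mu \in s).
    split=> [|c _ _ [a [b [aP bP ->]]] [a' [b' [aP' bP' ->]]]].
      by exists 0, 0; split; rewrite ?addr0; [apply: sA.1|apply: sB.1|].
    exists (c *: a + a'), (c *: b + b'); split; [exact: sA.2|exact: sB.2|].
    by rewrite scalerDr addrACA.
  move=> mu v; rewrite inE => /orP [/eqP -> vP|mus vP].
    by exists v, 0; split; rewrite ?addr0 //; apply: (weight_span_subspace V _).1.
  exists 0, v; split; rewrite ?add0r //; first exact: sA.1.
  exact: weight_span1 vP mus.
- exact: finite_weightsP.
Qed.

Lemma weight_space_hom V W (f : {linear V -> W}) nu v : rep_hom f ->
  weight_space V nu v -> weight_space W nu (f v).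
Proof. by move=> fh vP t; rewrite -fh vP linearZ. Qed.

Lemma weight_space_hom_inj V W (f : {linear V -> W}) nu v : rep_hom f ->
  injective f -> weight_space W nu (f v) -> weight_space V nu v.
Proof. by move=> fh fI vP t; apply: fI; rewrite fh vP linearZ. Qed.

Lemma weight_span_hom V W (f : {linear V -> W}) Q v : rep_hom f ->
  weight_span Q v -> weight_span Q (f v).
Proof.
move=> fh; apply: (weight_span_ind (S := f @^-1` [set x | weight_span Q x])).
  by apply: subspace_preimage; apply: weight_span_subspace.
by move=> nu x Qnu xP; apply: weight_span1 Qnu; apply: weight_space_hom.
Qed.

Lemma graded_split V nu v : graded V -> exists a b,
  [/\ weight_space V nu a, weight_span (fun mu => mu <> nu) b & v = a + b].
Proof.
move=> gV; apply: (weight_span_ind (Q := fun=> True) (S := [set v | exists a b,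
  [/\ weight_space V nu a, weight_span (fun mu => mu <> nu) b & v = a + b]])) => //.
  have sa := weight_space_subspace V nu.
  have sb := weight_span_subspace V (fun mu => mu <> nu).
  split=> [|c _ _ [a [b [aP bP ->]]] [a' [b' [aP' bP' ->]]]].
    by exists 0, 0; split; rewrite ?addr0; [apply: sa.1|apply: sb.1|].
  exists (c *: a + a'), (c *: b + b'); split; [exact: sa.2|exact: sb.2|].
  by rewrite scalerDr addrACA.
move=> mu x _ xP; have [<-|/eqP munu] := eqVneq mu nu.
  exists x, 0; split; rewrite ?addr0 //.
  exact: (weight_span_subspace V (fun nu => nu <> mu)).1.
exists 0, x; split; rewrite ?add0r //; first exact: (weight_space_subspace V nu).1.
exact: weight_span1 xP munu.
Qed.

Lemma iter_hom V W (f : {linear V -> W}) x N v : rep_hom f ->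
  f (iter N (act x) v) = iter N (act x) (f v).
Proof. by move=> fh; elim: N => //= N IH; rewrite fh IH. Qed.

Lemma has_dim_preimage (A B : lmodType K) (f : {linear A -> B}) (S : set A) d :
  subspace S -> injective f -> has_dim (f @` S) d -> has_dim S d.
Proof.
move=> sS fI dP; have sf := subspace_image f sS.
have [|e _ eP] := @dim_le_has_dim _ _ S d sS.
  move=> e w Sw fw; apply: (has_dim_le sf dP (w := f \o w)) => [i|c].
    by exists (w i).
  by rewrite -comb_linear -(linear0 f) => /fI/fw.
by rewrite (has_dim_inj sf dP (has_dim_image_inj sS fI eP)).
Qed.

(** Weight spaces form an exact functor: a submodule contains the weight
    components of its vectors, and a weight vector of a quotient lifts to the
    component of that weight of any of its preimages. *)
Lemma good_exact lam U M W (f : {linear U -> M}) (h : {linear M -> W}) :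
  rep_hom f -> injective f -> rep_hom h -> (forall y, exists v, h v = y) ->
  (forall v, (exists u, f u = v) <-> h v = 0) -> good_rep lam M ->
  [/\ good_rep lam U, good_rep lam W
    & forall nu, character M nu = (character U nu + character W nu)%N].
Proof.
move=> fh fI hh hS fhE [gM fM bM iM].
have imf nu : f @` weight_space U nu = weight_space M nu `&` h @^-1` [set 0].
  apply/seteqP; split=> [_ [u uP <-]|v [vP /fhE [u uE]]].
    by split; [apply: weight_space_hom|apply/fhE; exists u].
  by exists u => //; apply: (weight_space_hom_inj fh fI); rewrite uE.
have imh nu : h @` weight_space M nu = weight_space W nu.
  apply/seteqP; split=> [_ [v vP <-]|y yP]; first exact: weight_space_hom.
  have [v vy] := hS y; have [a [b [aP bP vE]]] := graded_split nu v gM.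
  exists a => //; apply/eqP; rewrite -subr_eq0 -oppr_eq0 opprB; apply/eqP.
  have E : y - h a = h b by rewrite -vy vE linearD addrC addKr.
  apply: (@weight_span_eq0 _ _ _ Dht W (fun mu => mu <> nu) nu) => //.
    have sW := weight_space_subspace W nu.
    exact: (subspaceB sW yP (weight_space_hom hh aP)).
  by rewrite E; apply: weight_span_hom.
have dU nu : exists2 d, has_dim (weight_space U nu) d &
    has_dim (weight_space M nu `&` h @^-1` [set 0]) d.
  have [d dP] := fM nu; have sM := weight_space_subspace M nu.
  have sk : subspace (weight_space M nu `&` h @^-1` [set 0]).
    by apply: subspaceI => //; apply/subspace_preimage/subspace0.
  have [|e _ eP] := subspace_has_dim sk sM _ dP; first by move=> v [].
  exists e => //; rewrite -imf in eP.
  exact: has_dim_preimage (weight_space_subspace U nu) fI eP.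
have dW nu : exists d, has_dim (weight_space W nu) d.
  have [d dP] := fM nu; rewrite -imh.
  exact: has_dim_image_le (weight_space_subspace M nu) dP.
split.
- split=> [u|nu|nu [u u0 uP]|i u].
  + have [s [x [us _ xP xE]]] := weight_span_uniq (gM (f u)).
    have tS : toral_closed (f @` setT).
      by apply/subrep_toral_closed/subrep_image => //; apply: subrep_setT.
    have imx : forall nu, nu \in s -> (f @` setT) (x nu).
      by apply: (weight_components Dht tS us) => //; rewrite -xE; exists u.
    have /choice [z zE] : forall nu, exists z, nu \in s -> f z = x nu.
      move=> nu; case: (boolP (nu \in s)) => [/imx [z _ zE]|_]; last by exists 0.
      by exists z.
    exists [seq (nu, z nu) | nu <- s] => [p /mapP [nu nus ->]|].
      by split=> //; apply: (weight_space_hom_inj fh fI); rewrite zE.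
    apply: fI; rewrite big_map linear_sum xE big_seq [RHS]big_seq.
    by apply: eq_bigr => nu nus /=; rewrite zE.
  + by have [d dP _] := dU nu; exists d.
  + apply: bM; exists (f u); last exact: weight_space_hom.
    by apply: contraNneq u0 => fu; apply/eqP/fI; rewrite fu linear0.
  + have [N [eN fN]] := iM i (f u); exists N.
    by split; apply: fI; rewrite iter_hom // linear0.
- split=> [y|nu|nu [y y0 yP]|i y].
  + by have [v <-] := hS y; apply: weight_span_hom.
  + exact: dW.
  + apply: bM; move: yP; rewrite -imh => -[v vP vE]; exists v => //.
    by apply: contraNneq y0 => v0; rewrite -vE v0 linear0.
  + have [v <-] := hS y; have [N [eN fN]] := iM i v; exists N.
    by rewrite -!iter_hom // eN fN linear0.
- move=> nu; have [d dP dk] := dU nu; have [e eP] := dW nu.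
  rewrite (characterE dP) (characterE eP); apply: characterE.
  apply: (has_dim_ker_image (weight_space_subspace M nu) dk).
  by rewrite imh.
Qed.

Lemma iter_zero (V : lmodType K) (F : {linear V -> V}) N N' v :
  iter N F v = 0 -> (N <= N')%N -> iter N' F v = 0.
Proof.
move=> FN /subnK <-; rewrite iterD FN.
by elim: (N' - N)%N => //= m ->; rewrite linear0.
Qed.

Lemma good_prod lam V W : good_rep lam V -> good_rep lam W ->
  good_rep lam (prod_rep V W) /\
  forall nu, character (prod_rep V W) nu = (character V nu + character W nu)%N.
Proof.
move=> [gV fV bV iV] [gW fW bW iW]; pose P := prod_rep V W.
have [f [_ fE]] := prod_rep_fst V W.
have [il [ilh ilE]] := prod_rep_inl V W; have [ir [irh irE]] := prod_rep_inr V W.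
have irI : injective ir by move=> x y; rewrite !irE => -[].
have wP nu (p : P) : weight_space P nu p <->
    weight_space V nu p.1 /\ weight_space W nu p.2.
  split=> [pP|[pP qP] t]; last by rewrite /= /prod_act pP qP.
  by split=> t; have /pair_equal_spec [] := pP t.
have dP nu : has_dim (weight_space P nu) (character W nu + character V nu)%N.
  apply: (has_dim_ker_image (f := f) (weight_space_subspace P nu)).
    have -> : weight_space P nu `&` f @^-1` [set 0] = ir @` weight_space W nu.
      apply/seteqP; split=> [[v w] [/wP [/= vP wwP]]|_ [w wwP <-]].
        by rewrite /preimage /= fE /= => ->; exists w => //; rewrite irE.
      rewrite /preimage /= fE irE; split=> //; apply/wP; split=> //=.
      exact: (weight_space_subspace V nu).1.
    apply: has_dim_image_inj irI _; first exact: weight_space_subspace.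
    exact: finite_weightsP.
  have -> : f @` weight_space P nu = weight_space V nu.
    apply/seteqP; split=> [_ [p /wP [pP _] <-]|v vP]; first by rewrite fE.
    exists ((v, 0) : P); last by rewrite fE.
    by apply/wP; split=> //=; apply: (weight_space_subspace W nu).1.
  exact: finite_weightsP.
split; last by move=> nu; rewrite addnC; apply: characterE.
split=> [[v w]|nu|nu [[v w] p0 /wP [/= vP wwP]]|i [v w]].
- have -> : (v, w) = il v + ir w :> P.
    by rewrite ilE irE; apply/pair_equal_spec; rewrite /= addr0 add0r.
  by apply: (subspaceD (weight_span_subspace P _)); apply: weight_span_hom.
- by eexists; apply: dP.
- have [v0|v0] := eqVneq v 0; last by apply: bV; exists v.
  apply: bW; exists w => //; apply: contraNneq p0 => w0.
  by apply/eqP/pair_equal_spec.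
- have itE x N : iter N (act x) ((v, w) : P) = (iter N (act x) v, iter N (act x) w).
    by elim: N => //= N ->.
  have [N [eN fN]] := iV i v; have [N' [eN' fN']] := iW i w.
  exists (N + N')%N; rewrite !itE; split; apply/pair_equal_spec; split.
  + by apply: (iter_zero (F := act _)) eN _; rewrite leq_addr.
  + by apply: (iter_zero (F := act _)) eN' _; rewrite leq_addl.
  + by apply: (iter_zero (F := act _)) fN _; rewrite leq_addr.
  + by apply: (iter_zero (F := act _)) fN' _; rewrite leq_addl.
Qed.

Lemma good_subrep lam M (S : set M) : good_rep lam M -> subrep S ->
  exists U W (f : {linear U -> M}) (h : {linear M -> W}),
    [/\ rep_hom f /\ injective f, rep_hom h /\ forall y, exists v, h v = y,
        forall v, (exists u, f u = v) <-> S v, forall v, h v = 0 <-> S v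
      & [/\ good_rep lam U, good_rep lam W
          & forall nu, character M nu = (character U nu + character W nu)%N]].
Proof.
move=> gM sS; have [f [fh fI fS]] := sub_rep_spec sS.
have [h [hh hS hE]] := quot_rep_spec sS.
exists (sub_rep sS), (quot_rep sS), f, h; split=> //.
- by move=> v; split=> /fS.
- by move=> v; split=> /hE.
- by apply: (good_exact fh fI hh hS) gM => v; split=> [/fS/hE|/hE/fS].
Qed.

(** A vector [v] of maximal weight [nu] generates a highest weight submodule [U]
    of [M], and [L] is the quotient of [U] by the sum [N'] of its submodules that
    miss the generator; this sum misses it too, since all its weights are strictly
    below [nu]. The remaining layers [N'] and [M / U] are put together in the
    direct sum [M'], which has the right character. *)
Lemma good_step lam M nu : good_rep lam M -> is_weight M nu ->
  (forall mu, is_weight M mu -> ht mu <= ht nu) ->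
  exists L M', [/\ simple_integrable L, is_highest_weight L nu, good_rep lam M'
    & forall mu, character M mu = (character L mu + character M' mu)%N].
Proof.
move=> gM [v v0 vP] nutop; have vr := top_weight_raise Dht vP nutop.
have sN := hw_span_subrep Dht vP vr.
have [U [W [f [h [[fh fI] [hh hS] fN hN [gU gW chM]]]]]] := good_subrep gM sN.
have [u uE] : exists u, f u = v by apply/fN; apply: (hw_span_word v [::]).
have u0 : u != 0 by apply: contraNneq v0 => u0; rewrite -uE u0 linear0.
have uP : weight_space U nu u by apply: (weight_space_hom_inj fh fI); rewrite uE.
have ur i : act (raising K i) u = 0 by apply: fI; rewrite fh uE vr linear0.
have fw w : f (lower_word w u) = lower_word w v.
  by elim: w => //= i w IH; rewrite fh IH.
have ugen x : hw_span u x.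
  have : hw_span v (f x) by apply/fN; exists x.
  move=> /(_ (f @` hw_span u)) [||y yP /fI <- //].
    exact/subspace_image/hw_span_subspace.
  by move=> w; exists (lower_word w u) => //; apply: (hw_span_word u w).
pose N' := [set x : U | exists2 S : set U, subrep S /\ ~ S u & S x].
have N'below (S : set U) x : subrep S -> ~ S u -> S x ->
    weight_span (strictly_below nu) x.
  by move=> sS Su Sx; apply: (hw_span_proper Dht uP sS).
have sN' : subrep N'.
  split=> [|a x y [S [sS Su] Sx] [T [sT Tu] Ty]|z x [S [sS Su] Sx]].
  - exists [set 0] => //; split; first exact: subrep_set0.
    by move=> /eqP; rewrite (negPf u0).
  - exists [set z | exists p q, [/\ S p, T q & z = p + q]]; last first.
      exists (a *: x), y; split=> //; apply: subspaceZ => //; exact: subrep_subspace.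
    split.
      split=> [|b _ _ [p [q [Sp Tq ->]]] [p' [q' [Sp' Tq' ->]]]|z _ [p [q [Sp Tq ->]]]].
      + by exists 0, 0; rewrite addr0; case: sS; case: sT.
      + exists (b *: p + p'), (b *: q + q'); rewrite scalerDr addrACA.
        by split=> //; [case: sS => _ SL _; apply: SL|case: sT => _ TL _; apply: TL].
      + exists (act z p), (act z q); rewrite linearD.
        by split=> //; apply: subrep_act.
    move=> [p [q [Sp Tq uE']]]; case/eqP: u0.
    apply: (weight_span_eq0 Dht (Q := strictly_below nu)) uP _.
      by move=> /(strictly_below_ht Dht); rewrite ltxx.
    rewrite uE'; apply: (subspaceD (weight_span_subspace _ _)).
      exact: N'below Sp.
    exact: N'below Tq.
  - by exists S => //; apply: subrep_act.
have N'u : ~ N' u by case=> S [].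
have [U' [L [f' [h' [_ [hh' hS'] _ hN' [gU' gL chU]]]]]] := good_subrep gU sN'.
have hu0 : h' u != 0 by apply/eqP => /hN'.
have genL (S : set L) : subrep S -> S (h' u) -> S = setT.
  move=> sS Su; apply/seteqP; split=> // y _; have [x <-] := hS' y.
  have := hw_span_min (subrep_preimage hh' sS); apply; last exact: ugen.
  exact: Su.
have [gM' chM'] := good_prod gU' gW.
exists L, (prod_rep U' W); split=> //.
- split; [split|by case: gL|exact: good_category_O gL].
    by exists (h' u).
  move=> S sS; case: (pselect (S (h' u))) => [/(genL S sS)|Su]; first by right.
  left; apply/seteqP; split=> [y Sy|_ ->]; last by case: sS.
  have [x xE] := hS' y; rewrite -xE in Sy *; apply/hN'.
  by exists (h' @^-1` S) => //; split=> //; apply: subrep_preimage.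
- exists (h' u); split=> //; first exact: weight_space_hom.
  by move=> i; rewrite -hh' ur linear0.
- by move=> mu; rewrite chM chU chM' addnA [(character L mu + _)%N]addnC.
Qed.

End Characters.

Section Decomposition.
Variables (K : numFieldType) (D : rootDatum) (ht : weight D -> int).
Hypothesis Dht : graded_datum ht.
Local Notation g := (kac_moody K D).
Implicit Types (V W U M L : lieRep g) (mu nu lam : weight D).

Lemma simple_integrable_finite V : simple_integrable V -> finite_weights V.
Proof. by case=> _ _ []. Qed.

Lemma simple_integrable_hw V : simple_integrable V -> exists lam, is_highest_weight V lam.
Proof. by case=> sV _ oV; apply: (simple_highest_weight Dht). Qed.

Lemma rep_iso_character V W nu : finite_weights V -> rep_iso V W ->
  character W nu = character V nu.
Proof.
move=> fV [f fb fh]; apply: characterE.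
have -> : weight_space W nu = f @` weight_space V nu.
  apply/seteqP; split=> [y yP|_ [x xP <-]]; last exact: weight_space_hom.
  have [f' fK f'K] := fb; exists (f' y); rewrite ?f'K //.
  by apply: (weight_space_hom_inj fh (bij_inj fb)); rewrite f'K.
apply: has_dim_image_inj (bij_inj fb) (finite_weightsP nu fV).
exact: weight_space_subspace.
Qed.

(** ** Existence of a nonnegative decomposition *)

(** When [M] has no weight left, [L] has character 0 and the sequence of steps
    goes on without effect. The last clause is the progress made: whatever weight
    of [M] is considered, [L] takes away one that is at least as high. *)
Definition step_spec lam M L M' :=
  [/\ good_rep lam M',
      forall mu, character M mu = (character L mu + character M' mu)%N,
      simple_integrable L \/ forall mu, character L mu = 0%N
    & forall mu, is_weight M mu ->
        exists nu, [/\ is_weight M nu, ht mu <= ht nu & (0 < character L nu)%N]].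

Lemma good_stepP lam M : good_rep lam M -> exists L M', step_spec lam M L M'.
Proof.
move=> gM; have [_ fM bM _] := gM.
have [[mu0 mu0P]|noW] := pselect (exists mu, is_weight M mu); last first.
  have c0 mu : character M mu = 0%N.
    apply/eqP; rewrite -leqn0 leqNgt; apply/negP => /(character_gt0 _ fM) ?.
    by apply: noW; exists mu.
  exists M, M; split=> // [mu|| mu muP]; rewrite ?c0 //; first by right.
  by case: noW; exists mu.
have [nu nuP nutop] : exists2 nu, is_weight M nu &
    forall mu, is_weight M mu -> ht mu <= ht nu.
  apply: (@max_weight _ ht _ (ht lam)); first by exists mu0.
  by move=> nu /bM; apply: (Qplus_ht Dht).
have [L [M' [sL hL gM' chM]]] := good_step Dht gM nuP nutop.
exists L, M'; split=> // [|mu /nutop munu]; first by left.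
exists nu; split=> //; apply/character_gt0; first exact: simple_integrable_finite.
exact: highest_weight_weight hL.
Qed.

Fixpoint words_upto (idx : seq (simple_index D)) d : seq (seq (simple_index D)) :=
  if d is d'.+1 then
    [::] :: [seq i :: w | i <- idx, w <- words_upto idx d'] else [:: [::]].

Lemma words_uptoP idx d w : {subset w <= idx} -> (size w <= d)%N ->
  w \in words_upto idx d.
Proof.
elim: d w => [|d IH] [|i w] //= wi dw; rewrite inE /=.
apply/allpairsP; exists (i, w); rewrite IH // ?wi ?mem_head //.
by move=> j jw; apply: wi; rewrite inE jw orbT.
Qed.

Section Sequence.
Variables (lam : weight D) (idx : seq (simple_index D)).
Hypothesis idxP : forall i, i \in idx.

Definition weights_upto d :=
  [seq mu <- undup [seq lam - root_sum w | w <- words_upto idx d] | ht lam - d%:Z <= ht mu].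

Lemma weights_uptoP d mu : Qplus (lam - mu) -> ht lam - d%:Z <= ht mu ->
  mu \in weights_upto d.
Proof.
move=> /QplusP [w E] le_d; rewrite mem_filter le_d mem_undup; apply/mapP; exists w.
  apply: words_uptoP; first by move=> i _.
  have := ht_root_sum Dht w; rewrite -E (htB Dht).
  by move: le_d; lia.
by rewrite -E opprB addrC subrK.
Qed.

(** Peeling off simple modules at maximal weights: the number of weights, with
    multiplicity, at a given depth or above drops at every step until it
    vanishes, so each weight is exhausted after finitely many steps. *)
Lemma simple_sequence M : good_rep lam M ->
  exists (L : nat -> lieRep g) (B : weight D -> nat),
    (forall k, simple_integrable (L k) \/ forall mu, character (L k) mu = 0%N) /\
    forall mu, (forall k, (B mu <= k)%N -> character (L k) mu = 0%N) /\
      character M mu = (\sum_(k < B mu) character (L k) mu)%N.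
Proof.
move=> gM; pose state := {M : lieRep g | good_rep lam M}.
have step (s : state) : {Ls : lieRep g * state | step_spec lam (sval s) Ls.1 (sval Ls.2)}.
  apply: cid; have [L [M' LM']] := good_stepP (svalP s).
  have gM' : good_rep lam M' by case: LM'.
  by exists (L, exist _ M' gM').
pose st k := iter k (fun s => (sval (step s)).2) (exist _ M gM : state).
pose L k := (sval (step (st k))).1.
have stP k : step_spec lam (sval (st k)) (L k) (sval (st k.+1)).
  exact: (svalP (step (st k))).
pose T d k := (\sum_(mu <- weights_upto d) character (sval (st k)) mu)%N.
have Tdec d k : (T d k.+1 <= (T d k).-1)%N.
  have [gM' chM _ top] := stP k.
  have TE : T d k = (\sum_(mu <- weights_upto d) character (L k) mu + T d k.+1)%N.
    by rewrite /T -big_split; apply: eq_bigr => mu _; apply: chM.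
  have [->|Tpos] := posnP (T d k.+1); first by [].
  suff : (0 < \sum_(mu <- weights_upto d) character (L k) mu)%N by lia.
  have [_ fst_ bst _] := svalP (st k).
  have [mu muw mu0] : exists2 mu, mu \in weights_upto d &
      (0 < character (sval (st k)) mu)%N.
    apply: contrapT => noM; move: Tpos; rewrite /T big_seq big1 // => mu muw.
    apply/eqP; rewrite -leqn0 leqNgt; apply/negP => c0; apply: noM; exists mu => //.
    by rewrite chM; lia.
  have /top [nu [nuP munu nu0]] : is_weight (sval (st k)) mu by apply/character_gt0.
  have nuw : nu \in weights_upto d.
    apply: weights_uptoP; first exact: bst.
    by apply: le_trans munu; move: muw; rewrite mem_filter => /andP [].
  by rewrite (big_rem nu) //=; lia.
have Tle d k : (T d k <= T d 0 - k)%N.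
  by elim: k => [|k IH]; [rewrite subn0|have := Tdec d k; lia].
pose B mu := T `|ht lam - ht mu|%N 0%N.
have chst k mu : character M mu =
    (\sum_(j < k) character (L j) mu + character (sval (st k)) mu)%N.
  elim: k => [|k IH]; first by rewrite big_ord0.
  by have [_ chM _ _] := stP k; rewrite IH big_ord_recr /= -addnA chM.
have st0 k mu : (B mu <= k)%N -> character (sval (st k)) mu = 0%N.
  move=> Bk; apply/eqP; rewrite -leqn0 leqNgt; apply/negP => c0.
  have [_ fk bk _] := svalP (st k).
  have /bk Qmu : is_weight (sval (st k)) mu by apply/character_gt0.
  have muw : mu \in weights_upto `|ht lam - ht mu|%N.
    by apply: weights_uptoP => //; have := Qplus_ht Dht Qmu; lia.
  have := Tle `|ht lam - ht mu|%N k; rewrite -/(B mu) /T (big_rem mu) //=.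
  by lia.
exists L, B; split=> [k|mu]; first by case: (stP k).
split=> [k Bk|]; last by rewrite (chst (B mu) mu) st0 ?addn0.
by have [_ chM _ _] := stP k; have := chM mu; rewrite st0 //; lia.
Qed.

End Sequence.

Lemma simple_representatives (L : nat -> lieRep g) b : exists s : seq nat,
  [/\ forall i, i \in s -> (i < b)%N /\ simple_integrable (L i), uniq s,
      forall i j, i \in s -> j \in s -> rep_iso (L i) (L j) -> i = j
    & forall k, (k < b)%N -> simple_integrable (L k) ->
        exists2 i, i \in s & rep_iso (L k) (L i)].
Proof.
elim: b => [|b [s [sP us sI sC]]]; first by exists [::].
have sP' i : i \in s -> (i < b.+1)%N /\ simple_integrable (L i).
  by move=> /sP [/ltnW ? ?].
have [[Lb Lbs]|H] := pselect (simple_integrable (L b) /\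
    forall i, i \in s -> ~ rep_iso (L b) (L i)); last first.
  exists s; split=> // k; rewrite ltnS leq_eqVlt => /orP [/eqP -> Lb|]; last exact: sC.
  by apply: contrapT => nI; apply: H; split=> // i si bi; apply: nI; exists i.
have bs : b \notin s by apply/negP => /sP []; rewrite ltnn.
exists (b :: s); split=> /=.
- by move=> i; rewrite inE => /orP [/eqP -> //|/sP'].
- by rewrite bs.
- move=> i j; rewrite !inE => /orP [/eqP ->|si] /orP [/eqP ->|sj] //.
  + by move=> /(Lbs j sj).
  + by move=> /rep_iso_sym /(Lbs i si).
  + exact: sI.
- move=> k; rewrite ltnS leq_eqVlt => /orP [/eqP -> _|kb Lk].
    by exists b; [rewrite mem_head|apply: rep_iso_refl].
  by have [i si ?] := sC k kb Lk; exists i => //; rewrite inE si orbT.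
Qed.

Lemma good_decomposition lam M (idx : seq (simple_index D)) :
  (forall i, i \in idx) -> good_rep lam M ->
  exists2 m : lieRep g -> int, is_decomposition (character M) m & forall V, 0 <= m V.
Proof.
move=> idxP /(simple_sequence idxP) [L [B [LP BP]]].
pose e V k : bool := `[< simple_integrable (L k) /\ rep_iso (L k) V >].
pose m V : int := (\sum_(k < B (highest_weight V)) e V k)%N.
exists m => //; have e_lt V mu k : is_weight V mu -> e V k -> (k < B mu)%N.
  move=> Vmu /asboolP [sL LV]; rewrite ltnNge; apply/negP => /((BP mu).1 k) c0.
  suff : (0 < character (L k) mu)%N by rewrite c0.
  apply/character_gt0; first exact: simple_integrable_finite.
  by apply: rep_iso_weight Vmu; apply: rep_iso_sym.
have count V mu : simple_integrable V -> is_weight V mu ->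
    m V = (\sum_(k < B mu) e V k)%N.
  move=> sV Vmu; have /(highest_weightP) hV := simple_integrable_hw sV.
  have trunc b b' : (forall k, e V k -> (k < b)%N) -> (b <= b')%N ->
      (\sum_(k < b) e V k = \sum_(k < b') e V k)%N.
    move=> eb /subnKC <-; rewrite big_split_ord /= [X in (_ + X)%N]big1 ?addn0 //.
    move=> k _; case ek: (e V _) => //; have := eb _ ek.
    by rewrite ltnNge leq_addr.
  rewrite /m; set b := B _; congr Posz.
  have Hb k : e V k -> (k < b)%N by apply: e_lt (highest_weight_weight hV).
  have Hmu k : e V k -> (k < B mu)%N by apply: e_lt.
  by rewrite (trunc _ (maxn b (B mu)) Hb) ?leq_maxl // (trunc _ (maxn b (B mu)) Hmu) ?leq_maxr.
split=> [V W VW|mu].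
  have hw : highest_weight V = highest_weight W.
    congr (xget 0 _); apply/seteqP; split=> nu; first exact: rep_iso_highest_weight.
    by apply: rep_iso_highest_weight; apply: rep_iso_sym.
  rewrite /m hw; congr Posz; apply: eq_bigr => k _; congr nat_of_bool.
  apply: asbool_equiv_eq; split=> -[sL LV]; split=> //; apply: rep_iso_trans LV _ => //.
  exact: rep_iso_sym.
have [s [sP us sI sC]] := simple_representatives L (B mu).
have [_ ->] := BP mu.
exists (size s), (fun i => L (nth 0%N s i)); split.
- by move=> j; apply: (sP _ (mem_nth _ (ltn_ord j))).2.
- move=> i j /(sI _ _ (mem_nth _ (ltn_ord i)) (mem_nth _ (ltn_ord j))) /eqP.
  by rewrite nth_uniq // => /eqP/val_inj.
- move=> V sV mV Vmu; rewrite (count V mu sV Vmu) in mV.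
  have [k ek] : exists k : 'I_(B mu), e V k.
    apply: contrapT => noe; case/eqP: mV; congr Posz; apply: big1 => k _.
    by case ek: (e V k) => //; case: noe; exists k.
  have /asboolP [sL LV] := ek.
  have [i si Li] := sC k (ltn_ord k) sL.
  have is_ : (index i s < size s)%N by rewrite index_mem.
  exists (Ordinal is_); rewrite /= nth_index //.
  by apply: rep_iso_trans Li; apply: rep_iso_sym.
- pose F i := m (L i) * (character (L i) mu)%:Z.
  have -> : \sum_(j < size s) m (L (nth 0%N s j)) * (character (L (nth 0%N s j)) mu)%:Z
      = \sum_(i <- s) F i by rewrite (big_nth 0%N) big_mkord.
  have FE i : i \in s -> F i = (\sum_(k < B mu) e (L i) k * character (L k) mu)%N%:Z.
    move=> /sP [_ sLi]; have fLi := simple_integrable_finite sLi.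
    have [c0|] := posnP (character (L i) mu).
      rewrite /F c0 mulr0; congr Posz; apply/esym; apply: big1 => k _.
      case ek: (e _ k) => //; have /asboolP [sLk Lki] := ek.
      by rewrite -(rep_iso_character mu _ Lki) ?c0 //; apply: simple_integrable_finite.
    move=> /(character_gt0 _ fLi) Lmu; rewrite /F (count _ mu sLi Lmu) -PoszM big_distrl /=.
    congr Posz; apply: eq_bigr => k _.
    case ek: (e _ k) => //; have /asboolP [sLk Lki] := ek.
    by rewrite -(rep_iso_character mu _ Lki) //; apply: simple_integrable_finite.
  rewrite [RHS]big_seq [RHS](eq_bigr _ (fun i si => FE i si)) -[RHS]big_seq.
  rewrite -(big_morph Posz PoszD (erefl _)).
  congr Posz; rewrite [RHS]exchange_big; apply: eq_bigr => k _ /=.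
  case: (LP k) => [sLk|c0]; last by rewrite c0 big1 // => i _; rewrite muln0.
  have [i si Lki] := sC k (ltn_ord k) sLk.
  rewrite (bigD1_seq i) //= big_seq_cond big1 ?addn0.
    by rewrite (_ : e (L i) k = true) ?mul1n //; apply/asboolP.
  move=> j /andP [sj ji]; case ek: (e _ k) => //.
  have /asboolP [_ Lkj] := ek; case/eqP: ji; apply: sI => //.
  by apply: rep_iso_trans Lki; apply: rep_iso_sym.
Qed.

(** ** Uniqueness of the decomposition *)

Definition covers_at mu (m : lieRep g -> int) k (W : 'I_k -> lieRep g) :=
  forall V, simple_integrable V -> m V != 0 -> is_weight V mu ->
    exists j, rep_iso V (W j).

(** The sum over the classes does not depend on the list of representatives: for
    two lists, both sums equal the double sum over the pairs of isomorphic
    entries. *)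
Lemma decomposition_sum f (m : lieRep g -> int) mu k (W : 'I_k -> lieRep g) :
  is_decomposition f m -> (forall j, simple_integrable (W j)) ->
  (forall i j, rep_iso (W i) (W j) -> i = j) -> covers_at mu m W ->
  (f mu)%:Z = \sum_(j < k) m (W j) * (character (W j) mu)%:Z.
Proof.
move=> [miso /(_ mu) [l [U [sU dU cU ->]]]] sW dW cW.
pose F V := m V * (character V mu)%:Z.
have Fiso V V' : simple_integrable V -> rep_iso V V' -> F V = F V'.
  move=> sV VV'; rewrite /F (miso _ _ VV') (rep_iso_character mu _ VV') //.
  exact: simple_integrable_finite.
have Fwt V : simple_integrable V -> F V != 0 -> m V != 0 /\ is_weight V mu.
  move=> /simple_integrable_finite fV; rewrite mulf_eq0 negb_or => /andP [-> c0].
  by split=> //; apply/character_gt0 => //; rewrite lt0n.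
have half a b (X : 'I_a -> lieRep g) (Y : 'I_b -> lieRep g) :
    (forall i, simple_integrable (X i)) -> (forall i j, rep_iso (Y i) (Y j) -> i = j) ->
    covers_at mu m Y ->
    \sum_(i < a) F (X i) = \sum_(i < a) \sum_(j < b | `[< rep_iso (X i) (Y j) >]) F (X i).
  move=> sX dY cY; apply: eq_bigr => i _.
  have [F0|Fn0] := eqVneq (F (X i)) 0; first by rewrite F0 big1.
  have [mn0 wmu] := Fwt _ (sX i) Fn0; have [j XY] := cY _ (sX i) mn0 wmu.
  rewrite (big_pred1 j) // => j'; apply/asboolP/eqP => [XY'|-> //].
  by apply/esym/dY; apply: rep_iso_trans XY'; apply: rep_iso_sym.
rewrite -!/(F _) (half _ _ U W) // (half _ _ W U) //.
rewrite (exchange_big_dep predT) //=; apply: eq_bigr => j _.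
rewrite (eq_bigl (fun i => `[< rep_iso (W j) (U i) >])).
  by apply: eq_bigr => i /asboolP WU; apply/esym/Fiso.
by move=> i /=; apply: asbool_equiv_eq; split; apply: rep_iso_sym.
Qed.

Lemma common_classes f (m m' : lieRep g -> int) mu (V0 : lieRep g) :
  is_decomposition f m -> is_decomposition f m' -> exists k (W : 'I_k -> lieRep g),
  [/\ forall j, simple_integrable (W j), forall i j, rep_iso (W i) (W j) -> i = j,
      covers_at mu m W & covers_at mu m' W].
Proof.
move=> [_ /(_ mu) [k [W [sW _ cW _]]]] [_ /(_ mu) [k' [W' [sW' _ cW' _]]]].
pose L i := if (i < k)%N then oapp W V0 (insub i) else oapp W' V0 (insub (i - k)%N).
have LW (j : 'I_k) : L j = W j by rewrite /L ltn_ord valK.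
have LW' (j : 'I_k') : L (k + j)%N = W' j.
  by rewrite /L ltnNge leq_addr /= addKn valK.
have [s [sP us sI sC]] := simple_representatives L (k + k').
exists (size s), (fun i => L (nth 0%N s i)).
have cov V i : (i < k + k')%N -> simple_integrable (L i) -> rep_iso V (L i) ->
    exists j : 'I_(size s), rep_iso V (L (nth 0%N s j)).
  move=> ik sL VL; have [i' si' Li'] := sC i ik sL.
  have is_ : (index i' s < size s)%N by rewrite index_mem.
  by exists (Ordinal is_); rewrite /= nth_index //; apply: rep_iso_trans Li'.
split.
- by move=> j; apply: (sP _ (mem_nth _ (ltn_ord j))).2.
- move=> i j /(sI _ _ (mem_nth _ (ltn_ord i)) (mem_nth _ (ltn_ord j))) /eqP.
  by rewrite nth_uniq // => /eqP/val_inj.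
- move=> V sV mV Vmu; have [j VW] := cW V sV mV Vmu.
  by apply: (cov V j); rewrite ?LW // ltn_addr.
- move=> V sV mV Vmu; have [j VW] := cW' V sV mV Vmu.
  by apply: (cov V (k + j)%N); rewrite ?LW' // ltn_add2l.
Qed.

(** Among the finitely many classes that have the highest weight [mu0] of a
    discrepancy as a weight, take a discrepancy [U] of maximal height. Comparing
    coefficients at the highest weight [mu1] of [U] gives another discrepancy
    [U'] with [mu1] as a weight; [U'] is higher than [U] and still has the
    weight [mu0]. *)
Lemma decomposition_uniq f (m m' : lieRep g -> int) V :
  is_decomposition f m -> is_decomposition f m' -> simple_integrable V -> m V = m' V.
Proof.
move=> mP mP' sV; apply: contrapT => /eqP dV.
have nz U : m U != m' U -> m U != 0 \/ m' U != 0.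
  by case: (eqVneq (m U) 0) => [->|]; [rewrite eq_sym; right|left].
have [mu0 hV] := simple_integrable_hw sV.
have [k [W [sW dW cW cW']]] := common_classes mu0 V mP mP'.
have cov U : simple_integrable U -> m U != m' U -> is_weight U mu0 ->
    exists j, rep_iso U (W j).
  by move=> sU /nz [mU|mU] Umu; [apply: cW|apply: cW'].
have diso U U' : rep_iso U U' -> (m U != m' U) = (m U' != m' U').
  by move=> UU'; rewrite (mP.1 _ _ UU') (mP'.1 _ _ UU').
have [j0 VW0] := cov V sV dV (highest_weight_weight hV).
pose h j := ht (highest_weight (W j)).
have Pj0 : (m (W j0) != m' (W j0)) && `[< is_weight (W j0) mu0 >].
  rewrite -(diso _ _ VW0) dV; apply/asboolP.
  exact: rep_iso_weight VW0 (highest_weight_weight hV).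
have [j /andP [dj /asboolP jmu0] jmax] := @Order.TotalTheory.arg_maxP _ _ _ j0
  (fun j => (m (W j) != m' (W j)) && `[< is_weight (W j) mu0 >]) h Pj0.
set U := W j in dj jmu0 jmax; have sU : simple_integrable U := sW j.
have /highest_weightP hU := simple_integrable_hw sU.
set mu1 := highest_weight U in hU.
have Umu1 := highest_weight_weight hU.
have [l [Z [sZ dZ cZ cZ']]] := common_classes mu1 V mP mP'.
have [i0 UZ] : exists i, rep_iso U (Z i).
  by case: (nz _ dj) => mU; [apply: cZ|apply: cZ'].
have di0 : m (Z i0) != m' (Z i0) by rewrite -(diso _ _ UZ).
have /eqP := decomposition_sum mP sZ dZ cZ.
rewrite (decomposition_sum mP' sZ dZ cZ') eq_sym -subr_eq0 -sumrB (bigD1 i0) //= => S0.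
have [i1 i10 ni1] : exists2 i, i != i0 &
    m (Z i) * (character (Z i) mu1)%:Z - m' (Z i) * (character (Z i) mu1)%:Z != 0.
  apply: contrapT => noi; move: S0; rewrite big1 ?addr0 => [|i ii0].
    rewrite -mulrBl mulf_eq0 subr_eq0 (negPf di0) /=.
    have /(character_gt0 _ (simple_integrable_finite (sZ i0))) : is_weight (Z i0) mu1.
      exact: rep_iso_weight UZ Umu1.
    by rewrite lt0n => /negPf c0 /eqP [] /eqP; rewrite c0.
  by apply/eqP/negPn/negP => ni; apply: noi; exists i.
move: ni1; rewrite -mulrBl mulf_eq0 negb_or subr_eq0 => /andP [di1 c1].
have Zmu1 : is_weight (Z i1) mu1.
  by apply/character_gt0; [apply: simple_integrable_finite|rewrite lt0n].
have [simU intU _] := sU; have [simZ intZ _] := sZ i1.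
have Zmu0 : is_weight (Z i1) mu0 by apply: (weights_sub Dht simU intU hU intZ Zmu1).
have /highest_weightP hZ := simple_integrable_hw (sZ i1).
have [j1 ZW] := cov _ (sZ i1) di1 Zmu0.
have hw1 : highest_weight (W j1) = highest_weight (Z i1).
  have /highest_weightP hW1 := simple_integrable_hw (sW j1).
  have hW2 := rep_iso_highest_weight ZW hZ.
  by have := highest_weight_uniq Dht hW1 hW2.
have := jmax j1; rewrite -(diso _ _ ZW) di1 /= => /(_ _).
have -> : `[< is_weight (W j1) mu0 >] by apply/asboolP; apply: rep_iso_weight ZW Zmu0.
rewrite /h -/U -/mu1 hw1 => /(_ isT) le_ht.
have /QplusP [w wE] := highest_weight_bounded Dht hZ Zmu1.
have := ht_root_sum Dht w; case: w wE => [|i w] wE; rewrite -wE (htB Dht) /=; last by lia.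
move=> _; move/eqP: wE; rewrite /root_sum big_nil subr_eq0 => /eqP wE.
case/eqP: i10; apply: dZ; apply: rep_iso_trans UZ.
by apply: (simple_hw_iso Dht simZ simU hZ); rewrite wE.
Qed.

End Decomposition.

(** * Linear functionals on the two weight lattices *)

Local Notation P := {malg int[int]}.

Definition lfun (a : int -> int) : P -> int := mmap idfun a.

Lemma lfunD a : {morph lfun a : mu nu / mu + nu}.
Proof. exact: mmapD. Qed.

Lemma lfunB a mu nu : lfun a (mu - nu) = lfun a mu - lfun a nu.
Proof. exact: mmapB. Qed.

Lemma lfunMn a mu m : lfun a (mu *+ m) = lfun a mu *+ m.
Proof. exact: mmapMn. Qed.

Lemma lfun_sum a (I : Type) (r : seq I) (F : I -> P) :
  lfun a (\sum_(i <- r) F i) = \sum_(i <- r) lfun a (F i).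
Proof. exact: raddf_sum. Qed.

Lemma lfun_alpha a j : lfun a (alpha j) = a j *+ 2 - a (j + 1) - a (j - 1).
Proof.
by rewrite /alpha /fund !lfunB lfunMn /lfun !mmapU /= !mul1r.
Qed.

Lemma lfun_seq a (nu : P) (s : seq int) : uniq s ->
  (forall k, k \notin s -> nu@_k = 0) -> lfun a nu = \sum_(k <- s) nu@_k * a k.
Proof.
move=> us sP; rewrite /lfun (mmapEw (d := [fset k in s]%fset)).
  by apply: perm_big; apply: uniq_perm => // k; rewrite !inE.
by apply/fsubsetP => k; rewrite -mcoeff_neq0 inE; apply: contraNT => /sP ->.
Qed.

Lemma first_difference (g : int -> int) :
  exists a : int -> int, forall j, a (j + 1) - a j = g j.
Proof.
exists (fun j => match j with
  | Posz m => \sum_(k < m) g k%:Z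
  | Negz m => - \sum_(k < m.+1) g (- k.+1%:Z) end) => -[m|[|m]].
- have -> : Posz m + 1 = Posz m.+1 by lia.
  by apply/eqP; rewrite big_ord_recr /= subr_eq addrC.
- have -> : Negz 0 + 1 = 0%N by [].
  by rewrite big_ord_recr !big_ord0 /= !add0r opprK.
- have -> : Negz m.+1 + 1 = Negz m by rewrite !NegzE; lia.
  rewrite [X in _ - - X]big_ord_recr /= opprK addrA addNr add0r.
  by rewrite NegzE.
Qed.

Lemma second_difference (g : int -> int) :
  exists a : int -> int, forall j, a j *+ 2 - a (j + 1) - a (j - 1) = g j.
Proof.
have [d dP] := first_difference (fun j => - g (j + 1)).
have [a aP] := first_difference d; exists a => j.
have := aP j; have := aP (j - 1); have := dP (j - 1); rewrite /= subrK mulr2n.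
move: (a (j + 1)) (a (j - 1)) (d (j - 1)) (a j) (d j) (g j) => *; lia.
Qed.

(** On simple roots a functional takes minus the second difference of its
    coefficients, so that it can be prescribed there by solving a difference
    equation. *)
Definition dual (g : int -> int) : P -> int := lfun (sval (cid (second_difference g))).

Lemma dual_alpha g j : dual g (alpha j) = g j.
Proof. by rewrite /dual lfun_alpha; case: cid. Qed.

Lemma slinf_graded : @graded_datum slinf_datum (dual (fun=> 1)).
Proof.
split=> [mu nu t|mu nu E|i||i].
- exact: mcoeffD.
- by apply/malgP => k; apply: E.
- by rewrite cartan_slinfE eqxx.
- exact: lfunD.
- by rewrite /= dual_alpha.
Qed.

Section AffineHeight.
Variable n : nat.
Hypothesis n_ge1 : (1 <= n)%N.

(** On simple roots this is twice the height: [i * (n + 1 - i)] has second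
    difference -2, and the wrap-around at 0 is compensated by [delta]. *)
Definition aff_ht (mu : aff_weight n) : int :=
  \sum_(i < n.+1) mu.1 i * (i * (n.+1 - i))%N%:Z + mu.2 * (2 * n.+1)%N%:Z.

Lemma aff_htD : {morph aff_ht : mu nu / mu + nu}.
Proof.
move=> mu nu; rewrite /aff_ht addrACA -mulrDl -big_split /=; congr (_ + _).
by apply: eq_bigr => i _; rewrite ffunE mulrDl.
Qed.

Lemma aff_ht_fund (i : 'I_n.+1) : aff_ht (aff_fund i) = (i * (n.+1 - i))%N%:Z.
Proof.
rewrite /aff_ht mul0r addr0 (bigD1 i) //= big1 => [|j ji].
  by rewrite ffunE eqxx mul1r addr0.
by rewrite ffunE (negPf ji) mul0r.
Qed.

Lemma val_addZp1 (i : 'I_n.+1) :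
  (i + inZp 1 : 'I_n.+1) = (if i == n :> nat then 0 else i.+1)%N :> nat.
Proof.
have e1 : (1 %% n.+1)%N = 1%N by rewrite modn_small; lia.
rewrite /= e1 addn1; case: eqP => [->|ni]; first by rewrite modnn.
by rewrite modn_small //; have := ltn_ord i; lia.
Qed.

Lemma val_subZp1 (i : 'I_n.+1) :
  (i - inZp 1 : 'I_n.+1) = (if i == 0 :> nat then n else i.-1)%N :> nat.
Proof.
have e1 : (1 %% n.+1)%N = 1%N by rewrite modn_small; lia.
rewrite /= e1 subSS subn0 (modn_small (ltnSn n)).
case: eqP => [->|i0]; first by rewrite add0n modn_small.
have -> : (i + n = i.-1 + n.+1)%N by lia.
by rewrite modnDr modn_small //; have := ltn_ord i; lia.
Qed.

Lemma aff_ht_alpha (i : 'I_n.+1) : aff_ht (aff_alpha i) = 2.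
Proof.
have ht0 : aff_ht 0 = 0 by apply: (addrI (aff_ht 0)); rewrite -aff_htD !addr0.
have htN mu : aff_ht (- mu) = - aff_ht mu.
  by apply: (addrI (aff_ht mu)); rewrite -aff_htD !subrr ht0.
rewrite /aff_alpha mulr2n !aff_htD !htN !aff_ht_fund val_addZp1 val_subZp1.
have dlt : aff_ht (aff_delta n) = (2 * n.+1)%N%:Z.
  by rewrite /aff_ht big1 ?add0r ?mul1r // => j _; rewrite ffunE mul0r.
have := ltn_ord i; rewrite -[i == 0]/(i == 0 :> nat).
case: (eqVneq (i : nat) 0%N) => [->|i0]; rewrite ?mulr1n ?mulr0n ?dlt ?ht0;
  case: (eqVneq (_ : nat) n) => [e|ne]; nia.
Qed.

Lemma aff_alpha1 (i j : 'I_n.+1) :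
  (aff_alpha i).1 j = (j == i)%:R *+ 2 - (j == i + inZp 1)%:R - (j == i - inZp 1)%:R.
Proof.
by rewrite /aff_alpha mulr2n; case: (i == 0); rewrite /= !ffunE /= ?addr0 mulr2n.
Qed.

Lemma aff_alpha2 (i : 'I_n.+1) : (aff_alpha i).2 = (i == 0)%:R.
Proof. by rewrite /aff_alpha mulr2n; case: (i == 0). Qed.

Lemma affine_graded : @graded_datum (affine_datum n) aff_ht.
Proof.
split=> [mu nu [i|]|mu nu E|i||i] //=.
- by rewrite ffunE.
- rewrite [mu]surjective_pairing [nu]surjective_pairing; congr (_, _).
    by apply/ffunP => i; apply: (E (Some i)).
  exact: (E None).
- rewrite /cartan /= aff_alpha1 eqxx -!(inj_eq val_inj) /=.
  have := val_addZp1 i; have := val_subZp1 i; rewrite /= => -> ->.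
  have ltin := ltn_ord i; have -> : ((i : nat) == (if (i : nat) == 0 then n else i.-1))%N = false.
    by apply/eqP; case: eqP => e; lia.
  have -> : ((i : nat) == (if (i : nat) == n then 0 else i.+1))%N = false.
    by apply/eqP; case: eqP => e; lia.
  by rewrite !subr0.
- exact: aff_htD.
- by rewrite aff_ht_alpha.
Qed.

End AffineHeight.

(** * Locally finite sums of operators *)

(** For commuting operators the binomial formula gives the exponent; the
    induction replaces [v] by [A v] and by [B v]. *)
Lemma nilpotentD (K : fieldType) (V : lmodType K) (A B : {linear V -> V}) a b v :
  (forall x, A (B x) = B (A x)) -> iter a.+1 A v = 0 -> iter b.+1 B v = 0 ->
  iter (a + b).+1 (fun x => A x + B x) v = 0.
Proof.
move=> AB; have [m] := ubnP (a + b); elim: m a b v => // m IH a b v.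
rewrite ltnS => abm Av Bv; pose S x := A x + B x.
have SD N x y : iter N S (x + y) = iter N S x + iter N S y.
  by elim: N => //= N ->; rewrite /S !linearD addrACA.
have S0 N : iter N S 0 = 0 by elim: N => //= N ->; rewrite /S !linear0 addr0.
have AN N x : iter N A (B x) = B (iter N A x) by elim: N => //= N ->; rewrite AB.
have BN N x : iter N B (A x) = A (iter N B x) by elim: N => //= N ->; rewrite -AB.
rewrite iterSr -/S SD.
have -> : iter (a + b) S (A v) = 0.
  case: a abm Av => [_ /= ->|a abm Av]; first exact: S0.
  by rewrite addSn; apply: IH; [lia|rewrite -iterSr|rewrite BN Bv linear0].
rewrite add0r; case: b abm Bv => [_ /= ->|b abm Bv]; first exact: S0.
by rewrite addnS; apply: IH; [lia|rewrite AN Av linear0|rewrite -iterSr].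
Qed.

Lemma nilpotent_sum (K : fieldType) (V : lmodType K) (I : Type) (s : seq I)
    (A : I -> {linear V -> V}) (a : I -> nat) v :
  (forall i j x, A i (A j x) = A j (A i x)) ->
  (forall i, iter (a i).+1 (A i) v = 0) ->
  iter (\sum_(i <- s) a i).+1 (fun x => \sum_(i <- s) A i x) v = 0.
Proof.
move=> AA Av; elim: s => [|i s IH]; first by rewrite /= big_nil.
have lin : linear (fun x => \sum_(i <- s) A i x).
  move=> c x y; rewrite scaler_sumr -big_split.
  by apply: eq_bigr => j _; rewrite linearP.
have [B BE] := linear_pack lin.
rewrite (_ : (fun x => _) = (fun x => A i x + B x)); last first.
  by apply/funext => x; rewrite big_cons BE.
rewrite big_cons; apply: nilpotentD => [x||]; [|exact: Av|by rewrite (eq_iter BE)].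
by rewrite !BE linear_sum; apply: eq_bigr => j _ /=; rewrite AA.
Qed.

Definition ints (B : nat) : seq int := [seq k%:Z - B%:Z | k <- iota 0 (2 * B).+1].

Lemma mem_ints B (j : int) : (j \in ints B) = (`|j| <= B)%N.
Proof.
apply/mapP/idP => [[k]|jB]; first by rewrite mem_iota => /andP [_ kB] ->; lia.
by exists `|(j + B%:Z)%R|%N; [rewrite mem_iota|]; lia.
Qed.

Lemma ints_uniq B : uniq (ints B).
Proof. by rewrite map_inj_uniq ?iota_uniq // => i j; lia. Qed.

Section SlInfinity.
Variable K : numFieldType.
Local Notation g := (slinf K).
Local Notation D := slinf_datum.
Local Notation slgrd := slinf_graded.
Implicit Types (V : lieRep g) (i j k : int).

Definition root_vector (b : bool) j : g :=
  if b then raising K (j : simple_index D) else lowering K (j : simple_index D).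

Lemma root_vector_serre b i j : i != j ->
  bracket (root_vector b i) (bracket (root_vector b i) (root_vector b j)) = 0 /\
  (i != j + 1 -> j != i + 1 -> bracket (root_vector b i) (root_vector b j) = 0).
Proof.
move=> nij.
pose gen k : lie_term K (chevalley D) :=
  LGen K (if b then Xplus (k : simple_index D) else Xminus (k : simple_index D)).
have E : lie_class (@serre_rel K D) (iter `|1 - @cartan D i j|%N (LBr (gen i)) (gen j)) = 0.
  apply/presentedP; apply: lc_rel.
  by rewrite /gen; case: (b); [apply: serre_plus|apply: serre_minus].
have rE k : lie_class (@serre_rel K D) (gen k) = root_vector b k.
  by rewrite /gen; case: (b).
move: E; rewrite cartan_slinfE (negPf nij); case: ifP => [adj|nadj].
  rewrite -[absz _]/2%N /= -!presented_brE rE rE => E; split=> // n1 n2.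
  by move: adj; rewrite (negPf n1) (negPf n2).
rewrite -[absz _]/1%N /= -presented_brE rE rE => E.
split=> [|_ _]; last exact: E.
by rewrite E; exact: (bracket0r (root_vector b i)).
Qed.

Lemma root_vector_comm b i j : i != j + 1 -> j != i + 1 ->
  bracket (root_vector b i) (root_vector b j) = 0.
Proof.
have [->|nij] := eqVneq i j; first by move=> _ _; apply: bracketxx.
exact: (root_vector_serre b nij).2.
Qed.

Lemma act_root_vectorC V b i j (v : V) : i != j + 1 -> j != i + 1 ->
  act (root_vector b i) (act (root_vector b j) v) =
  act (root_vector b j) (act (root_vector b i) v).
Proof.
move=> n1 n2; apply/eqP; rewrite -subr_eq0 -act_bracket root_vector_comm //.
by rewrite act0l.
Qed.

(** ** Simple modules are locally finite *)

Section LocalFiniteness.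
Variables (V : lieRep g) (lam : weight D).
Hypotheses (V_simple : simple_rep V) (V_hw : is_highest_weight V lam).

Lemma support_bound : exists M : nat, forall j, (M < `|j|)%N -> (lam : P)@_j = 0.
Proof.
have [M MP] : exists M : nat, forall j, j \in (msupp lam : seq int) -> (`|j| <= M)%N.
  elim: (msupp lam : seq int) => [|k s [M MP]]; first by exists 0%N.
  by exists (maxn `|k| M) => j; rewrite inE leq_max => /orP [/eqP ->|/MP ->];
    rewrite ?leqnn ?orbT.
by exists M => j; rewrite ltnNge => /negP jM; apply: mcoeff_outdom; apply/negP => /MP.
Qed.

(** Otherwise this vector is killed by all raising operators and generates a
    submodule that has only weights strictly below [lam]. *)
Lemma lower_hw_eq0 v j : weight_space V lam v ->
  (forall i, act (raising K (i : simple_index D)) v = 0) ->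
  v != 0 -> (lam : P)@_j = 0 -> act (lowering K (j : simple_index D)) v = 0.
Proof.
move=> vP vr v0 lj; apply: contrapT => /eqP u0; set u := act _ v in u0.
have uP : weight_space V (lam - sroot (j : simple_index D)) u.
  exact: (weight_space_lower slgrd).
have ur i : act (raising K (i : simple_index D)) u = 0.
  rewrite act_raise_lower vr linear0 add0r; case: eqP => // ij.
  by rewrite vP /= ij lj scale0r.
have sS := hw_span_subrep slgrd uP ur.
have uu : hw_span u u := hw_span_word u [::].
have [S0|ST] := V_simple.2 _ sS; first by move: uu; rewrite S0 => /eqP; rewrite (negPf u0).
have vu : hw_span u v by rewrite ST.
have := Qplus_ht slgrd (hw_span_weight slgrd uP vu vP v0).
by rewrite (htB slgrd) /= dual_alpha; lia.
Qed.

(** The lowering operator of index [j] commutes with all the letters, so it acts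
    first, on the highest weight vector. *)
Lemma lower_far_word_eq0 v M (w : seq (simple_index D)) : weight_space V lam v ->
  (forall i, act (raising K (i : simple_index D)) v = 0) -> v != 0 ->
  (forall j, (M < `|j|)%N -> (lam : P)@_j = 0) ->
  forall B : nat, (M <= B)%N -> (forall i : int, i \in (w : seq int) -> (`|i| <= B)%N) ->
  forall j, (B.+1 < `|j|)%N ->
    act (lowering K (j : simple_index D)) (lower_word w v) = 0.
Proof.
move=> vP vr v0 lM B MB; elim: w => [|i w IH] wB j Bj /=.
  by apply: lower_hw_eq0 => //; apply: lM; lia.
have iB := wB i (mem_head _ _).
rewrite [LHS](@act_root_vectorC V false j i) /=; [|lia|lia].
by rewrite IH ?linear0 // => k kw; apply: wB; rewrite inE kw orbT.
Qed.

(** Each new letter of a nonzero word is at distance at most 1 from the letters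
    to its right or from the support of [lam]. *)
Lemma word_letters v M (w : seq (simple_index D)) : weight_space V lam v ->
  (forall i, act (raising K (i : simple_index D)) v = 0) -> v != 0 ->
  (forall j, (M < `|j|)%N -> (lam : P)@_j = 0) -> lower_word w v != 0 ->
  forall i : int, i \in (w : seq int) -> (`|i| <= M + size w)%N.
Proof.
move=> vP vr v0 lM; elim: w => // i w IH /= w0.
have w0' : lower_word w v != 0 by apply: contraNneq w0 => ->; rewrite linear0.
have H := IH w0' => k; rewrite inE => /orP [/eqP ->|/H kM]; last by rewrite addnS; apply: leqW.
rewrite leqNgt; apply/negP => Mi; case/eqP: w0.
by apply: (lower_far_word_eq0 vP vr v0 lM (leq_addr (size w) M) H); rewrite -addnS.
Qed.

Definition locally_zero (x : V) (B : nat) := forall j, (B < `|j|)%N ->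
  [/\ act (root_vector true j) x = 0, act (root_vector false j) x = 0
    & act (toral K (j : torus D)) x = 0].

(** For toral elements, [h_j] is the bracket of two operators that kill the
    vector. *)
Lemma locally_finite x : exists B, locally_zero x B.
Proof.
have [v [v0 vP vr vgen]] := is_highest_weightE slgrd V_hw.
have [M lM] := support_bound; apply: (vgen x [set x | exists B, locally_zero x B]).
  split=> [|a y z [B yB] [C zC]]; first by exists 0%N => j _; rewrite !linear0.
  exists (maxn B C) => j; rewrite gtn_max => /andP [/yB [y1 y2 y3] /zC [z1 z2 z3]].
  by rewrite !linearP /= y1 y2 y3 z1 z2 z3 !scaler0 !addr0.
move=> w; pose N := (\max_(i <- (w : seq int)) `|i|)%N.
have wN (i : int) : i \in (w : seq int) -> (`|i| <= N)%N.
  by move=> iw; rewrite /N; apply: (@leq_bigmax_seq int w predT absz i).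
have wB (i : int) : i \in (w : seq int) -> (`|i| <= maxn M N)%N.
  by move=> /wN; rewrite leq_max => ->; rewrite orbT.
exists (maxn M N).+1 => j Bj.
have lj : act (root_vector false j) (lower_word w v) = 0.
  by apply: (lower_far_word_eq0 vP vr v0 lM (leq_maxl M N)).
have rj : act (root_vector true j) (lower_word w v) = 0.
  have jw : j \notin (w : seq int) by apply/negP => /wB; lia.
  elim: (w : seq int) jw => [|i u IH] /=; first by rewrite vr.
  rewrite inE negb_or => /andP [ji ju]; rewrite act_raise_lower.
  by rewrite [X in act _ X]IH // linear0 (negPf ji) addr0.
split=> //; have := act_raise_lower (j : simple_index D) (j : simple_index D) (lower_word w v).
by rewrite eqxx -/(root_vector true j) -/(root_vector false j) lj rj !linear0 add0r => <-.
Qed.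

End LocalFiniteness.

End SlInfinity.

(** * Folding *)

Section Residues.
Variable n : nat.

Lemma residue_addM (q : int) (r : nat) : (r < n.+1)%N ->
  residue n (q * n.+1%:Z + r%:Z) = r :> nat.
Proof.
move=> rn; rewrite /residue modzMDl modz_small ?le0z_nat //=.
by rewrite modn_small.
Qed.

Lemma residue_surj (i : int) : exists q : int, i = q * n.+1%:Z + (residue n i)%:Z.
Proof.
exists (i %/ n.+1)%Z; rewrite {1}(divz_eq i n.+1) /residue /=.
have r0 : 0 <= (i %% n.+1)%Z by apply: modz_ge0.
have rn : (i %% n.+1)%Z < n.+1 by apply: ltz_pmod.
rewrite modn_small ?gez0_abs //; lia.
Qed.

Lemma residue_succ (i : int) : (1 <= n)%N -> residue n (i + 1) = residue n i + inZp 1.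
Proof.
move=> n_ge1; have [q iE] := residue_surj i; apply: val_inj.
rewrite [RHS](val_addZp1 n_ge1); have := ltn_ord (residue n i).
case: eqP => [rn _|rn lt].
  have -> : i + 1 = (q + 1) * n.+1%:Z + 0%:Z by rewrite {1}iE rn mulrDl mul1r; lia.
  by rewrite [LHS]residue_addM.
have -> : i + 1 = q * n.+1%:Z + (residue n i).+1%:Z by rewrite {1}iE; lia.
by rewrite [LHS]residue_addM //; lia.
Qed.

Lemma residue_pred (i : int) : (1 <= n)%N -> residue n (i - 1) = residue n i - inZp 1.
Proof. by move=> n_ge1; rewrite -[i in RHS](subrK 1) residue_succ // addrK. Qed.

Lemma residue_not_adjacent (i j : int) : (1 <= n)%N ->
  residue n i = residue n j -> i != j + 1.
Proof.
move=> n_ge1 ij; apply/eqP => iE; move: ij; rewrite iE residue_succ //.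
move=> /(congr1 (@nat_of_ord _)); rewrite [LHS](val_addZp1 n_ge1).
by have := ltn_ord (residue n j); case: eqP => [e|e]; move: n_ge1; lia.
Qed.

End Residues.

Lemma sum_ints_widen (V : zmodType) (F : int -> V) B B' :
  (forall j, (B < `|j|)%N -> F j = 0) -> (B <= B')%N ->
  \sum_(j <- ints B') F j = \sum_(j <- ints B) F j.
Proof.
move=> F0 BB'; rewrite (bigID (mem (ints B))) /= [X in _ + X]big1 ?addr0; last first.
  by move=> j; rewrite mem_ints -ltnNge; apply: F0.
rewrite -big_filter; apply: perm_big; apply: uniq_perm.
- by rewrite filter_uniq // ints_uniq.
- exact: ints_uniq.
- by move=> j; rewrite mem_filter !mem_ints; case: leqP => // jB; rewrite (leq_trans jB).
Qed.

Section Folding.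
Variables (K : numFieldType) (n : nat).
Hypothesis n_ge1 : (1 <= n)%N.
Local Notation g := (slinf K).
Local Notation D := slinf_datum.
Local Notation DA := (affine_datum n).
Variables (V : lieRep g) (lam : weight D) (bd : V -> nat).
Hypothesis bdP : forall x, locally_zero x (bd x).
Implicit Types (i j k : int) (x : V).

Definition trunc (y : int -> g) B : g := \sum_(j <- ints B) y j.

Definition locally_finite_family (y : int -> g) :=
  forall x j, (bd x < `|j|)%N -> act (y j) x = 0.

(** The sum of all the [y j], which is finite on each vector. *)
Definition lf_op (y : int -> g) x := act (trunc y (bd x)) x.

Lemma lf_opE y x B : locally_finite_family y -> (bd x <= B)%N ->
  lf_op y x = act (trunc y B) x.
Proof.
move=> yP xB; rewrite /lf_op /trunc !act_suml.
by rewrite (sum_ints_widen _ xB) // => j; apply: yP.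
Qed.

Lemma lf_op_linear y : locally_finite_family y -> linear (lf_op y).
Proof.
move=> yP a u v; pose B := maxn (bd u) (maxn (bd v) (bd (a *: u + v))).
by rewrite !(@lf_opE y _ B) ?linearP // /B; lia.
Qed.

Definition fold_root_vector b (r : 'I_n.+1) j : g :=
  if residue n j == r then root_vector K b j else 0.

(** Coefficients on the [h_j] of the element of the affine torus: [h_r] collects
    the [h_j] with [j] of residue [r], and the degree operator must take the value
    1 on the [alpha j] with [j] divisible by [n + 1] and 0 on the others. *)
Definition kap (t : option 'I_n.+1) : int -> int :=
  if t is Some r then fun j => (residue n j == r)%:R
  else sval (cid (second_difference (fun j => (residue n j == 0)%:R))).

Definition kap_shift (t : option 'I_n.+1) : int :=
  if t is None then lfun (kap None) lam else 0.

Definition fold_toral t j : g := (kap t j)%:~R *: toral K (j : torus D).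

Definition fold_op (c : chevalley DA) x : V :=
  match c with
  | Xplus r => lf_op (fold_root_vector true r) x
  | Xminus r => lf_op (fold_root_vector false r) x
  | Tor t => lf_op (fold_toral t) x - (kap_shift t)%:~R *: x
  end.

(** The map on exponents: it sends [alpha j] to [aff_alpha (residue j)], and its
    constant term makes the [delta] component of the image of [lam] vanish. *)
Definition fold_map (nu : weight D) : weight DA :=
  ([ffun r => lfun (kap (Some r)) nu], lfun (kap None) nu - lfun (kap None) lam).

Lemma pairing_fold_map nu (t : torus DA) :
  pairing (fold_map nu) t = lfun (kap t) nu - kap_shift t.
Proof. by case: t => [r|] //=; rewrite ffunE subr0. Qed.

Lemma lfun_kap_alpha t j :
  lfun (kap t) (alpha j) = pairing (aff_alpha (residue n j) : weight DA) (t : torus DA).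
Proof.
case: t => [r|]; last first.
  by rewrite [LHS](dual_alpha (fun i => (residue n i == 0)%:R)) [RHS]aff_alpha2.
rewrite [RHS]aff_alpha1 lfun_alpha /kap residue_succ // residue_pred //.
by rewrite !(eq_sym r).
Qed.

Lemma fold_mapD nu j :
  fold_map (nu + alpha j) = fold_map nu + aff_alpha (residue n j).
Proof.
apply: (pairing_inj (affine_graded n_ge1)) => t.
rewrite (pairingD (affine_graded n_ge1)) !pairing_fold_map lfunD lfun_kap_alpha.
by rewrite addrAC.
Qed.

Lemma fold_mapB nu j :
  fold_map (nu - alpha j) = fold_map nu - aff_alpha (residue n j).
Proof. by rewrite -[in RHS](subrK (alpha j) nu) fold_mapD addrK. Qed.

Lemma fold_root_vector_lf b r : locally_finite_family (fold_root_vector b r).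
Proof.
move=> x j /(bdP) [x1 x2 _]; rewrite /fold_root_vector; case: ifP => _; last exact: act0l.
by case: b.
Qed.

Lemma fold_toral_lf t : locally_finite_family (fold_toral t).
Proof. by move=> x j /(bdP) [_ _ x3]; rewrite /fold_toral actZl x3 scaler0. Qed.

Lemma fold_op_linear c : linear (fold_op c).
Proof.
case: c => [r|r|t]; [exact/lf_op_linear/fold_root_vector_lf..|].
move=> a u v /=; rewrite (lf_op_linear (fold_toral_lf t)) scalerDr opprD addrACA.
by rewrite scalerBr !scalerA mulrC.
Qed.

Lemma fold_op_tor t nu x : weight_space V nu x ->
  fold_op (Tor (t : torus DA)) x = (pairing (fold_map nu) (t : torus DA))%:~R *: x.
Proof.
move=> xP; rewrite pairing_fold_map intrB scalerBl /=; congr (_ - _).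
have [C CP] := support_bound nu; pose B := maxn (bd x) C.
rewrite (lf_opE (fold_toral_lf t) (leq_maxl _ C)) /trunc act_suml.
rewrite (lfun_seq _ (ints_uniq B)) => [|k]; last first.
  by rewrite mem_ints -ltnNge gtn_max => /andP [_ /CP].
rewrite raddf_sum scaler_suml; apply: eq_bigr => j _.
by rewrite /fold_toral actZl xP /= scalerA intrM mulrC.
Qed.

(** On each vector, [F] coincides with the elements [A B] for [B] large. Brackets
    pass to the operators, and hence so do the identities between brackets that
    hold for all truncations. *)
Definition approximates (F : V -> V) (A : nat -> g) :=
  forall x, exists B0, forall B, (B0 <= B)%N -> F x = act (A B) x.

Lemma approximates_lf y : locally_finite_family y -> approximates (lf_op y) (trunc y).
Proof. by move=> yP x; exists (bd x) => B; apply: lf_opE. Qed.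

Lemma approximates_bracket F G A A' : approximates F A -> approximates G A' ->
  approximates (fun x => F (G x) - G (F x)) (fun B => bracket (A B) (A' B)).
Proof.
move=> FA GA x; have [b1 F1] := FA x; have [b2 F2] := FA (G x).
have [b3 G1] := GA x; have [b4 G2] := GA (F x).
exists (maxn (maxn b1 b2) (maxn b3 b4)) => B; rewrite !geq_max.
move=> /andP [/andP [B1 B2] /andP [B3 B4]].
by rewrite act_bracket (F2 B) // (G2 B) // (F1 B) // (G1 B).
Qed.

(** ** The Serre relations *)

Lemma fold_root_vector_comm b r i j :
  bracket (fold_root_vector b r i) (fold_root_vector b r j) = 0.
Proof.
rewrite /fold_root_vector; case: eqP => [ri|]; last by rewrite bracket0l.
case: eqP => [rj|]; last by rewrite bracket0r.
by apply: root_vector_comm; apply: residue_not_adjacent n_ge1 _; rewrite ri rj.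
Qed.

Lemma iter_bracket_zero (X Y : g) a b : iter a (bracket X) Y = 0 -> (a <= b)%N ->
  iter b (bracket X) Y = 0.
Proof.
move=> E /subnK <-; rewrite iterD E.
by elim: (b - a)%N => // m IH; rewrite iterS IH bracket0r.
Qed.

(** Both neighbours of [l] may have residue [r] (when [n = 1]); each contributes
    an operator of square zero, whence the exponent [1 - cartan r r']. *)
Lemma fold_serre b r r' B : r != r' ->
  iter `|1 - cartan (r : simple_index DA) (r' : simple_index DA)|%N
    (bracket (trunc (fold_root_vector b r) B)) (trunc (fold_root_vector b r') B) = 0.
Proof.
move=> rr'; set a := absz _; set X := trunc _ B.
have iter_sum m (s : seq int) (F : int -> g) :
    iter m (bracket X) (\sum_(l <- s) F l) = \sum_(l <- s) iter m (bracket X) (F l).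
  by elim: m => // m IH; rewrite iterS IH bracket_sumr.
rewrite [trunc _ B]/trunc iter_sum; apply: big1 => l _.
rewrite {1}/fold_root_vector; case: eqP => [lr'|_]; last first.
  exact: (@iter_bracket_zero _ _ 0).
pose e k := ((k == (l + 1)%R) && (residue n (l + 1)%R == r) +
  ((k == (l - 1)%R) && (residue n (l - 1)%R == r)))%N.
have /choice [A AE] : forall k, exists A : {linear g -> g},
    A =1 bracket (fold_root_vector b r k).
  by move=> k; apply: linear_pack; apply: bracket_linearr.
have nil : iter (\sum_(k <- ints B) e k).+1 (bracket X) (root_vector K b l) = 0.
  have := nilpotent_sum (ints B) (A := A) (a := e) (v := root_vector K b l).
  move=> <-.
  - by apply: eq_iter => z; rewrite bracket_suml; apply: eq_bigr => k _; rewrite AE.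
  - by move=> i j z; rewrite !AE; apply/bracket_comm_ad/fold_root_vector_comm.
  - move=> k; rewrite (eq_iter (AE k)) /fold_root_vector.
    case: eqP => [kr|_]; last by rewrite iterS bracket0l.
    have kl : k != l by apply: contraNneq rr' => kl; rewrite -kr -lr' kl.
    have [s1 s2] := root_vector_serre K b kl.
    have [e0|epos] := posnP (e k); last exact: (@iter_bracket_zero _ _ 2).
    rewrite e0; apply: s2; apply/eqP => kE.
      by move: e0; rewrite /e -kE kr !eqxx.
    have {}kE : k = l - 1 by rewrite kE addrK.
    by move: e0; rewrite /e -kE kr !eqxx addnC.
apply: (iter_bracket_zero nil).
have e_sum c (m : bool) : (\sum_(k <- ints B) ((k == c) && m) <= m)%N.
  case: m; last by rewrite big1 // => k _; rewrite andbF.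
  have -> : (\sum_(k <- ints B) ((k == c) && true) = count_mem c (ints B))%N.
    by rewrite -sum1_count [RHS]big_mkcond; apply: eq_bigr => k _ /=; case: eqP.
  by rewrite count_uniq_mem ?ints_uniq ?leq_b1.
rewrite /e big_split /=.
have := e_sum (l + 1) (residue n (l + 1) == r).
have := e_sum (l - 1) (residue n (l - 1) == r).
rewrite /a /cartan /= aff_alpha1 (negPf rr') -lr' -residue_succ // -residue_pred //.
rewrite !(eq_sym r) mul0rn sub0r.
by case: (_ == r); case: (_ == r) => /=; lia.
Qed.

Hypothesis V_graded : graded V.

Lemma graded_ext (F G : V -> V) : linear F -> linear G ->
  (forall nu x, weight_space V nu x -> F x = G x) -> F =1 G.
Proof.
move=> lF lG FG x; have [f fE] := linear_pack lF; have [h hE] := linear_pack lG.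
apply: (weight_span_ind (S := [set x | F x = G x]) _ _ (V_graded x)) => [|nu y _].
  split=> [|a y z /= yE zE]; first by rewrite /= -fE -hE !linear0.
  by rewrite -fE -hE !linearP /= !fE !hE yE zE.
exact: FG.
Qed.

Lemma fold_op_root_vector b r x : fold_op (if b then Xplus r else Xminus r) x =
  \sum_(j <- ints (bd x) | residue n j == r) act (root_vector K b j) x.
Proof.
have -> : fold_op (if b then Xplus r else Xminus r) x = lf_op (fold_root_vector b r) x.
  by case: b.
rewrite /lf_op /trunc act_suml [RHS]big_mkcond; apply: eq_bigr => j _.
by rewrite /fold_root_vector; case: ifP => // _; rewrite act0l.
Qed.

Definition signed_root (b : bool) (r : 'I_n.+1) : weight DA :=
  if b then aff_alpha r else - aff_alpha r.

Lemma weight_space_root_vector nu b j x : weight_space V nu x ->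
  exists2 mu, weight_space V mu (act (root_vector K b j) x) &
    fold_map mu = fold_map nu + signed_root b (residue n j).
Proof.
move=> xP; case: b.
  exists (nu + alpha j); last exact: fold_mapD.
  exact: (weight_space_raise slinf_graded).
exists (nu - alpha j); last exact: fold_mapB.
exact: (weight_space_lower slinf_graded).
Qed.

Lemma fold_op_tor_root_vector (t : torus DA) b r x :
  fold_op (Tor t) (fold_op (if b then Xplus r else Xminus r) x) -
  fold_op (if b then Xplus r else Xminus r) (fold_op (Tor t) x) =
  (pairing (signed_root b r) t)%:~R *: fold_op (if b then Xplus r else Xminus r) x.
Proof.
have [T TE] := linear_pack (fold_op_linear (Tor t)).
have [X XE] := linear_pack (fold_op_linear (if b then Xplus r else Xminus r)).
rewrite -!XE -!TE; move: x; apply: graded_ext => [a u v|a u v|nu x xP].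
- by do !rewrite linearP /=; rewrite addrACA scalerDr.
- by rewrite linearP /= scalerDr !scalerA mulrC.
rewrite [T x]TE (fold_op_tor t xP) linearZ /= XE fold_op_root_vector linear_sum.
rewrite !scaler_sumr -sumrB; apply: eq_bigr => j /eqP jr /=.
have [mu muP muE] := weight_space_root_vector b j xP.
rewrite TE (fold_op_tor t muP) muE jr (pairingD (affine_graded n_ge1)) intrD.
by rewrite scalerDl addrAC subrr add0r.
Qed.

Lemma fold_op_serre_lf b r r' x : r != r' ->
  term_op fold_op (iter `|1 - cartan (r : simple_index DA) (r' : simple_index DA)|%N
    (LBr (LGen K (if b then Xplus r else Xminus r)))
    (LGen K (if b then Xplus r' else Xminus r'))) x = 0.
Proof.
move=> rr'.
have ap r0 : approximates (term_op fold_op (LGen K (if b then Xplus r0 else Xminus r0)))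
    (trunc (fold_root_vector b r0)).
  by case: (b); apply/approximates_lf/fold_root_vector_lf.
have itap m : approximates
    (term_op fold_op (iter m (LBr (LGen K (if b then Xplus r else Xminus r)))
      (LGen K (if b then Xplus r' else Xminus r'))))
    (fun B => iter m (bracket (trunc (fold_root_vector b r) B))
      (trunc (fold_root_vector b r') B)).
  elim: m => [|m IH]; first exact: ap.
  exact: (approximates_bracket (ap r) IH).
have [B0 E] := itap `|1 - cartan (r : simple_index DA) (r' : simple_index DA)|%N x.
by rewrite (E B0 (leqnn B0)) fold_serre // act0l.
Qed.

Lemma fold_op_plus_minus r r' x :
  fold_op (Xplus r) (fold_op (Xminus r') x) - fold_op (Xminus r') (fold_op (Xplus r) x) =
  if r == r' then fold_op (Tor (Some r : torus DA)) x else 0.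
Proof.
have ap b r0 := approximates_lf (fold_root_vector_lf b r0).
have [B1 E1] := approximates_bracket (ap true r) (ap false r') x.
pose B := maxn B1 (bd x); rewrite [LHS](E1 B) ?leq_maxl //.
have br j k : bracket (root_vector K true j) (root_vector K false k) =
    if j == k then toral K (j : torus D) else 0.
  have := bracket_rel (serre_plus_minus K (j : simple_index D) (k : simple_index D)).
  by move=> E; rewrite [LHS]E; case: ifP.
rewrite /trunc bracket_suml act_suml.
have -> : fold_op (Tor (Some r : torus DA)) x =
    \sum_(j <- ints B) (residue n j == r)%:R *: act (toral K (j : torus D)) x.
  rewrite /= scale0r subr0 (lf_opE (fold_toral_lf (Some r)) (leq_maxr B1 (bd x))).
  rewrite /trunc act_suml; apply: eq_bigr => j _.
  by rewrite /fold_toral actZl /=; case: (_ == r).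
have inner j : j \in ints B -> act (bracket (fold_root_vector true r j)
      (\sum_(k <- ints B) fold_root_vector false r' k)) x =
    if r == r' then (residue n j == r)%:R *: act (toral K (j : torus D)) x else 0.
  move=> jB; rewrite bracket_sumr (bigD1_seq j jB (ints_uniq B)) big1 => [|k kj].
    rewrite Monoid.mulm1 /fold_root_vector; case: (eqVneq (residue n j) r) => [->|_].
      case: (r == r'); last by rewrite bracket0r act0l.
      by rewrite br eqxx scale1r.
    by rewrite bracket0l act0l scale0r; case: ifP.
  rewrite /fold_root_vector; case: ifP => _; last by rewrite bracket0l.
  case: ifP => _; last by rewrite bracket0r.
  by rewrite br eq_sym (negPf kj).
rewrite big_seq; under eq_bigr => j jB do rewrite (inner j jB).
by rewrite -big_seq; case: ifP => // _; rewrite big1.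
Qed.

Lemma fold_op_rel s t : serre_rel (D := DA) s t ->
  term_op fold_op s =1 term_op fold_op t.
Proof.
case=> {s t} [s t|t j|t j|i j|i j ij|i j ij] x.
- have [S SE] := linear_pack (fold_op_linear (Tor s)).
  have [T TE] := linear_pack (fold_op_linear (Tor t)).
  rewrite -[LHS]/(fold_op (Tor s) (fold_op (Tor t) x) - fold_op (Tor t) (fold_op (Tor s) x)).
  rewrite -[RHS]/(0 : V).
  apply/eqP; rewrite subr_eq0; apply/eqP; move: x; apply: graded_ext.
  + by move=> a u v; rewrite -!SE -!TE; do !rewrite linearP /=.
  + by move=> a u v; rewrite -!SE -!TE; do !rewrite linearP /=.
  + move=> nu x xP; rewrite (fold_op_tor s xP) (fold_op_tor t xP).
    rewrite -SE -TE !linearZ /= SE TE (fold_op_tor s xP) (fold_op_tor t xP).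
    by rewrite !scalerA mulrC.
- exact: (fold_op_tor_root_vector t true j x).
- have := fold_op_tor_root_vector t false j x.
  by rewrite /signed_root (pairingN (affine_graded n_ge1)) intrN.
- by have := fold_op_plus_minus i j x; rewrite /=; case: eqP.
- exact: (fold_op_serre_lf true x ij).
- exact: (fold_op_serre_lf false x ij).
Qed.

Definition folded_rep : lieRep (affine n K) :=
  rep_of_ops fold_op_linear fold_op_rel.

Lemma folded_actE c x : act (presented_gen _ c) (x : folded_rep) = fold_op c x.
Proof. exact: rep_of_opsE. Qed.

Lemma weight_space_folded nu x : weight_space V nu x ->
  weight_space folded_rep (fold_map nu) (x : folded_rep).
Proof. by move=> xP t; rewrite [LHS]folded_actE (fold_op_tor t xP). Qed.

(** ** Integrability *)

Hypothesis V_int : forall nu (i : simple_index D), exists N0, forall N, (N0 <= N)%N ->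
  ~ is_weight V (nu + sroot i *+ N) /\ ~ is_weight V (nu - sroot i *+ N).

Lemma root_vector_nilpotent b j x : exists N, iter N (act (root_vector K b j)) x = 0.
Proof.
have itD N (u v : V) a : iter N (act (root_vector K b j)) (a *: u + v) =
    a *: iter N (act (root_vector K b j)) u + iter N (act (root_vector K b j)) v.
  by elim: N => //= N ->; rewrite linearP.
apply: (weight_span_ind (S := [set x | exists N, iter N (act (root_vector K b j)) x = 0])
  _ _ (V_graded x)) => [|nu y _ yP].
  split=> [|a u v [M uM] [N vN]]; first by exists 0%N.
  exists (M + N)%N; rewrite itD.
  rewrite (iter_zero (F := act (root_vector K b j)) uM) ?leq_addr //.
  by rewrite (iter_zero (F := act (root_vector K b j)) vN) ?leq_addl // scaler0 addr0.
have [N /(_ N (leqnn N)) [nr nl]] := V_int nu (j : simple_index D).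
exists N; apply: contrapT => /eqP y0; case: b y0 {itD} => y0.
  by apply: nr; eexists; [exact: y0|apply: (weight_space_iter_raise slinf_graded)].
by apply: nl; eexists; [exact: y0|apply: (weight_space_iter_lower slinf_graded)].
Qed.

(** The operators of one residue commute, so that the iterates of [x] involve
    only the finitely many of them that do not kill [x]. *)
Lemma fold_root_vector_nilpotent b r x :
  exists N, iter N (lf_op (fold_root_vector b r)) x = 0.
Proof.
pose y := fold_root_vector b r; have yP := fold_root_vector_lf b r.
have yC j k (z : V) : act (y j) (act (y k) z) = act (y k) (act (y j) z).
  by apply/eqP; rewrite -subr_eq0 -act_bracket fold_root_vector_comm act0l.
have far N j : (bd x < `|j|)%N -> act (y j) (iter N (act (trunc y (bd x))) x) = 0.
  move=> jx; elim: N => [|N IH] /=; first exact: yP.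
  rewrite act_suml linear_sum big1 // => k _ /=.
  by rewrite yC IH linear0.
have itE N : iter N (lf_op y) x = iter N (act (trunc y (bd x))) x.
  elim: N => // N IH; rewrite !iterS IH; set z := iter N _ x.
  pose B := maxn (bd z) (bd x); rewrite (lf_opE yP (leq_maxl _ _ : bd z <= B)%N).
  rewrite /trunc !act_suml; apply: sum_ints_widen; last exact: leq_maxr.
  by move=> j; apply: far.
have /choice [e eP] : forall j, exists N, iter N.+1 (act (y j)) x = 0.
  move=> j; rewrite /y /fold_root_vector; case: ifP => _; last first.
    by exists 0%N; rewrite /= act0l.
  by have [N xN] := root_vector_nilpotent b j x; exists N; rewrite iterS xN linear0.
have := nilpotent_sum (ints (bd x)) (A := fun j => act (y j) : {linear V -> V}) yC eP.
move=> H; exists (\sum_(i <- ints (bd x)) e i).+1; rewrite itE -[RHS]H.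
by apply: eq_iter => z; rewrite act_suml.
Qed.

Lemma folded_integrable : integrable folded_rep.
Proof.
move=> r x; have [N xN] := fold_root_vector_nilpotent true r x.
have [M xM] := fold_root_vector_nilpotent false r x; exists (M + N)%N.
split.
  apply: (iter_zero (F := act _) (N := N)); last exact: leq_addl.
  by rewrite -xN; apply: eq_iter => z; apply: folded_actE.
apply: (iter_zero (F := act _) (N := M)); last exact: leq_addr.
by rewrite -xM; apply: eq_iter => z; apply: folded_actE.
Qed.

(** ** Characters *)

Hypotheses (V_simple : simple_rep V) (V_hw : is_highest_weight V lam).
Hypothesis V_fin : finite_weights V.

Lemma fold_map_word (w : seq int) :
  fold_map (lam - root_sum (w : seq (simple_index D))) =
  fold_map lam - root_sum ([seq residue n i | i <- w] : seq (simple_index DA)).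
Proof.
elim: w => [|i w IH]; first by rewrite /root_sum !big_nil !subr0.
have cons (E : rootDatum) (j : simple_index E) u : root_sum (j :: u) = sroot j + root_sum u.
  exact: big_cons.
have sub (A : zmodType) (a b c : A) : a - (b + c) = a - c - b.
  by rewrite opprD addrA addrAC.
by rewrite /= !cons (sub _ lam (alpha i)) [LHS]fold_mapB IH [RHS]sub.
Qed.

Lemma fold_map_le nu : is_weight V nu -> Qplus (fold_map lam - fold_map nu : weight DA).
Proof.
move=> /(highest_weight_bounded slinf_graded V_hw) /QplusP [w wE].
apply/QplusP; exists [seq residue n i | i <- (w : seq int)].
have <- : lam - root_sum w = nu by rewrite -wE; apply: subKr.
by rewrite fold_map_word; apply: subKr.
Qed.

(** A weight of [V] is the weight of a word that does not kill the highest weight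
    vector, and the letters of such a word are linked to the support of [lam]. *)
Lemma weight_word : exists M : nat, forall nu, is_weight V nu ->
  exists2 w : seq int, nu = lam - root_sum (w : seq (simple_index D)) &
    forall i, i \in w -> (`|i| <= M + size w)%N.
Proof.
have [v [v0 vP vr vgen]] := is_highest_weightE slinf_graded V_hw.
have [M lM] := support_bound lam; exists M => nu [x x0 xP].
have [w wE w0] : exists2 w, nu = lam - root_sum w & lower_word w v != 0.
  apply: contrapT => noW; case/eqP: x0.
  apply: (@weight_span_eq0 _ _ _ slinf_graded V (fun mu => mu <> nu) nu) => //.
  apply: (vgen x); first exact: weight_span_subspace.
  move=> w; have wP := weight_space_word slinf_graded w vP.
  have [->|w0] := eqVneq (lower_word w v) 0; first exact: (weight_span_subspace V _).1.
  by apply: weight_span1 wP _ => wE; apply: noW; exists w.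
by exists w => //; apply: (word_letters V_simple vP vr v0 lM w0).
Qed.

(** The height of [mu] determines the length of the words, and this length bounds
    their letters. *)
Lemma fold_fibre_finite (mu : weight DA) : exists s : seq (weight D),
  uniq s /\ forall nu, nu \in s <-> is_weight V nu /\ fold_map nu = mu.
Proof.
have [M MP] := weight_word; pose d := `|aff_ht (fold_map lam) - aff_ht mu|%N.
exists [seq nu <- undup [seq lam - root_sum w | w <- words_upto (D := D) (ints (M + d)) d]
  | (fold_map nu == mu) && `[< is_weight V nu >]].
split=> [|nu]; first by rewrite filter_uniq // undup_uniq.
rewrite mem_filter mem_undup; split=> [/andP [/andP [/eqP ? /asboolP ?] _] //|[nuP numu]].
rewrite numu eqxx /=; apply/andP; split; first exact/asboolP.
have [w wE wM] := MP nu nuP; have wd : (size w <= d)%N.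
  have := ht_root_sum (affine_graded n_ge1) ([seq residue n i | i <- w] : seq (simple_index DA)).
  have -> : root_sum ([seq residue n i | i <- w] : seq (simple_index DA)) =
      fold_map lam - mu by rewrite -numu wE fold_map_word; apply/esym/subKr.
  by rewrite (htB (affine_graded n_ge1)) size_map /d; lia.
have ww : (w : seq (simple_index D)) \in words_upto (D := D) (ints (M + d)) d.
  apply: (@words_uptoP D) => // i iw.
  have iM : (`|i : int| <= M + d)%N by rewrite (leq_trans (wM i iw)) // leq_add2l.
  by have := mem_ints (M + d) i; rewrite iM.
rewrite wE; exact: (map_f (fun w : seq (simple_index D) => lam - root_sum w) ww).
Qed.

(** Both actions are diagonal, and a weight decomposition for [V] refines one for
    the folded action. *)
Lemma weight_space_foldedE mu (s : seq (weight D)) :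
  (forall nu, nu \in s <-> is_weight V nu /\ fold_map nu = mu) ->
  weight_space folded_rep mu = weight_span (V := V) (fun nu => nu \in s).
Proof.
move=> sP; have sW := weight_space_subspace folded_rep mu.
apply/seteqP; split=> [x xP|]; last first.
  apply: (weight_span_ind (V := V) (S := weight_space folded_rep mu) sW).
  by move=> nu x /sP [_ <-]; apply: weight_space_folded.
have [t [u [ut _ uP xE]]] := weight_span_uniq (V_graded x).
have in_s nu : fold_map nu = mu -> weight_span (V := V) (fun nu => nu \in s) (u nu).
  move=> numu; have [->|u0] := eqVneq (u nu) 0.
    exact: (weight_span_subspace V _).1.
  by apply: weight_span1 (uP nu) _; apply/sP; split=> //; exists (u nu).
have low : weight_space folded_rep mu (\sum_(nu <- t | fold_map nu == mu) u nu : V).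
  by apply: (subspace_sum _ sW) => nu /eqP <-; apply: weight_space_folded.
have xE' : x = (\sum_(nu <- t | fold_map nu == mu) u nu : V) +
    \sum_(nu <- t | fold_map nu != mu) u nu.
  by rewrite xE [LHS](bigID (fun nu => fold_map nu == mu)).
set z := (\sum_(nu <- t | fold_map nu != mu) u nu : V) in xE'.
have zmu : weight_space folded_rep mu z.
  have -> : z = x - (\sum_(nu <- t | fold_map nu == mu) u nu : V).
    by rewrite {1}xE' addrC addKr.
  exact: (subspaceB sW xP low).
have znmu : weight_span (V := folded_rep) (fun mu' => mu' <> mu) z.
  apply: (subspace_sum _ (weight_span_subspace folded_rep (fun mu' => mu' <> mu))) => nu /eqP nm.
  exact: weight_span1 (weight_space_folded (uP nu)) nm.
have z0 : z = 0 by apply: (weight_span_eq0 (affine_graded n_ge1) _ zmu znmu); case.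
rewrite xE' z0 addr0; apply: subspace_sum => [|nu /eqP]; last exact: in_s.
exact: weight_span_subspace.
Qed.

Lemma folded_character_sum mu (s : seq (weight D)) : uniq s ->
  (forall nu, nu \in s <-> is_weight V nu /\ fold_map nu = mu) ->
  has_dim (weight_space folded_rep mu) (\sum_(nu <- s) character V nu)%N.
Proof.
move=> us sP; rewrite (weight_space_foldedE sP).
exact: (has_dim_weight_span slinf_graded V_fin us).
Qed.

Lemma folded_good : good_rep (fold_map lam : weight DA) folded_rep.
Proof.
split; last exact: folded_integrable.
- move=> x; apply: (weight_span_ind _ _ (V_graded x)) => [|nu y _ yP].
    exact: weight_span_subspace.
  exact: weight_span1 (weight_space_folded yP) _.
- move=> mu; have [s [us sP]] := fold_fibre_finite mu.
  by eexists; apply: folded_character_sum us sP.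
- move=> mu [x x0 xP]; have [s [us sP]] := fold_fibre_finite mu.
  case: s us sP => [|nu s] us sP.
    have := has_dim_eq0 (weight_space_subspace folded_rep mu) _ xP.
    have := folded_character_sum us sP; rewrite big_nil => d0 /(_ d0) xz.
    by move: x0; rewrite xz eqxx.
  have /sP [nuP <-] := mem_head nu s; exact: fold_map_le.
Qed.

Lemma fold_weightE m : fold_weight n lam m = fold_map (lower_weight lam m).
Proof.
have fold_sum (I : Type) (r : seq I) (F : I -> int) (e : I -> nat) :
    fold_map (lam - \sum_(j <- r) alpha (F j) *+ e j) =
    fold_map lam - \sum_(j <- r) aff_alpha (residue n (F j)) *+ e j.
  elim: r => [|j r IH]; first by rewrite !big_nil !subr0.
  rewrite !big_cons; elim: (e j) => [|k IHk]; first by rewrite !mulr0n !add0r.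
  have step (A : zmodType) (a b c : A) : a - (b *+ k.+1 + c) = a - (b *+ k + c) - b.
    by rewrite mulrSr addrAC [X in a - X]addrC opprD addrA addrAC.
  by rewrite (step _ lam (alpha (F j))) [LHS]fold_mapB IHk [RHS]step.
rewrite /lower_weight (fold_sum _ _ id) /fold_weight; congr (_ - _).
have fundZ (r a : 'I_n.+1) (z : int) : (aff_fund r *~ z).1 a = z * (r == a)%:R /\
    (aff_fund r *~ z).2 = 0.
  have fundM (k : nat) : (aff_fund r *+ k).1 a = k%:Z * (r == a)%:R /\ (aff_fund r *+ k).2 = 0.
    elim: k => [|k [IH1 IH2]]; first by rewrite mulr0n ffunE mul0r.
    by rewrite mulrS /= !ffunE IH1 IH2 eq_sym addr0 intS mulrDl mul1r.
  case: z => k; first exact: fundM.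
  have [E1 E2] := fundM k.+1.
  by rewrite NegzE mulrNz /= !ffunE E1 E2 oppr0 mulNr.
have fsum1 (r : seq int) : (\sum_(i <- r) aff_fund (residue n i) *~ lam@_i).1 =
    [ffun a => \sum_(i <- r) lam@_i * (residue n i == a)%:R].
  elim: r => [|i r IH]; apply/ffunP => a.
    by rewrite !big_nil !ffunE big_nil.
  by rewrite !big_cons [in LHS]/= !ffunE big_cons IH ffunE (fundZ _ _ _).1.
have fsum2 (r : seq int) : (\sum_(i <- r) aff_fund (residue n i) *~ lam@_i).2 = 0.
  elim: r => [|i r IH]; first by rewrite big_nil.
  by rewrite big_cons /= IH (fundZ _ 0 _).2 addr0.
by rewrite [LHS]surjective_pairing fsum1 fsum2 /fold_map subrr.
Qed.

Lemma lower_weight_inj : injective (lower_weight (lam : P)).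
Proof.
move=> m m' E; apply/fsfunP => j.
have coef (m0 : {fsfun int -> nat with 0%N}) :
    dual (fun i => (i == j)%:R) (lam - lower_weight (lam : P) m0) = m0 j.
  rewrite /lower_weight opprB addrC subrK /dual lfun_sum.
  rewrite (eq_bigr (fun i => (i == j)%:R *+ m0 i)) => [|i _]; last first.
    by rewrite lfunMn; congr (_ *+ _); apply: dual_alpha.
  have [jm|jm] := boolP (j \in finsupp m0).
    rewrite (bigD1_seq j) ?fset_uniq //= eqxx big1 ?addr0 => [|i /negPf ->].
      exact: natz.
    exact: mul0rn.
  rewrite (fsfun_dflt jm) big_seq big1 // => i im.
  rewrite (negPf (_ : i != j)); first exact: mul0rn.
  by apply: contraNneq jm => <-.
by have := coef m; rewrite E coef => -[].
Qed.

Lemma lower_weight_word (w : seq int) :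
  exists m, lower_weight (lam : P) m = lam - root_sum (w : seq (simple_index D)).
Proof.
pose m : {fsfun int -> nat with 0%N} := [fsfun j in [fset i in w]%fset => count_mem j w].
have mE j : m j = count_mem j w.
  rewrite fsfunE in_fset; case: ifP => // /negbT jw.
  by apply/esym/count_memPn.
have sumE : \sum_(j <- undup w) alpha j *+ m j = \sum_(j <- finsupp m) alpha j *+ m j.
  rewrite (bigID (mem (finsupp m))) /= [X in _ + X]big1 ?addr0 => [|j jm]; last first.
    by rewrite (fsfun_dflt jm).
  rewrite -big_filter; apply: perm_big; apply: uniq_perm => [||j].
  - by rewrite filter_uniq // undup_uniq.
  - exact: fset_uniq.
  - rewrite mem_filter mem_undup /= mem_finsupp mE.
    by case: (boolP (j \in w)); rewrite ?andbT // => /count_memPn ->.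
exists m; congr (_ - _); rewrite -sumE.
rewrite (eq_bigr (fun j => alpha j *+ count_mem j w)) => [|j _]; last by rewrite mE.
exact: (big_undup_iterop_count _ w xpredT alpha).
Qed.

Lemma character_folded mu : character folded_rep mu =
  (\big[addn/0%N]_(m \in [set m | fold_weight n (lam : P) m = mu])
    character V (lower_weight (lam : P) m))%N.
Proof.
have [s [us sP]] := fold_fibre_finite mu.
rewrite (characterE (folded_character_sum us sP)).
have /choice [h hE] : forall nu, exists m, nu \in s -> lower_weight (lam : P) m = nu.
  move=> nu; case: (boolP (nu \in s)) => [/sP [nuP _]|_]; last by exists [fsfun].
  have /QplusP [w wE] := highest_weight_bounded slinf_graded V_hw nuP.
  by have [m mE] := lower_weight_word w; exists m => _; rewrite mE -wE; apply: subKr.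
rewrite (fsbigE [seq h nu | nu <- s]).
- rewrite big_map [LHS]big_seq [RHS]big_seq_cond; apply: eq_big => [nu|nu nus].
    case: (boolP (nu \in s)) => // nus /=; apply/esym/mem_set => /=.
    by rewrite fold_weightE hE //; have /sP [] := nus.
  by rewrite hE.
- by rewrite map_inj_in_uniq // => x y xs ys hxy; rewrite -(hE x xs) hxy hE.
- move=> _ /mapP [nu nus ->] /=; rewrite fold_weightE hE //.
  by have /sP [] := nus.
- move=> m /= mmu mr; apply/eqP; rewrite -leqn0 leqNgt; apply/negP.
  move=> /(character_gt0 _ V_fin) mP; case/negP: mr.
  have ms : lower_weight (lam : P) m \in s by apply/sP; rewrite -fold_weightE.
  by apply/mapP; exists (lower_weight (lam : P) m) => //; apply: lower_weight_inj; rewrite hE.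
Qed.

End Folding.

Theorem proposition5p1 (R : realType) (n : nat) (n_ge1 : (1 <= n)%N)
    (V : lieRep (slinf R[i])) (V_Oint : category_Oint V)
    (V_simple : simple_rep V) :
  [/\ exists W : lieRep (affine n R[i]),
        [/\ integrable W, category_O W
          & forall mu, character W mu = folded_character n V mu],
      exists m : lieRep (affine n R[i]) -> int,
        is_decomposition (folded_character n V) m
    & forall m : lieRep (affine n R[i]) -> int,
        is_decomposition (folded_character n V) m ->
        forall W, simple_integrable W -> 0 <= m W].
Proof.
have [V_O V_int] := V_Oint; have [/(weight_direct_sumP slinf_graded) V_gr V_fin _] := V_O.
have V_hw := highest_weightP (simple_highest_weight slinf_graded V_simple V_O).
have [bd bdP] := choice (locally_finite V_simple V_hw).
pose W := folded_rep n_ge1 (highest_weight V) bdP V_gr.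
have W_good := folded_good n_ge1 bdP V_gr V_int V_simple V_hw V_fin.
have W_char mu : character W mu = folded_character n V mu.
  exact: (character_folded n_ge1 bdP V_gr V_simple V_hw V_fin).
have idxP (i : 'I_n.+1) : i \in enum 'I_n.+1 by rewrite mem_enum.
have [m0 m0P m0_ge0] := good_decomposition (affine_graded n_ge1) idxP W_good.
rewrite (funext W_char) in m0P.
split; last 1 first.
- move=> m mP U U_simple.
  by rewrite (decomposition_uniq (affine_graded n_ge1) mP m0P U_simple).
- exists W; split=> //; first by case: W_good.
  exact: (good_category_O (affine_graded n_ge1) W_good).
- by exists m0.
Qed.
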